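(* Let $F$ be a field of characteristic $p>0$ and let $\mathfrak F$ be a saturated formation of soluble Lie algebras over $F$. Let $(L,[p])$ be a finite-dimensional restricted Lie algebra over $F$ such that $z^{[p]}=0$ for every $z$ in the centre of $L$. Let $S$ be a nonzero subnormal subalgebra of $L$ with $S\in\mathfrak F$. Let $V$ and $W$ be finite-dimensional $L$-modules such that $\mathrm{cl}(W)\subseteq \mathbb F_p\,\mathrm{cl}(V)$, and suppose that $V$, regarded as an $S$-module, is $\mathfrak F$-hypercentral. Then $W$, regarded as an $S$-module, is $\mathfrak F$-hypercentral.
   Context: All Lie algebras and modules are finite-dimensional. A formation $\mathfrak F$ of soluble Lie algebras over $F$ is a class of soluble Lie algebras closed under homomorphic images and such that if $L/A, L/B\in\mathfrak F$ for ideals $A,B$ of $L$ then $L/(A\cap B)\in\mathfrak F$; it is saturated if $L/\Phi(L)\in\mathfrak F$ implies $L\in\mathfrak F$, where $\Phi(L)$ is the Frattini subalgebra (intersection of maximal subalgebras). A subalgebra $S$ of $L$ is subnormal if there is a chain $S=S_0\subseteq S_1\subseteq\cdots\subseteq S_n=L$ with each $S_{i}$ an ideal of $S_{i+1}$. For $S\in\mathfrak F$, an irreducible $S$-module $M$ is $\mathfrak F$-central if the split extension of $M$ (as an abelian ideal) by $S/C_S(M)$ belongs to $\mathfrak F$, where $C_S(M)$ is the centralizer of $M$ in $S$; an $S$-module is $\mathfrak F$-hypercentral if every composition factor of it is $\mathfrak F$-central. Let $\bar F$ be the algebraic closure of $F$. If $\rho$ is the representation of $L$ on an $L$-module $U$,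 then $U$ has character $\chi$, where $\chi: L\to \bar F$, if $\rho(x)^p-\rho(x^{[p]})$ acts as the scalar $\chi(x)^p$ for all $x\in L$ (on $\bar F\otimes U$); every irreducible module of $\bar F\otimes L$ has a character. The character cluster $\mathrm{cl}(U)$ of an $L$-module $U$ is the set of characters of the composition factors of $\bar F\otimes_F U$ (as a module for $\bar F\otimes L$, restricted to $L$). $\mathbb F_p$ denotes the field with $p$ elements and $\mathbb F_p\,\mathrm{cl}(V)$ denotes the set of $\mathbb F_p$-linear combinations of the elements of $\mathrm{cl}(V)$ (as functions on $L$). *)

(* Defs.v *)
From HB Require Import structures.
From mathcomp Require Import all_boot all_order all_algebra.
From Stdlib Require List.

Set Implicit Arguments.
Unset Strict Implicit.
Unset Printing Implicit Defensive.

Import GRing.Theory.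
Local Open Scope ring_scope.

Record lieAlgebra (F : fieldType) := LieAlgebra {
  lie_sort :> vectType F;
  lie_br : lie_sort -> lie_sort -> lie_sort;
  lie_brDl : forall (a : F) (x y z : lie_sort),
      lie_br (a *: x + y) z = a *: lie_br x z + lie_br y z;
  lie_brDr : forall (a : F) (x y z : lie_sort),
      lie_br z (a *: x + y) = a *: lie_br z x + lie_br z y;
  lie_brxx : forall x : lie_sort, lie_br x x = 0;
  lie_jacobi : forall x y z : lie_sort,
      lie_br x (lie_br y z) + lie_br y (lie_br z x) + lie_br z (lie_br x y) = 0
}.

Arguments lie_br {F L} : rename.

Section LieDefs.
Variable F : fieldType.

Definition lie_hom (L M : lieAlgebra F) (f : L -> M) : Prop :=
  (forall (a : F) (x y : L), f (a *: x + y) = a *: f x + f y) /\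
  (forall x y : L, f (lie_br x y) = lie_br (f x) (f y)).

Definition surj (A B : Type) (f : A -> B) : Prop := forall y, exists x, f x = y.

Definition subalgebra (L : lieAlgebra F) (S : {vspace L}) : Prop :=
  forall x y : L, x \in S -> y \in S -> lie_br x y \in S.

Definition ideal_in (L : lieAlgebra F) (I T : {vspace L}) : Prop :=
  (I <= T)%VS /\ forall x y : L, x \in T -> y \in I -> lie_br x y \in I.

Definition subnormal (L : lieAlgebra F) (S : {vspace L}) : Prop :=
  exists (n : nat) (c : nat -> {vspace L}),
    c 0%N = S /\ c n = fullv /\
    (forall i, (i <= n)%N -> subalgebra (c i)) /\
    (forall i, (i < n)%N -> ideal_in (c i) (c i.+1)).

Definition maximal_subalgebra (L : lieAlgebra F) (M : {vspace L}) : Prop :=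
  subalgebra M /\ M != fullv /\
  forall N : {vspace L}, subalgebra N -> (M <= N)%VS -> N = M \/ N = fullv.

Definition in_frattini (L : lieAlgebra F) (x : L) : Prop :=
  forall M : {vspace L}, maximal_subalgebra M -> x \in M.

Definition in_centre (L : lieAlgebra F) (z : L) : Prop :=
  forall x : L, lie_br z x = 0.

Definition derived_step (L : lieAlgebra F) (U : {vspace L}) : {vspace L} :=
  <<[seq lie_br x y | x <- vbasis U, y <- vbasis U]>>%VS.

Definition derived (L : lieAlgebra F) (k : nat) : {vspace L} :=
  iter k (@derived_step L) fullv.

Definition soluble (L : lieAlgebra F) : Prop := exists k, derived L k = 0%VS.

Definition lie_class := forall L : lieAlgebra F, Prop.

Definition formation (Fo : lie_class) : Prop :=
  (forall L, Fo L -> soluble L) /\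
  (forall (L M : lieAlgebra F) (f : L -> M),
      lie_hom f -> surj f -> Fo L -> Fo M) /\
  (* L/A, L/B in Fo  ==>  L/(A cap B) in Fo *)
  (forall (L M N P : lieAlgebra F) (f : L -> M) (g : L -> N) (h : L -> P),
      lie_hom f -> surj f -> lie_hom g -> surj g -> lie_hom h -> surj h ->
      (forall x, h x = 0 <-> (f x = 0 /\ g x = 0)) ->
      Fo M -> Fo N -> Fo P).

Definition saturated_formation (Fo : lie_class) : Prop :=
  formation Fo /\
  (* L / Phi(L) in Fo  ==>  L in Fo *)
  (forall (L M : lieAlgebra F) (h : L -> M),
      lie_hom h -> surj h -> (forall x, h x = 0 <-> in_frattini x) ->
      Fo M -> Fo L).

(* A subalgebra S of L belongs to Fo (as a Lie algebra in its own right):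
   it is the image of an injective homomorphism from a member of Fo. *)
Definition sub_in_class (Fo : lie_class) (L : lieAlgebra F) (S : {vspace L}) :
  Prop :=
  exists (M : lieAlgebra F) (f : M -> L),
    Fo M /\ lie_hom f /\ injective f /\ (forall y, y \in S <-> exists x, f x = y).

(* s_i(x,y), defined by  i s_i(x,y) = coefficient of t^(i-1) in
   ad(tx+y)^(p-1)(x). *)
Definition jac_s (L : lieAlgebra F) (p i : nat) (x y : L) : L :=
  (i%:R : F)^-1 *:
    \sum_(w : (p.-1).-tuple bool | count id w == i.-1)
       foldr (fun b v => lie_br (if b then x else y) v) x w.

Definition restricted (L : lieAlgebra F) (p : nat) (pm : L -> L) : Prop :=
  (forall (a : F) (x : L), pm (a *: x) = a ^+ p *: pm x) /\
  (forall x y : L, lie_br (pm x) y = iter p (lie_br x) y) /\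
  (forall x y : L,
      pm (x + y) = pm x + pm y + \sum_(1 <= i < p) jac_s p i x y).

(* An L-module of dimension n is F^n (row vectors) with x.v := v *m rho x.   *)

Definition lie_rep (L : lieAlgebra F) (n : nat) (rho : L -> 'M[F]_n) : Prop :=
  (forall (a : F) (x y : L), rho (a *: x + y) = a *: rho x + rho y) /\
  (forall x y : L, rho (lie_br x y) = rho y *m rho x - rho x *m rho y).

End LieDefs.

Section Series.
Variables (K : fieldType) (n : nat) (I : Type) (P : I -> Prop) (r : I -> 'M[K]_n).

Definition mx_stable (U : 'M[K]_n) : Prop :=
  forall i, P i -> (U *m r i <= U)%MS.

Definition irr_factor (U' U : 'M[K]_n) : Prop :=
  (U' < U)%MS /\
  forall W : 'M[K]_n, mx_stable W -> (U' <= W)%MS -> (W <= U)%MS ->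
    (W == U')%MS \/ (W == U)%MS.

Definition comp_series (k : nat) (c : nat -> 'M[K]_n) : Prop :=
  (c 0%N == (0 : 'M[K]_n))%MS /\ (c k == (1%:M : 'M[K]_n))%MS /\
  forall i, (i < k)%N -> mx_stable (c i) /\ mx_stable (c i.+1) /\
                         irr_factor (c i) (c i.+1).
End Series.

Section Central.
Variables (F : fieldType) (Fo : lie_class F) (L : lieAlgebra F)
          (S : {vspace L}) (n : nat) (rho : L -> 'M[F]_n).

Definition in_centralizer (U' U : 'M[F]_n) (s : L) : Prop :=
  s \in S /\ forall u : 'rV[F]_n, (u <= U)%MS -> (u *m rho s <= U')%MS.

(* The irreducible S-factor M = U / U' is Fo-central: the split extension of
   M (as an abelian ideal) by S / C_S(M) belongs to Fo.  This split extension
   is described up to isomorphism: X = A (+) Q, A abelian ideal identified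
   with M by phi, Q a subalgebra identified with S / C_S(M) by pi, and the
   adjoint action of Q on A corresponding to the action of S on M. *)
Definition Fcentral_factor (U' U : 'M[F]_n) : Prop :=
  exists (X : lieAlgebra F) (A Q : {vspace X})
         (phi : 'rV[F]_n -> X) (pi : L -> X),
    Fo X /\
    (A + Q)%VS = fullv /\ (A :&: Q)%VS = 0%VS /\
    (forall a b : X, a \in A -> b \in A -> lie_br a b = 0) /\
    (forall (c : F) (u v : 'rV[F]_n), phi (c *: u + v) = c *: phi u + phi v) /\
    (forall u, (u <= U)%MS -> phi u \in A) /\
    (forall a, a \in A -> exists2 u, (u <= U)%MS & phi u = a) /\
    (forall u, (u <= U)%MS -> (phi u = 0 <-> (u <= U')%MS)) /\
    (forall (c : F) (s t : L), s \in S -> t \in S ->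
        pi (c *: s + t) = c *: pi s + pi t) /\
    (forall s t : L, s \in S -> t \in S -> pi (lie_br s t) = lie_br (pi s) (pi t)) /\
    (forall s, s \in S -> pi s \in Q) /\
    (forall q, q \in Q -> exists2 s, s \in S & pi s = q) /\
    (forall s, s \in S -> (pi s = 0 <-> in_centralizer U' U s)) /\
    (forall s u, s \in S -> (u <= U)%MS -> lie_br (pi s) (phi u) = phi (u *m rho s)).

Definition Fhypercentral : Prop :=
  forall (k : nat) (c : nat -> 'M[F]_n),
    comp_series (fun x : L => x \in S) rho k c ->
    forall i, (i < k)%N -> Fcentral_factor (c i) (c i.+1).
End Central.

(* Characters and character clusters, computed in an algebraically closed   *)
(* extension K of F (given by a field embedding f : F -> K).                 *)

Section Characters.
Variables (F : fieldType) (K : fieldType) (f : {rmorphism F -> K})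
          (L : lieAlgebra F) (p : nat) (pm : L -> L).

(* chi is the character of some composition factor of K (x) F^n as a
   module for K (x) L (equivalently, for the K-span of the image of L). *)
Definition in_cl (n : nat) (rho : L -> 'M[F]_n) (chi : L -> K) : Prop :=
  exists (k : nat) (c : nat -> 'M[K]_n),
    comp_series (fun _ : L => True) (fun x => map_mx f (rho x)) k c /\
    exists2 i, (i < k)%N &
      forall (x : L) (u : 'rV[K]_n), (u <= c i.+1)%MS ->
        (u *m (map_mx f (rho x) ^+ p - map_mx f (rho (pm x)))
           - chi x ^+ p *: u <= c i)%MS.

(* F_p-linear combinations of characters in a set (as functions on L);
   natural-number coefficients suffice since char K = p. *)
Definition Fp_span (C : (L -> K) -> Prop) (psi : L -> K) : Prop :=
  exists s : seq (nat * (L -> K)),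
    (forall c, Stdlib.Lists.List.In c s -> C c.2) /\
    forall x : L, psi x = \sum_(c <- s) (c.1)%:R * c.2 x.
End Characters.

(* Main.v *)
(** Call a module M of an algebra S in the formation good if its split extension
    by S lies in the formation. If a submodule U and the quotient V / U are good,
    so is V: either U lies in the Frattini subalgebra of the split extension of V,
    or a maximal subalgebra complements U (or part of it) and the split extension
    is a subdirect product of two members of the formation. Hence good is the same
    as hypercentral. The Heisenberg extension of M1 + M2 by M1 (x) M2, whose centre
    lies in the Frattini subalgebra, shows that tensor products are good.

    As S is subnormal, the adjoint module of L is good for S. Its kernel is the
    centre of L, so its matrix coefficients generate all functions on the
    restricted enveloping algebra of L / Z(L), by a Taylor expansion. Hence every
    L-module on which rho(x)^p = rho(x^[p]) has a good submodule, the hypothesis on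
    the centre making Z(L) act as zero on its irreducible submodules.

    Finally, if a quotient T of W has the character sum_i a_i chi_i, with chi_i in
    cl(V), then iterating Hom(V, -) on T leads to a module with the character 0,
    which contains a good submodule; the evaluation maps Hom(V, T) (x) V -> T bring
    it back to a nonzero good submodule of T. *)

Require Import Defs.
From HB Require Import structures.
From mathcomp Require Import all_boot all_order all_algebra.
From mathcomp Require Import ring zify.
From Stdlib Require Import Classical ClassicalEpsilon.

Set Implicit Arguments.
Unset Strict Implicit.
Unset Printing Implicit Defensive.

Import GRing.Theory VectorInternalTheory.
Local Open Scope ring_scope.

Notation "[lie x , y ]" := (lie_br x y) (at level 0, x, y at level 99).

(** * Linear maps and subspaces *)

(** Three obstacles shape the development. A formation need not contain the subalgebras or ideals of
    its members, so a split extension is shown to lie in [Fo] by exhibiting it as a homomorphic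
    image or subdirect product of known members, or by the Frattini condition. Characters live over
    [K] while the formation lives over [F]: a common eigenvector of the operators rho(x)^p -
    rho(x^[p]) over [K] has no reason to descend to [F], but for eigenvalue 0 it solves a linear
    system over [F] and does descend; hence the effort to shift weights to 0. The restricted
    enveloping algebra itself is never built: functions on words in [L] that respect its relations
    take the place of its dual, filtered by word length. On words of its leading length such a
    function is symmetric and vanishes as soon as a letter occurs p times, so its leading part
    behaves like a polynomial with all exponents below p, which makes the Taylor expansion possible
    and finite. *)

Lemma ex_min_measure (T : Type) (P : T -> Prop) (m : T -> nat) :
  (exists x, P x) -> exists2 x, P x & forall y, P y -> (m x <= m y)%N.
Proof.
case=> x0; have [n] := ubnP (m x0).
elim: n x0 => // n IH x0 ltn Px0.
case: (classic (forall y, P y -> (m x0 <= m y)%N)) => [min|nmin]; first by exists x0.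
have [y [Py lty]] : exists y, P y /\ (m y < m x0)%N.
  apply: NNPP => no; apply: nmin => y Py; rewrite leqNgt; apply/negP => lty.
  by apply: no; exists y.
by apply: (IH y) => //; apply: leq_trans lty _; rewrite -ltnS.
Qed.

Lemma ex_max_measure (T : Type) (P : T -> Prop) (m : T -> nat) (b : nat) :
  (exists x, P x) -> (forall x, P x -> (m x <= b)%N) ->
  exists2 x, P x & forall y, P y -> (m y <= m x)%N.
Proof.
move=> exP mb.
have [x Px min] := ex_min_measure (fun x => b - m x)%N exP.
by exists x => // y Py; have := min y Py; have := mb y Py; have := mb x Px; lia.
Qed.

Lemma choice_fun (A B : Type) (R : A -> B -> Prop) :
  (forall a, exists b, R a b) -> exists g : A -> B, forall a, R a (g a).
Proof.
move=> H; exists (fun a => proj1_sig (constructive_indefinite_description _ (H a))).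
by move=> a; case: constructive_indefinite_description.
Qed.

Section Coord.
Variables (F : fieldType) (V : vectType F).

Definition crd i (v : V) : F := v2r v 0 i.

Lemma crdD i x y : crd i (x + y) = crd i x + crd i y.
Proof. by rewrite /crd (linearD v2r) mxE. Qed.

Lemma crdN i x : crd i (- x) = - crd i x.
Proof. by rewrite /crd (linearN v2r) mxE. Qed.

Lemma crdZ i a x : crd i (a *: x) = a * crd i x.
Proof. by rewrite /crd (linearZZ v2r) mxE. Qed.

Lemma crd0 i : crd i 0 = 0.
Proof. by rewrite /crd (linear0 v2r) mxE. Qed.

Lemma crdP x y : (forall i, crd i x = crd i y) -> x = y.
Proof.
by move=> H; apply: v2r_inj; apply/rowP => i; apply: H.
Qed.

End Coord.

(** Vector identities become identities in [F] after passing to coordinates. Brackets and actions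
    are atoms, so they must be expanded beforehand. *)
Ltac vring := apply: crdP => ?; rewrite ?(crdD, crdN, crdZ, crd0); ring.

Definition lin (F : fieldType) (V W : lmodType F) (f : V -> W) :=
  forall a x y, f (a *: x + y) = a *: f x + f y.

Section Lin.
Variables (F : fieldType) (V W : lmodType F) (f : V -> W).
Hypothesis lf : lin f.

Lemma linf0 : f 0 = 0.
Proof. by have := lf (-1) 0 0; rewrite scaler0 addr0 scaleN1r addNr. Qed.

Lemma linfD x y : f (x + y) = f x + f y.
Proof. by have := lf 1 x y; rewrite !scale1r. Qed.

Lemma linfZ a x : f (a *: x) = a *: f x.
Proof. by have := lf a x 0; rewrite linf0 !addr0. Qed.

Lemma linfN x : f (- x) = - f x.
Proof. by rewrite -scaleN1r linfZ scaleN1r. Qed.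

Lemma linfB x y : f (x - y) = f x - f y.
Proof. by rewrite linfD linfN. Qed.

Lemma linf_sum (I : Type) (r : seq I) (P : pred I) (E : I -> V) :
  f (\sum_(i <- r | P i) E i) = \sum_(i <- r | P i) f (E i).
Proof.
by elim/big_rec2: _ => [|i y x _ <-]; [exact: linf0 | exact: linfD].
Qed.

Lemma linf_inj : (forall x, f x = 0 -> x = 0) -> injective f.
Proof.
by move=> H x y e; apply/eqP; rewrite -subr_eq0; apply/eqP/H; rewrite linfB e subrr.
Qed.

End Lin.

Lemma lin_comp (F : fieldType) (U V W : lmodType F) (f : V -> W) (g : U -> V) :
  lin f -> lin g -> lin (fun x => f (g x)).
Proof. by move=> lf lg a x y; rewrite lg lf. Qed.

Lemma lin_linear (F : fieldType) (V W : lmodType F) (f : {linear V -> W}) : lin f.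
Proof. by move=> a x y; rewrite linearP. Qed.

Lemma lin_hom (F : fieldType) (V W : vectType F) (f : V -> W) :
  lin f -> exists g : 'Hom(V, W), forall x, g x = f x.
Proof.
move=> lf.
pose h := HB.pack_for {linear V -> W} f (GRing.isLinear.Build F V W *:%R f lf).
by exists (linfun h) => x; rewrite lfunE.
Qed.

Definition subsp (F : fieldType) (V : lmodType F) (P : V -> Prop) :=
  P 0 /\ forall a x y, P x -> P y -> P (a *: x + y).

Lemma subspD (F : fieldType) (V : lmodType F) (P : V -> Prop) x y :
  subsp P -> P x -> P y -> P (x + y).
Proof. by case=> _ H px py; rewrite -(scale1r x); apply: H. Qed.

Lemma subspZ (F : fieldType) (V : lmodType F) (P : V -> Prop) a x :
  subsp P -> P x -> P (a *: x).
Proof. by case=> p0 H px; rewrite -(addr0 (a *: x)); apply: H. Qed.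

Lemma subspN (F : fieldType) (V : lmodType F) (P : V -> Prop) x :
  subsp P -> P x -> P (- x).
Proof. by move=> sP px; rewrite -scaleN1r; apply: subspZ. Qed.

Lemma subspB (F : fieldType) (V : lmodType F) (P : V -> Prop) x y :
  subsp P -> P x -> P y -> P (x - y).
Proof. by move=> sP px py; apply: subspD => //; apply: subspN. Qed.

Section Spaces.
Variable F : fieldType.
Implicit Types V W : vectType F.

Lemma subsp_vspace V (U : {vspace V}) : subsp (fun x => x \in U).
Proof. by split=> [|a x y xU yU]; rewrite ?mem0v // memvD // memvZ. Qed.

Lemma vspace_of_subsp V (P : V -> Prop) :
  subsp P -> exists U : {vspace V}, forall x, x \in U <-> P x.
Proof.
move=> sP.
have [||U UP max] := @ex_max_measure _ (fun U : {vspace V} => forall x, x \in U -> P x)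
  (fun U => \dim U) (dim V).
- by exists 0%VS => x; rewrite memv0 => /eqP ->; case: sP.
- by move=> U _; rewrite -dimvf dimvS // subvf.
exists U => x; split; first exact: UP.
move=> px; have sub : (U <= U + <[x]>)%VS by rewrite addvSl.
have /max : forall y, y \in (U + <[x]>)%VS -> P y.
  move=> y /memv_addP[u uU [v /vlineP[k ->] ->]].
  by apply: subspD => //; [apply: UP | apply: subspZ].
rewrite (geq_leqif (dimv_leqif_sup sub)) => /subvP H.
by apply: H; apply: subvP (addvSr _ _) _ _; rewrite memv_line.
Qed.

Lemma subv_dim_eq V (U W : {vspace V}) :
  (forall x, x \in U -> x \in W) -> (\dim W <= \dim U)%N -> forall x, x \in W -> x \in U.
Proof.
move=> /subvP sub; rewrite (geq_leqif (dimv_leqif_sup sub)) => /subvP H x; exact: H.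
Qed.

Lemma vspace_full V (U : {vspace V}) : (forall x, x \in U) -> U = fullv.
Proof. by move=> H; apply/eqP; rewrite eqEsubv subvf; apply/subvP => x _. Qed.

Lemma not_fullP V (U : {vspace V}) : U != fullv -> exists x, x \notin U.
Proof.
move=> nU; apply: NNPP => no; case/eqP: nU; apply: vspace_full => x.
by apply/negPn/negP => nx; apply: no; exists x.
Qed.

Lemma quot_space V (U : {vspace V}) :
  exists (Q : vectType F) (pi : V -> Q) (si : Q -> V),
    [/\ lin pi, lin si, (forall q, pi (si q) = q) & (forall x, pi x = 0 <-> x \in U)].
Proof.
exists (subvs_of (U^C)%VS), (fun x => Subvs (memv_projC U x)), vsval; split.
- move=> a x y; apply: val_inj; rewrite /= linearP /= scalerBr.
  by rewrite opprD addrACA.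
- exact: lin_linear.
- move=> q; apply: val_inj => /=; suff -> : projv U (vsval q) = 0 by rewrite subr0.
  have qC := subvsP q; have /eqP := memv_projC U (vsval q).
  have: vsval q - (vsval q - projv U (vsval q)) \in (U^C)%VS by rewrite memvB // memv_projC.
  rewrite opprB addrC subrK => h.
  have: projv U (vsval q) \in (U :&: U^C)%VS by rewrite memv_cap memv_proj.
  by rewrite capv_compl memv0 => /eqP.
- move=> x; split=> [/(congr1 vsval)/= /eqP|xU]; last first.
    by apply: val_inj; rewrite /= projv_id // subrr.
  by rewrite subr_eq0 => /eqP ->; rewrite memv_proj.
Qed.

Lemma dim_surj V W (f : V -> W) (U : {vspace V}) :
  lin f -> surj f -> (forall x, f x = 0 <-> x \in U) -> (\dim U + dim W)%N = dim V.
Proof.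
move=> lf sf kf; have [g gE] := lin_hom lf.
have := limg_ker_dim g fullv; rewrite capfv -!dimvf.
have -> : lker g = U.
  by apply/vspaceP => x; rewrite memv_ker gE; apply/eqP/idP => /kf.
have -> : limg g = fullv => //.
apply: vspace_full => y; have [x <-] := sf y.
by rewrite -gE memv_img // memvf.
Qed.

Lemma lin_choice V W (R : V -> W -> Prop) :
  (forall x, exists y, R x y) -> (forall x y y', R x y -> R x y' -> y = y') ->
  (forall a x x' y y', R x y -> R x' y' -> R (a *: x + x') (a *: y + y')) ->
  exists2 g : V -> W, lin g & forall x, R x (g x).
Proof.
move=> /choice_fun[g gR] uR lR; exists g => // a x y.
by apply: uR (gR _) _; apply: lR.
Qed.

Lemma functional V (U : {vspace V}) v :
  v \notin U -> exists l : V -> F^o, [/\ lin l, forall x, x \in U -> l x = 0 & l v = 1].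
Proof.
move=> nv; have [Q [pi [si [lpi _ _ kpi]]]] := quot_space U.
have [i nz] : exists i, crd i (pi v) != 0.
  apply: NNPP => no; case/negP: nv; apply/kpi; apply: crdP => i; rewrite crd0.
  by apply/eqP/negPn/negP => nz; apply: no; exists i.
exists (fun x => (crd i (pi v))^-1 * crd i (pi x)); split.
- by move=> a x y; rewrite lpi crdD crdZ mulrDr mulrCA.
- by move=> x /kpi ->; rewrite crd0 mulr0.
- by rewrite mulVf.
Qed.

End Spaces.

(** * Lie modules and semidirect products *)

Section Bracket.
Variables (F : fieldType) (L : lieAlgebra F).
Implicit Types x y z : L.

Lemma brDl x y z : [lie x + y, z] = [lie x, z] + [lie y, z].
Proof. by have := lie_brDl 1 x y z; rewrite !scale1r. Qed.

Lemma brDr x y z : [lie z, x + y] = [lie z, x] + [lie z, y].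
Proof. by have := lie_brDr 1 x y z; rewrite !scale1r. Qed.

Lemma lin_brl z : lin (fun x => [lie x, z]).
Proof. by move=> a x y; apply: lie_brDl. Qed.

Lemma lin_brr z : lin (lie_br z).
Proof. by move=> a x y; apply: lie_brDr. Qed.

Lemma br0l z : [lie 0, z] = 0. Proof. exact: (linf0 (lin_brl z)). Qed.
Lemma br0r z : [lie z, 0] = 0. Proof. exact: (linf0 (lin_brr z)). Qed.
Lemma brNl x z : [lie - x, z] = - [lie x, z]. Proof. exact: (linfN (lin_brl z)). Qed.
Lemma brNr x z : [lie z, - x] = - [lie z, x]. Proof. exact: (linfN (lin_brr z)). Qed.
Lemma brZl a x z : [lie a *: x, z] = a *: [lie x, z].
Proof. exact: (linfZ (lin_brl z)). Qed.
Lemma brZr a x z : [lie z, a *: x] = a *: [lie z, x].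
Proof. exact: (linfZ (lin_brr z)). Qed.

Lemma brC x y : [lie x, y] = - [lie y, x].
Proof.
have := lie_brxx (x + y); rewrite brDl !brDr !lie_brxx addr0 add0r.
by move/eqP; rewrite addr_eq0 => /eqP.
Qed.

Lemma jacobi_l x y z : [lie [lie x, y], z] = [lie x, [lie y, z]] - [lie y, [lie x, z]].
Proof.
have /eqP := lie_jacobi x y z; rewrite addr_eq0 => /eqP e.
by rewrite (brC [lie x, y]) -e (brC z x) brNr.
Qed.

Lemma jacobi_r x y z : [lie x, [lie y, z]] = [lie [lie x, y], z] + [lie y, [lie x, z]].
Proof. by rewrite jacobi_l subrK. Qed.

End Bracket.

Definition idealP (F : fieldType) (L : lieAlgebra F) (I : L -> Prop) :=
  subsp I /\ forall x y : L, I y -> I [lie x, y].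

Record lmodule (F : fieldType) (L : lieAlgebra F) := LModule {
  lm_sort :> vectType F;
  lm_act : L -> lm_sort -> lm_sort;
  lm_actl : forall v, lin (fun x => lm_act x v);
  lm_actr : forall x, lin (lm_act x);
  lm_actbr : forall (x y : L) v,
      lm_act [lie x, y] v = lm_act x (lm_act y v) - lm_act y (lm_act x v)
}.

Notation "x \> v" := (lm_act x v) (at level 40, left associativity).

Definition mod_hom (F : fieldType) (L : lieAlgebra F) (M N : lmodule L) (h : M -> N) :=
  lin h /\ forall x v, h (x \> v) = x \> h v.

Definition stable (F : fieldType) (L : lieAlgebra F) (M : lmodule L) (P : M -> Prop) :=
  subsp P /\ forall x v, P v -> P (x \> v).

Section Modules.
Variables (F : fieldType) (L : lieAlgebra F).
Implicit Types M N : lmodule L.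

Section Act.
Variable M : lmodule L.
Implicit Types (u v : M) (x y : L).
Lemma actDl x y v : (x + y) \> v = x \> v + y \> v.
Proof. exact: (linfD (lm_actl v)). Qed.
Lemma actDr x u v : x \> (u + v) = x \> u + x \> v.
Proof. exact: (linfD (lm_actr x)). Qed.
Lemma actNr x v : x \> (- v) = - (x \> v).
Proof. exact: (linfN (lm_actr x)). Qed.
Lemma actZl a x v : (a *: x) \> v = a *: (x \> v).
Proof. exact: (linfZ (lm_actl v)). Qed.
Lemma actZr a x v : x \> (a *: v) = a *: (x \> v).
Proof. exact: (linfZ (lm_actr x)). Qed.
Lemma act0l v : 0 \> v = 0. Proof. exact: (linf0 (lm_actl v)). Qed.
Lemma act0r x : x \> (0 : M) = 0. Proof. exact: (linf0 (lm_actr x)). Qed.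
End Act.

Lemma submodule_ex M (P : M -> Prop) : stable P ->
  exists (N : lmodule L) (i : N -> M),
    [/\ mod_hom i, injective i & forall v, P v <-> exists n, i n = v].
Proof.
case=> sP aP; have [U UP] := vspace_of_subsp sP.
have aU x (u : subvs_of U) : x \> (vsval u : M) \in U.
  by apply/UP/aP/UP/subvsP.
pose act x u : subvs_of U := Subvs (aU x u).
have al v : lin (fun x => act x v).
  by move=> a x y; apply: val_inj; rewrite /= actDl actZl.
have ar x : lin (act x).
  by move=> a u v; apply: val_inj; rewrite /= actDr actZr.
have ab x y v : act [lie x, y] v = act x (act y v) - act y (act x v).
  by apply: val_inj; rewrite /= lm_actbr.
exists (LModule al ar ab), vsval; split.
- by split=> //; exact: lin_linear.
- exact: val_inj.
- move=> v; split=> [/UP vU | [n <-]]; first by exists (Subvs vU).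
  by apply/UP/subvsP.
Qed.

Lemma quotient_module M (P : M -> Prop) : stable P ->
  exists (Q : lmodule L) (pi : M -> Q) (si : Q -> M),
    [/\ mod_hom pi, lin si, (forall q, pi (si q) = q) & (forall v, pi v = 0 <-> P v)].
Proof.
case=> sP aP; have [U UP] := vspace_of_subsp sP.
have [Q [pi [si [lpi lsi piK kpi]]]] := quot_space U.
pose act x q := pi (x \> si q).
have piE x v : pi (x \> v) = act x (pi v).
  apply/eqP; rewrite -subr_eq0 -(linfB lpi) -actNr -actDr; apply/eqP/kpi/UP/aP/UP/kpi.
  by rewrite (linfB lpi) piK subrr.
have al v : lin (fun x => act x v).
  by move=> a x y; rewrite /act actDl actZl lpi.
have ar x : lin (act x).
  by move=> a u v; rewrite /act lsi actDr actZr lpi.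
have ab x y v : act [lie x, y] v = act x (act y v) - act y (act x v).
  by rewrite -[v]piK -!piE lm_actbr (linfB lpi).
exists (LModule al ar ab), pi, si; split=> //.
by move=> v; rewrite -UP; apply: kpi.
Qed.

Lemma lift_inj M N N' (i : N -> M) (h : N' -> M) :
  mod_hom i -> injective i -> mod_hom h -> (forall n', exists n, i n = h n') ->
  exists2 h' : N' -> N, mod_hom h' & forall n', i (h' n') = h n'.
Proof.
move=> [li ei] ii [lh eh] /choice_fun[h' h'E]; exists h' => //; split.
  by move=> a x y; apply: ii; rewrite li !h'E lh.
by move=> x v; apply: ii; rewrite ei !h'E eh.
Qed.

Definition prod_act (M N : lmodule L) (x : L) (v : (M * N)%type) : (M * N)%type :=
  (x \> v.1, x \> v.2).

Lemma prod_actl M N v : lin (fun x => @prod_act M N x v).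
Proof. by move=> a x y; rewrite /prod_act !actDl !actZl. Qed.
Lemma prod_actr M N x : lin (@prod_act M N x).
Proof. by move=> a u v; rewrite /prod_act /= !actDr !actZr. Qed.
Lemma prod_actbr M N x y v :
  @prod_act M N [lie x, y] v = prod_act x (prod_act y v) - prod_act y (prod_act x v).
Proof. by rewrite /prod_act !lm_actbr. Qed.

Definition dsum M N := LModule (@prod_actl M N) (@prod_actr M N) (@prod_actbr M N).

Definition adj : lmodule L :=
  LModule (@lin_brl F L) (@lin_brr F L) (@jacobi_l F L).

Definition triv_act (x : L) (v : F^o) : F^o := 0.
Lemma triv_actl v : lin (fun x => triv_act x v).
Proof. by move=> a x y; rewrite /triv_act scaler0 addr0. Qed.
Lemma triv_actr x : lin (triv_act x).
Proof. by move=> a u v; rewrite /triv_act scaler0 addr0. Qed.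
Lemma triv_actbr x y v :
  triv_act [lie x, y] v = triv_act x (triv_act y v) - triv_act y (triv_act x v).
Proof. by rewrite /triv_act subrr. Qed.
Definition triv := LModule triv_actl triv_actr triv_actbr.

End Modules.

Section Restriction.
Variables (F : fieldType) (L S : lieAlgebra F) (f : S -> L).
Hypothesis hf : lie_hom f.
Variable M : lmodule L.

Lemma res_actl (v : M) : lin (fun s => f s \> v).
Proof. by move=> a x y; rewrite hf.1 actDl actZl. Qed.
Lemma res_actr s : lin (fun v : M => f s \> v).
Proof. exact: lm_actr. Qed.
Lemma res_actbr x y (v : M) : f [lie x, y] \> v = f x \> (f y \> v) - f y \> (f x \> v).
Proof. by rewrite hf.2 lm_actbr. Qed.
Definition res := LModule res_actl res_actr res_actbr.

End Restriction.

Section Semidirect.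
Variables (F : fieldType) (L : lieAlgebra F) (M : lmodule L).

Definition sd_br (e e' : (M * L)%type) : (M * L)%type :=
  (e.2 \> e'.1 - e'.2 \> e.1, [lie e.2, e'.2]).

Lemma sd_brDl a x y z : sd_br (a *: x + y) z = a *: sd_br x z + sd_br y z.
Proof.
rewrite /sd_br /= actDl actZl actDr actZr lie_brDl; congr (_, _); vring.
Qed.
Lemma sd_brDr a x y z : sd_br z (a *: x + y) = a *: sd_br z x + sd_br z y.
Proof.
rewrite /sd_br /= actDl actZl actDr actZr lie_brDr; congr (_, _); vring.
Qed.
Lemma sd_brxx x : sd_br x x = 0.
Proof. by rewrite /sd_br lie_brxx subrr. Qed.
Lemma sd_jacobi x y z :
  sd_br x (sd_br y z) + sd_br y (sd_br z x) + sd_br z (sd_br x y) = 0.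
Proof.
transitivity ((0, 0) : (M * L)%type) => //; rewrite /sd_br /=.
congr (_, _); last exact: lie_jacobi.
by rewrite /= !(actDr, actNr, lm_actbr); vring.
Qed.

Definition sd : lieAlgebra F := LieAlgebra sd_brDl sd_brDr sd_brxx sd_jacobi.

End Semidirect.

Lemma lie_quotient (F : fieldType) (L : lieAlgebra F) (I : L -> Prop) : idealP I ->
  exists (Q : lieAlgebra F) (pi : L -> Q),
    [/\ lie_hom pi, surj pi & (forall v, pi v = 0 <-> I v)].
Proof.
case=> sI aI; have [U UP] := vspace_of_subsp sI.
have [Q [pi [si [lpi lsi piK kpi]]]] := quot_space U.
pose br x q := pi [lie si x, si q].
have k0 v : pi (v - si (pi v)) = 0 by rewrite (linfB lpi) piK subrr.
have brE x v : pi [lie x, v] = br (pi x) (pi v).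
  rewrite /br; set x' := si (pi x); set v' := si (pi v).
  have -> : [lie x, v] = [lie x', v'] + [lie x', v - v'] - [lie v, x - x'].
    by rewrite !(brDr, brNr) (brC v x) (brC v x'); vring.
  rewrite (linfB lpi) (linfD lpi).
  rewrite (_ : pi [lie x', v - v'] = 0); last by apply/kpi/UP/aI/UP/kpi.
  rewrite (_ : pi [lie v, x - x'] = 0); last by apply/kpi/UP/aI/UP/kpi.
  by rewrite subr0 addr0.
have dl a x y z : br (a *: x + y) z = a *: br x z + br y z.
  by rewrite /br lsi lie_brDl lpi.
have dr a x y z : br z (a *: x + y) = a *: br z x + br z y.
  by rewrite /br lsi lie_brDr lpi.
have xx x : br x x = 0 by rewrite /br lie_brxx (linf0 lpi).
have jac x y z : br x (br y z) + br y (br z x) + br z (br x y) = 0.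
  rewrite -[x]piK -[y]piK -[z]piK -!brE -!(linfD lpi) lie_jacobi; exact: linf0 lpi.
exists (LieAlgebra dl dr xx jac), pi; split=> //.
- by move=> q; exists (si q).
- by move=> v; rewrite -UP; apply: kpi.
Qed.

(** * The Frattini ideal *)

Lemma lift_surj (F : fieldType) (E Q P : lieAlgebra F) (h : E -> Q) (pi : E -> P) :
  lie_hom h -> surj h -> lie_hom pi -> (forall x, h x = 0 -> pi x = 0) ->
  exists2 g : Q -> P, lie_hom g & forall x, g (h x) = pi x.
Proof.
move=> [lh eh] /choice_fun[s sE] [lpi epi] ker.
have gE x : pi (s (h x)) = pi x.
  by apply/eqP; rewrite -subr_eq0 -(linfB lpi) ker // (linfB lh) sE subrr.
exists (fun q => pi (s q)) => //; split.
  by move=> a x y; rewrite -{1}(sE x) -{1}(sE y) -lh gE lpi.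
by move=> x y; rewrite -{1}(sE x) -{1}(sE y) -eh gE epi.
Qed.

Section Solvable.
Variable F : fieldType.
Implicit Types E L : lieAlgebra F.

(* The form of solubility that is used: a proper subspace fails to contain some
   ideal which is abelian modulo it. *)
Definition solv E := forall H : {vspace E}, H != fullv ->
  exists A : E -> Prop, [/\ idealP A, (exists2 a, A a & a \notin H) &
                            forall a b, A a -> A b -> [lie a, b] \in H].

Lemma br_derived_step E (U : {vspace E}) x y :
  x \in U -> y \in U -> [lie x, y] \in derived_step U.
Proof.
move=> xU yU; rewrite (coord_vbasis xU) (coord_vbasis yU).
rewrite (linf_sum (@lin_brl _ E _)); apply: memv_suml => i _.
rewrite (linf_sum (@lin_brr _ E _)); apply: memv_suml => j _.
rewrite brZl brZr !memvZ //; apply: memv_span; apply/allpairsP.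
by exists ((vbasis U)`_i, (vbasis U)`_j); split; rewrite ?mem_nth ?size_tuple.
Qed.

Lemma derived_step_ideal E (U : {vspace E}) :
  idealP (fun x => x \in U) -> idealP (fun x => x \in derived_step U).
Proof.
move=> [_ iU]; split; first exact: subsp_vspace.
move=> x; have [W WP] : exists W : {vspace E}, forall v, v \in W <-> [lie x, v] \in derived_step U.
  apply: vspace_of_subsp; split=> [|a u v hu hv]; first by rewrite br0r mem0v.
  by rewrite lie_brDr memvD // memvZ.
suff /subvP sub : (derived_step U <= W)%VS by move=> y /sub /WP.
apply/span_subvP => v /allpairsP[[a b] [/= /vbasis_mem aU /vbasis_mem bU ->]].
by apply/WP; rewrite jacobi_r memvD // br_derived_step //; apply: iU.
Qed.

Lemma derived_ideal E k : idealP (fun x => x \in derived E k).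
Proof.
elim: k => [|k IH]; last exact: derived_step_ideal.
by split=> [|x y _]; [exact: subsp_vspace | rewrite memvf].
Qed.

(** The witness is the last derived term not contained in [H]: its brackets lie in the next term,
    which is contained in [H]. *)
Lemma soluble_solv E : soluble E -> solv E.
Proof.
case=> k dk H nH.
have ex : exists k, (derived E k <= H)%VS by exists k; rewrite dk sub0v.
case: (ex_minnP ex) => -[|m] mH min.
  by case/eqP: nH; apply: vspace_full => x; apply: (subvP mH); rewrite memvf.
exists (fun x => x \in derived E m); split; first exact: derived_ideal.
  apply: NNPP => no; suff /min : (derived E m <= H)%VS by rewrite ltnn.
  by apply/subvP => x xm; apply/negPn/negP => nx; apply: no; exists x.
by move=> a b am bm; apply: (subvP mH); apply: br_derived_step.
Qed.

(** Either the abelian kernel sticks out of [H] and serves as the ideal, or [H] is the full preimage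
    of its image in [L] and an ideal of [L] is pulled back. *)
Lemma solv_ext E L (h : E -> L) : lie_hom h -> surj h ->
  (forall a b, h a = 0 -> h b = 0 -> [lie a, b] = 0) -> solv L -> solv E.
Proof.
move=> [lh eh] sh ab sL H nH.
case: (classic (exists2 a, h a = 0 & a \notin H)) => [exa|no].
  exists (fun x => h x = 0); split=> //; last by move=> a b ha hb; rewrite ab // mem0v.
  split; last by move=> x y hy; rewrite eh hy br0r.
  by split=> [|a x y hx hy]; rewrite ?(linf0 lh) // lh hx hy scaler0 addr0.
have kH a : h a = 0 -> a \in H.
  by move=> ha; apply/negPn/negP => na; apply: no; exists a.
have [H' H'P] : exists H' : {vspace L}, forall y, y \in H' <-> exists2 x, x \in H & h x = y.
  apply: vspace_of_subsp; split; first by exists 0; rewrite ?mem0v ?(linf0 lh).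
  move=> a _ _ [x xH <-] [y yH <-]; exists (a *: x + y); rewrite ?lh //.
  by rewrite memvD // memvZ.
have hH x : h x \in H' -> x \in H.
  move=> /H'P[y yH e]; rewrite -(subrK y x) memvD //; apply: kH.
  by rewrite (linfB lh) e subrr.
have [|A [[sA iA] [a Aa na] AH]] := sL H'.
  apply: contraNneq nH => fH; apply/eqP/vspace_full => x.
  by apply: hH; rewrite fH memvf.
have [x hx] := sh a.
exists (fun x => A (h x)); split.
- split; last by move=> u v Av; rewrite eh; apply: iA.
  split; first by rewrite (linf0 lh); case: sA.
  by move=> c u v Au Av; rewrite lh; apply: sA.2.
- by exists x; rewrite ?hx //; apply: contra na => xH; rewrite -hx; apply/H'P; exists x.
- by move=> u v Au Av; apply: hH; rewrite eh; apply: AH.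
Qed.

Section Frattini.
Variables (E : lieAlgebra F) (M : {vspace E}) (A : E -> Prop).
Hypotheses (maxM : maximal_subalgebra M) (iA : idealP A).

(** M + A is a subalgebra strictly above [M], hence everything. *)
Lemma max_plus_ideal : (exists2 a, A a & a \notin M) ->
  forall e, exists h a, [/\ h \in M, A a & e = h + a].
Proof.
move=> [a0 Aa0 na0] e.
have [sM [nM mM]] := maxM.
have [N NP] : exists N : {vspace E}, forall e, e \in N <->
    exists h a, [/\ h \in M, A a & e = h + a].
  apply: vspace_of_subsp; split.
    by exists 0, 0; split; rewrite ?mem0v ?addr0 //; case: iA => -[].
  move=> c _ _ [h [a [hM Aa ->]]] [h' [a' [hM' Aa' ->]]].
  exists (c *: h + h'), (c *: a + a'); split; first by rewrite memvD // memvZ.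
    by apply: iA.1.2.
  by rewrite scalerDr addrACA.
apply/NP; have [sA jA] := iA.
have [||eN|->] := mM N; last by rewrite memvf.
- move=> x y /NP[h [a [hM Aa ->]]] /NP[h' [a' [hM' Aa' ->]]]; apply/NP.
  exists [lie h, h'], ([lie h + a, a'] - [lie h', a]); split; first exact: sM.
    by apply: subspB => //; apply: jA.
  by rewrite !(brDl, brDr) (brC h' a); vring.
- by apply/subvP => h hM; apply/NP; exists h, 0; split; rewrite ?addr0 //; case: sA.
- exfalso; case/negP: na0; rewrite -eN; apply/NP.
  by exists 0, a0; rewrite mem0v add0r.
Qed.

Hypotheses (nAM : exists2 a, A a & a \notin M)
  (abA : forall a b, A a -> A b -> [lie a, b] \in M).

(** This is exp(- ad a) truncated after the linear term. The quadratic terms left over in [twist_br]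
    and [twistK] are harmless for [a] in [A], since they fall into both [A] and [M]. *)
Definition twist (a z : E) := z - [lie a, z].

Lemma twist_lin a : lin (twist a).
Proof. by move=> c x y; rewrite /twist lie_brDr; vring. Qed.

Lemma twist_br a y z :
  twist a [lie y, z] = [lie twist a y, twist a z] - [lie [lie a, y], [lie a, z]].
Proof. by rewrite /twist jacobi_r !(brDl, brDr, brNl, brNr); vring. Qed.

Lemma twistK a z : twist a (twist (- a) z) = z - [lie a, [lie a, z]].
Proof. by rewrite /twist brNl opprK brDr; vring. Qed.

(* twist a is an automorphism modulo the ideal A /\ M, so it moves M to another
   maximal subalgebra. *)
Lemma twist_max a (N : {vspace E}) : A a -> (forall z, z \in N <-> twist a z \in M) ->
  maximal_subalgebra N.
Proof.
move=> Aa NP; have [sM [nM mM]] := maxM; have [sA jA] := iA.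
have jA' x y : A x -> A [lie x, y] by move=> Ax; rewrite brC; apply: subspN => //; apply: jA.
(* A /\ M is an ideal: write x = h + c by [max_plus_ideal]; [h, b] stays in the subalgebra [M], and
   [c, b] is in [M] because [A] is abelian modulo [M]. *)
have AMM x b : A b -> b \in M -> A [lie x, b] /\ [lie x, b] \in M.
  move=> Ab bM; split; first exact: jA.
  have [h [c [hM Ac ->]]] := max_plus_ideal nAM x.
  by rewrite brDl memvD //; [apply: sM | apply: abA].
have AN b : A b -> b \in M -> b \in N.
  by move=> Ab bM; apply/NP; rewrite memvB //; apply: (AMM a b Ab bM).2.
have aaM z : A [lie a, [lie a, z]] /\ [lie a, [lie a, z]] \in M.
  by split; [apply: jA; apply: jA' | apply: abA => //; apply: jA'].
have ANa : A (- a) by apply: subspN.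
split; [|split].
- move=> x y /NP xN /NP yN; apply/NP; rewrite twist_br memvB //; first exact: sM.
  by apply: abA; apply: jA'.
- apply: contraNneq nM => fN; apply/eqP/vspace_full => z.
  rewrite -(subrK [lie a, [lie a, z]] z) memvD ?(aaM z).2 //.
  by rewrite -twistK; apply/NP; rewrite fN memvf.
- move=> N1 sN1 /subvP NN1.
  (* A subalgebra above [N] is carried back to one above [M] by means of [twist (- a)], the inverse
     of [twist a] modulo A /\ M. *)
  have [N2 N2P] : exists N2 : {vspace E}, forall z, z \in N2 <-> twist (- a) z \in N1.
    apply: vspace_of_subsp; split; first by rewrite (linf0 (twist_lin _)) mem0v.
    by move=> c x y hx hy; rewrite twist_lin memvD // memvZ.
  have aaN z : [lie a, [lie a, z]] \in N1.
    by apply/NN1/AN; [exact: (aaM z).1 | exact: (aaM z).2].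
  have twistK' z : twist (- a) (twist a z) = z - [lie a, [lie a, z]].
    by rewrite -{2}(opprK a) twistK !(brNl, brNr) opprK.
  have [||e|e] := mM N2.
  + move=> x y /N2P xN /N2P yN; apply/N2P; rewrite twist_br memvB //; first exact: sN1.
    by rewrite !brNl brNr opprK; apply/NN1/AN; [apply/jA/jA' | apply: abA; apply: jA'].
  + apply/subvP => h hM; apply/N2P/NN1/NP; rewrite twistK memvB //.
    exact: (aaM h).2.
  + left; apply/eqP; rewrite eqEsubv; apply/andP; split; apply/subvP => z; last exact: NN1.
    by move=> zN; apply/NP; rewrite -e; apply/N2P; rewrite twistK' memvB.
  + right; apply: vspace_full => z; rewrite -(subrK [lie a, [lie a, z]] z) memvD //.
    by rewrite -twistK'; apply/N2P; rewrite e memvf.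
Qed.

(** Write e = h + a with h in [M]. Since [y] also lies in the maximal subalgebra moved by [twist a],
    both y and y - [a, y] are in [M], hence so is [a, y]. *)
Lemma frattini_br_max e y : in_frattini y -> [lie e, y] \in M.
Proof.
move=> yP; have [h [a [hM Aa ->]]] := max_plus_ideal nAM e; clear e.
have [sM _] := maxM.
have yM := yP M maxM; rewrite brDl memvD //; first exact: sM.
have [N NP] : exists N : {vspace E}, forall z, z \in N <-> twist a z \in M.
  apply: vspace_of_subsp; split; first by rewrite (linf0 (twist_lin _)) mem0v.
  by move=> c u v hu hv; rewrite twist_lin memvD // memvZ.
have /NP := yP N (twist_max Aa NP).
by rewrite /twist => t; rewrite -(subKr y [lie a, y]) memvB.
Qed.

End Frattini.

Lemma frattini_ideal E : solv E -> idealP (@in_frattini F E).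
Proof.
move=> sE; split.
  by split=> [M _|a x y xP yP M mM]; rewrite ?mem0v // memvD ?memvZ ?xP ?yP.
move=> x y yP M mM; have [_ [nM _]] := mM.
have [A [iA nA ab]] := sE M nM.
exact: (frattini_br_max mM iA nA ab).
Qed.

End Solvable.

(** * Closure properties of a saturated formation *)

Section Formation.
Variables (F : fieldType) (Fo : lie_class F).
Hypothesis sF : saturated_formation Fo.

Lemma Fo_solv L : Fo L -> solv L.
Proof. by case: sF => -[H _] _ /H; apply: soluble_solv. Qed.

Lemma Fo_im (L M : lieAlgebra F) (h : L -> M) : lie_hom h -> surj h -> Fo L -> Fo M.
Proof. by case: sF => -[_ [H _]] _; apply: H. Qed.

Lemma Fo_subdirect (L M N : lieAlgebra F) (h : L -> M) (g : L -> N) :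
  lie_hom h -> surj h -> lie_hom g -> surj g -> (forall x, h x = 0 -> g x = 0 -> x = 0) ->
  Fo M -> Fo N -> Fo L.
Proof.
case: sF => -[_ [_ H]] _ hh sh hg sg inj.
apply: (H L M N L h g id) => //; last first.
  by move=> x; split=> [->|[]]; [rewrite (linf0 hh.1) (linf0 hg.1) | exact: inj].
by move=> y; exists y.
Qed.

(** [E] modulo its Frattini subalgebra is a homomorphic image of [Q]; [solv E] ensures that this
    subalgebra is an ideal. *)
Lemma Fo_frattini (E Q : lieAlgebra F) (h : E -> Q) : solv E ->
  lie_hom h -> surj h -> (forall x, h x = 0 -> in_frattini x) -> Fo Q -> Fo E.
Proof.
move=> sE hh sh ker FQ; have [P [pi [hpi spi kpi]]] := lie_quotient (frattini_ideal sE).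
have [g hg gE] := lift_surj hh sh hpi (fun x hx => (kpi x).2 (ker x hx)).
have [_ sat] := sF; apply: (sat E P pi hpi spi kpi).
apply: (Fo_im hg) FQ => p; have [x <-] := spi p.
by exists (h x).
Qed.

End Formation.

(** * Modules whose split extension lies in the formation *)

Section Hypercentral.
Variables (F : fieldType) (Fo : lie_class F).
Hypothesis sF : saturated_formation Fo.

(** The extension is by all of [S], not by S / C_S(M) as in the definition of centrality. For [S] in
    the formation this makes no difference, and no centralizer has to be carried along. *)
Definition good (S : lieAlgebra F) (M : lmodule S) := Fo (sd M).

Section SemidirectHom.
Variables (S : lieAlgebra F) (M N : lmodule S).

Lemma sd_snd_hom : lie_hom (fun e : sd M => e.2).
Proof. by split. Qed.

Lemma sd_snd_surj : surj (fun e : sd M => e.2).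
Proof. by move=> s; exists (0, s). Qed.

Lemma sd_solv : solv S -> solv (sd M).
Proof.
apply: (solv_ext sd_snd_hom sd_snd_surj) => -[u x] [v y] /= -> ->.
by rewrite /= /sd_br /= !act0l subrr lie_brxx.
Qed.

Lemma sd_map_hom (h : M -> N) : mod_hom h ->
  @lie_hom F (sd M) (sd N) (fun e => (h e.1, e.2)).
Proof.
move=> [lh eh]; split=> [a x y|x y] /=; first by rewrite /= lh.
by rewrite /sd_br /= (linfB lh) !eh.
Qed.

End SemidirectHom.

Section FixS.
Variable S : lieAlgebra F.
Hypotheses (FS : Fo S) (nzS : exists s : S, s != 0).
Implicit Types M N V Q T : lmodule S.

Let solS : solv S := Fo_solv sF FS.

Lemma good_im M N (h : M -> N) : mod_hom h -> surj h -> good M -> good N.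
Proof.
move=> hh sh; apply: (Fo_im sF (sd_map_hom hh)) => -[n s].
by have [m <-] := sh n; exists (m, s).
Qed.

(** The maps (t, s) to i t + pi s and (t, s) to s exhibit [sd T] as a subdirect product of [E] and
    [S]. It serves for abelian ideals of quotients of [S]. *)
Lemma good_abelian (E : lieAlgebra F) (pi : S -> E) T (i : T -> E) :
  Fo E -> lie_hom pi -> surj pi -> lin i -> injective i ->
  (forall t t', [lie i t, i t'] = 0) -> (forall s t, [lie pi s, i t] = i (s \> t)) ->
  good T.
Proof.
move=> FE [lpi epi] spi li ii ab eq.
apply: (@Fo_subdirect _ _ sF (sd T) E S (fun e => i e.1 + pi e.2) (fun e => e.2)) => //.
- split=> [a x y|[t s] [t' s']] /=; first by rewrite li lpi; vring.
  rewrite (linfB li) epi !(brDl, brDr) ab -!eq (brC (i t)); vring.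
- by move=> e; have [s <-] := spi e; exists (0, s); rewrite /= (linf0 li) add0r.
- exact: sd_snd_surj.
- move=> [t s] /= e s0; rewrite s0 (linf0 lpi) addr0 in e *.
  by congr (_, _); apply: ii; rewrite e (linf0 li).
Qed.

(** Over [E], the split extension of [T] is a subdirect product of two copies of [E], by (t, e) to i
    t + e and (t, e) to e; the split extension over [S] is an image of it. This extracts an abelian
    ideal without closure under subalgebras. *)
Lemma good_ideal (E : lieAlgebra F) (si : E -> S) T (i : T -> E) :
  Fo E -> lie_hom si -> surj si -> lin i -> injective i ->
  (forall t t', [lie i t, i t'] = 0) -> (forall e t, [lie e, i t] = i (si e \> t)) ->
  good T.
Proof.
move=> FE hsi ssi li ii ab eq.
pose T' := res hsi T.
suff FT : Fo (sd T').
  apply: (@Fo_im _ _ sF (sd T') (sd T) (fun e => (e.1, si e.2))) FT.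
    split=> [a x y|x y]; first by rewrite /= hsi.1.
    by rewrite /= /sd_br /= hsi.2.
  by move=> [t s]; have [e <-] := ssi s; exists (t, e).
pose j (e : sd T') : E := i e.1 + e.2.
apply: (@Fo_subdirect _ _ sF (sd T') E E j (fun e => e.2)) => //.
- split=> [a x y|x y]; rewrite /j /=; first by rewrite li; vring.
  rewrite (linfB li) !(brDl, brDr) ab -!eq (brC (i x.1)); vring.
- by move=> e; exists (0, e); rewrite /j /= (linf0 li) add0r.
- exact: sd_snd_surj.
- move=> [t e]; rewrite /j /= => h e0; rewrite e0 addr0 in h.
  have -> : t = 0 by apply: ii; rewrite h (linf0 li).
  by rewrite e0.
Qed.

Lemma good_inj T V (i : T -> V) : mod_hom i -> injective i -> good V -> good T.
Proof.
move=> [li ei] ii gV.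
apply: (@good_ideal (sd V) (fun e => e.2) T (fun t => (i t, 0)) gV) => //.
- exact: sd_snd_surj.
- by move=> a x y; rewrite li; congr (_, _); rewrite /= scaler0 addr0.
- by move=> x y [/ii].
- by move=> t t'; rewrite /= /sd_br /= !act0l subrr br0r.
- by move=> [v s] t; rewrite /= /sd_br /= act0l subr0 br0r ei.
Qed.

Lemma good_dsum M N : good M -> good N -> good (dsum M N).
Proof.
move=> gM gN.
have hM : mod_hom (fun v : dsum M N => v.1) by split.
have hN : mod_hom (fun v : dsum M N => v.2) by split.
apply: (Fo_subdirect sF (sd_map_hom hM) _ (sd_map_hom hN)) gM gN.
- by move=> [m s]; exists ((m, 0), s).
- by move=> [m s]; exists ((0, m), s).
- by move=> [[m n] s] /= [m0 s0] [n0 _]; rewrite m0 n0 s0.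
Qed.

Lemma good_inj2 M N V (i : V -> M) (j : V -> N) : mod_hom i -> mod_hom j ->
  (forall v, i v = 0 -> j v = 0 -> v = 0) -> good M -> good N -> good V.
Proof.
move=> [li ei] [lj ej] inj gM gN.
apply: (@good_inj V (dsum M N) (fun v => (i v, j v))) (good_dsum gM gN).
  by split=> [a x y|x v]; rewrite ?li ?lj ?ei ?ej.
have l : @lin F V (dsum M N) (fun v => (i v, j v)) by move=> a x y; rewrite li lj.
by apply: (linf_inj l) => v [hi hj]; apply: inj.
Qed.

(** Here [S] must be nonzero: a nonzero soluble algebra differs from its derived algebra, so it maps
    onto the one-dimensional algebra, and [sd (triv S)] is the direct product of that algebra with
    [S]. *)
Lemma good_triv : good (triv S).
Proof.
have [l [ll l0 [s0 ls0]]] : exists l : S -> F^o,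
    [/\ lin l, forall x y, l [lie x, y] = 0 & exists s, l s = 1].
  suff nD : derived_step (fullv : {vspace S}) != fullv.
    have [v nv] := not_fullP nD.
    have [l [ll l0 lv]] := functional nv; exists l; split=> //; last by exists v.
    by move=> x y; apply/l0/br_derived_step; rewrite memvf.
  apply/eqP => e; have [k dk] : soluble S by case: sF => -[H _] _; apply: H.
  have full m : derived S m = fullv by elim: m => //= m ->.
  by case: nzS => s /eqP; apply; apply/eqP; rewrite -memv0 -dk full memvf.
have xx (x : F^o) : (0 : F^o) = 0 by [].
have dl (a : F) (x y z : F^o) : (0 : F^o) = a *: 0 + 0 by rewrite scaler0 addr0.
have jac (x y z : F^o) : (0 : F^o) + 0 + 0 = 0 by rewrite !addr0.
pose A1 := @LieAlgebra F F^o (fun _ _ => 0) dl dl xx jac.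
have FA : Fo A1.
  apply: (@Fo_im _ _ sF S A1 l) FS; first by split=> // x y; rewrite l0.
  by move=> a; exists (a *: s0); rewrite (linfZ ll) ls0 /GRing.scale /= mulr1.
apply: (@Fo_subdirect _ _ sF (sd (triv S)) A1 S (fun e => e.1) (fun e => e.2)) => //.
- by split=> // x y /=; rewrite /triv_act subrr.
- by move=> a; exists (a, 0).
- exact: sd_snd_surj.
- by move=> [a s] /= -> ->.
Qed.

(** The map [h] need not be injective, so images under homomorphisms come for free; injectivity is
    recovered in [gsub_inj] because quotients of good modules are good. *)
Definition gsub V (P : V -> Prop) := exists (M : lmodule S) (h : M -> V),
  [/\ good M, mod_hom h & forall v, P v <-> exists m, h m = v].

Lemma gsub_inj V (P : V -> Prop) : gsub P ->
  exists (M : lmodule S) (h : M -> V),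
  [/\ good M, mod_hom h, injective h & forall v, P v <-> exists m, h m = v].
Proof.
move=> [M [h [gM [lh eh] hP]]].
have [|Q [pi [si [[lpi epi] lsi piK kpi]]]] := @quotient_module _ _ M (fun v => h v = 0).
  split; last by move=> x v hv; rewrite eh hv act0r.
  by split=> [|a x y hx hy]; rewrite ?(linf0 lh) // lh hx hy scaler0 addr0.
have hE m : h (si (pi m)) = h m.
  by apply/eqP; rewrite -subr_eq0 -(linfB lh); apply/eqP/kpi; rewrite (linfB lpi) piK subrr.
exists Q, (fun q => h (si q)); split.
- by apply: (@good_im M Q pi) gM => // q; exists (si q).
- by split=> [a x y|x v]; rewrite ?lsi ?lh // -{1}(piK v) -epi hE eh.
- apply: linf_inj; first by apply: lin_comp.
  by move=> q /kpi; rewrite piK.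
- move=> v; rewrite hP; split=> [[m <-]|[q <-]]; last by exists (si q).
  by exists (pi m).
Qed.

Lemma gsub_stable V (P : V -> Prop) : gsub P -> stable P.
Proof.
move=> [M [h [_ [lh eh] hP]]]; split; first split.
- by apply/hP; exists 0; apply: linf0.
- by move=> a _ _ /hP[m <-] /hP[n <-]; apply/hP; exists (a *: m + n).
- by move=> x _ /hP[m <-]; apply/hP; exists (x \> m).
Qed.

Lemma gsub_full V : gsub (fun _ : V => True) -> good V.
Proof. by move=> [M [h [gM hh hP]]]; apply: (good_im hh _ gM) => v; apply/hP. Qed.

Lemma gsub0 V : gsub (fun v : V => v = 0).
Proof.
exists (triv S), (fun=> 0); split; first exact: good_triv.
  by split=> [a x y|x v]; rewrite ?scaler0 ?addr0 // act0r.
by move=> v; split=> [->|[_ <-]] //; exists 0.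
Qed.

Lemma gsub_im V N (h : V -> N) (P : V -> Prop) : mod_hom h -> gsub P ->
  gsub (fun n => exists2 v, P v & h v = n).
Proof.
move=> [lh eh] [M [i [gM [li ei] iP]]]; exists M, (fun m => h (i m)); split=> //.
  by split=> [a x y|x v]; rewrite ?li ?ei ?lh ?eh.
move=> n; split=> [[v /iP[m <-] <-]|[m <-]]; first by exists m.
by exists (i m) => //; apply/iP; exists m.
Qed.

Lemma gsub_sub V (P P' : V -> Prop) : gsub P -> stable P' ->
  (forall v, P' v -> P v) -> gsub P'.
Proof.
move=> /gsub_inj[M [h [gM hh ih hP]]] sP' sub.
have [N [j [hj ij jP]]] := submodule_ex sP'.
exists N, j; split=> //.
have [n|k hk kE] := lift_inj hh ih hj; first by apply/hP/sub/jP; exists n.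
by apply: (good_inj hk) gM => x y e; apply: ij; rewrite -!kE e.
Qed.

(* A saturated formation contains an extension by a submodule inside the Frattini
   subalgebra; otherwise a maximal subalgebra complements (part of) the submodule. *)
Lemma good_ext_aux n V Q (U : {vspace V}) (psi : V -> Q) : (\dim U < n)%N ->
  mod_hom psi -> surj psi -> (forall v, psi v = 0 <-> v \in U) ->
  gsub (fun v => v \in U) -> good Q -> good V.
Proof.
elim: n V Q U psi => // n IH V Q U psi dU hpsi spsi kpsi gU gQ.
have [lpsi epsi] := hpsi; have [sU aU] := gsub_stable gU.
have hE := sd_map_hom hpsi.
have sE : surj (fun e : sd V => (psi e.1, e.2) : sd Q).
  by move=> [q s]; have [v <-] := spsi q; exists (v, s).
case: (classic (forall e : sd V, (psi e.1, e.2) = (0, 0) -> in_frattini e)) => [fr|nfr].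
  exact: (Fo_frattini sF (sd_solv solS) hE sE fr gQ).
have [u [H [uU mH nH]]] : exists u (H : {vspace (sd V)}),
    [/\ u \in U, maximal_subalgebra H & ((u, 0) : sd V) \notin H].
  apply: NNPP => no; apply: nfr => -[v s] /= [/kpsi vU ->] H mH.
  by apply/negPn/negP => nH; apply: no; exists v, H.
pose A (e : sd V) := e.1 \in U /\ e.2 = 0.
have iA : idealP A.
  split; first split=> /=; first by split; rewrite /= ?mem0v.
    by move=> a x y [h1 h2] [k1 k2]; split; rewrite /= ?memvD ?memvZ // h2 k2 scaler0 addr0.
  move=> [w t] [v s] [/= vU ->]; split; rewrite /= ?br0r // act0l subr0; exact: aU.
have dec := max_plus_ideal mH iA (ex_intro2 _ _ ((u, 0) : sd V) (conj uU erefl) nH).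
have [sH _] := mH.
pose P1 v := v \in U /\ ((v, 0) : sd V) \in H.
have sP1 : stable P1.
  split; first split=> /=.
  - by split; rewrite mem0v.
  - move=> a x y [xU xH] [yU yH]; split; first by rewrite memvD // memvZ.
    have -> : ((a *: x + y, 0) : sd V) = a *: ((x, 0) : sd V) + (y, 0).
      by congr (_, _); rewrite /= scaler0 addr0.
    by rewrite memvD // memvZ.
  (* [H] and [U] together span everything, so [H] contains some (h1, x); its bracket with (v, 0) is
     (x.v, 0). *)
  - move=> x v [vU vH]; split; first exact: aU.
    have [[h1 h2] [[a1 a2] [hH [/= aU' a20] [e1 e2]]]] := dec (0, x).
    rewrite a20 addr0 /= in e2; rewrite e2.
    have := sH _ _ hH vH; rewrite /= /sd_br /= act0l subr0 br0r //.
have [U1 U1P] := vspace_of_subsp sP1.1.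
have U1U v : v \in U1 -> v \in U by move=> /U1P[].
have dU1 : (\dim U1 < \dim U)%N.
  rewrite ltnNge; apply/negP => le; case/negP: nH.
  by have /U1P[] := subv_dim_eq U1U le uU.
case: (classic (exists2 v, v != 0 & v \in U1)) => [[v0 nv0 v0U1]|triv1]; last first.
  (* If [H] meets [U] trivially, every element is uniquely h + (i m, 0) with h in [H]. Sending it to
     [m] paired with its [S]-component is a Lie homomorphism to [sd M], injective on the kernel of
     the map to [sd Q]. *)
  have [M [i [gM [li ei] ii iP]]] := gsub_inj gU.
  have ex (e : sd V) : exists e' : sd M, ((e.1 - i e'.1, e.2) : sd V) \in H /\ e'.2 = e.2.
    have [[h1 h2] [[a1 a2] [hH [/= /iP[m <-] a20] ->]]] := dec e.
    by rewrite a20 in hH *; exists (m, h2); rewrite /= addr0 addrK.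
  have uq (e : sd V) (r r' : sd M) : ((e.1 - i r.1, e.2) : sd V) \in H /\ r.2 = e.2 ->
      ((e.1 - i r'.1, e.2) : sd V) \in H /\ r'.2 = e.2 -> r = r'.
    case: e r r' => [v s] [m t] [m' t'] /= [h1 ->] [h2 ->]; congr (_, _).
    apply: ii; apply/eqP; rewrite -subr_eq0; apply/negPn/negP => nz.
    case: triv1; exists (i m - i m') => //; apply/U1P; split.
      by rewrite memvB //; apply/iP; [exists m | exists m'].
    have -> : ((i m - i m', 0) : sd V) = (v - i m', s) - (v - i m, s).
      by congr (_, _); rewrite /= ?subrr //; vring.
    by rewrite memvB.
  have [a x x' y y'|g lg gP] := lin_choice ex uq.
  - case: x x' y y' => [v s] [v' s'] [m t] [m' t'] /= [h1 ->] [h2 ->]; split=> //.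
    have -> : ((a *: v + v' - i (a *: m + m'), a *: s + s') : sd V)
        = a *: ((v - i m, s) : sd V) + (v' - i m', s').
      by congr (_, _); rewrite /= li; vring.
    by rewrite memvD // memvZ.
  have g2 e : (g e).2 = e.2 by case: (gP e).
  have iU m : i m \in U by apply/iP; exists m.
  apply: (@Fo_subdirect _ _ sF (sd V) (sd M) (sd Q) g (fun e => (psi e.1, e.2))) gM gQ => //.
  - split=> // x y; have [hx ex2] := gP x; have [hy ey2] := gP y.
    have := gP [lie x, y]; set r := g [lie x, y] => -[hr r2].
    move: (sH _ _ hx hy) r2 hr; rewrite /= /sd_br /=.
    case: (g x) (g y) r ex2 ey2 => [m1 x2] [m2 y2] [m3 r2] /= -> -> k -> hr.
    congr (_, _); apply: ii; apply/eqP; rewrite -subr_eq0; apply/negPn/negP => nz.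
    case: triv1; exists (i m3 - i (x.2 \> m2 - y.2 \> m1)) => //; apply/U1P; split.
      by rewrite memvB.
    have := memvB k hr.
    rewrite (_ : _ - _ = (i m3 - i (x.2 \> m2 - y.2 \> m1), 0)) //.
    by congr (_, _); rewrite /= ?subrr // (linfB li) !ei !(actDr, actNr); vring.
  - move=> [m s]; have [[h1 h2] [[a1 a2] [hH [/= /iP[m' <-] a20] [e1 e2]]]] := dec (i m, s).
    rewrite a20 addr0 in e2; rewrite /= in e1 e2.
    exists (h1 + i m, h2); apply: (uq _ _ _ (gP _)).
    by rewrite /= addrK e2.
  - move=> e ge [/kpsi eU e2]; have [] := gP e; rewrite ge /= (linf0 li) subr0 => eH _.
    case: e ge eU e2 eH => v s /= ge vU -> vH; congr (_, _).
    apply/eqP/negPn/negP => nz; case: triv1; exists v => //.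
    exact/U1P.
(* Now [U1] and U / U1 are both smaller than [U]: the induction hypothesis applies to V / U1 over
   [Q], then to [V] over V / U1. *)
have [V1 [pi [si [hpi lsi piK kpi]]]] := quotient_module sP1.
have [lpi epi] := hpi.
have psiE v : psi (si (pi v)) = psi v.
  apply/eqP; rewrite -subr_eq0 -(linfB lpsi); apply/eqP/kpsi/U1U/U1P/kpi.
  by rewrite (linfB lpi) piK subrr.
have spi : surj pi by move=> q; exists (si q).
have hpsi1 : mod_hom (fun q => psi (si q)).
  by split=> [a x y|x v]; rewrite ?lsi ?lpsi // -{1}(piK v) -epi psiE epsi.
have spsi1 : surj (fun q => psi (si q)).
  by move=> q; have [v <-] := spsi q; exists (pi v).
have [U2 U2P] : exists U2 : {vspace V1}, forall q, q \in U2 <-> psi (si q) = 0.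
  apply: vspace_of_subsp; split; first by rewrite (linf0 hpsi1.1).
  by move=> a x y hx hy; rewrite hpsi1.1 hx hy scaler0 addr0.
have d1 := dim_surj lpi spi (fun v => iff_trans (kpi v) (iff_sym (U1P v))).
have d2 := dim_surj hpsi1.1 spsi1 (fun q => iff_sym (U2P q)).
have d3 := dim_surj lpsi spsi kpsi.
have nU1 : (0 < \dim U1)%N.
  by rewrite lt0n dimv_eq0; apply: contraNneq nv0 => e; rewrite -memv0 -e.
have dU2 : (\dim U2 < n)%N by lia.
apply: (IH V V1 U1 pi) => //; first by lia.
- by move=> v; rewrite U1P; apply: kpi.
- apply: (gsub_sub gU) => //; split; first exact: subsp_vspace.
  by move=> x v /U1P v1; apply/U1P/sP1.2.
- apply: (IH V1 Q U2 _ dU2 hpsi1 spsi1) gQ; first by move=> q; apply: iff_sym.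
  have [N [h [gN hh hP]]] := gsub_im hpi gU; exists N, h; split=> // q.
  rewrite U2P -hP; split=> [/kpsi siU|[v /kpsi vU <-]]; last by rewrite psiE.
  by exists (si q).
Qed.

Lemma good_ext V Q (psi : V -> Q) : mod_hom psi -> surj psi ->
  gsub (fun v => psi v = 0) -> good Q -> good V.
Proof.
move=> hpsi spsi gU gQ; have [sU aU] := gsub_stable gU.
have [U UP] := vspace_of_subsp sU.
apply: (good_ext_aux (ltnSn (\dim U)) hpsi spsi) gQ; first by move=> v; apply: iff_sym.
apply: (gsub_sub gU); last by move=> v /UP.
split; first exact: subsp_vspace.
by move=> x v /UP h; apply/UP/aU.
Qed.

Lemma gsub_ext V Q (psi : V -> Q) (P : Q -> Prop) : mod_hom psi -> surj psi ->
  gsub (fun v => psi v = 0) -> gsub P -> gsub (fun v => P (psi v)).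
Proof.
move=> hpsi spsi gU gP; have [lpsi epsi] := hpsi; have [sP aP] := gsub_stable gP.
have [N [j [hj ij jP]]] : exists (N : lmodule S) (j : N -> V),
    [/\ mod_hom j, injective j & forall v, P (psi v) <-> exists n, j n = v].
  apply: submodule_ex; split; last by move=> x v; rewrite epsi; apply: aP.
  split; first by rewrite (linf0 lpsi); case: sP.
  by move=> a x y hx hy; rewrite lpsi; apply: sP.2.
have [M [i [gM hi ii iP]]] := gsub_inj gP.
have [MU [k [gMU hk ik kU]]] := gsub_inj gU.
have [lj ej] := hj; have [li ei] := hi.
have hpj : mod_hom (fun n => psi (j n)).
  by split=> [a x y|x v]; rewrite ?lj ?ej ?lpsi ?epsi.
have [n|g hg gE] := lift_inj hi ii hpj; first by apply/iP/jP; exists n.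
have [m|k' hk' kE] := lift_inj hj ij hk.
  apply/jP; rewrite (_ : psi (k m) = 0); first by case: sP.
  by apply/kU; exists m.
exists N, j; split=> //.
apply: (good_ext hg) gM.
  move=> m; have [v vE] := spsi (i m).
  have [n nE] : exists n, j n = v by apply/jP; rewrite vE; apply/iP; exists m.
  by exists n; apply: ii; rewrite gE nE.
exists MU, k'; split=> // n; split=> [gn|[m <-]].
  have [m mE] : exists m, k m = j n by apply/kU; rewrite -gE gn (linf0 li).
  by exists m; apply: ij; rewrite kE.
by apply: ii; rewrite gE kE (linf0 li); apply/kU; exists m.
Qed.

(** * Equivariant pairings of good modules *)

Definition bspan (A B V : vectType F) (b : A -> B -> V) (v : V) :=
  forall U : {vspace V}, (forall x y, b x y \in U) -> v \in U.

Lemma bspanP (A B V : vectType F) (b : A -> B -> V) x y : bspan b (b x y).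
Proof. by move=> U; apply. Qed.

Lemma subsp_bspan (A B V : vectType F) (b : A -> B -> V) : subsp (bspan b).
Proof.
split; first by move=> U _; apply: mem0v.
by move=> a x y hx hy U bU; rewrite memvD ?memvZ ?hx ?hy.
Qed.

Lemma bspan_map (A B V W : vectType F) (b : A -> B -> V) (b' : A -> B -> W) (h : V -> W) :
  lin h -> (forall x y, bspan b' (h (b x y))) -> forall v, bspan b v -> bspan b' (h v).
Proof.
move=> lh hb v bv; have [U UP] : exists U : {vspace V}, forall v, v \in U <-> bspan b' (h v).
  apply: vspace_of_subsp; have [s0 sP] := subsp_bspan b'; split; first by rewrite (linf0 lh).
  by move=> a x y hx hy; rewrite lh; apply: sP.
by apply/UP/bv => x y; apply/UP.
Qed.

Section Heisenberg.
Variables (M1 M2 T : lmodule S) (b : M1 -> M2 -> T).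
Hypotheses (bl : forall y, lin (fun x => b x y)) (br : forall x, lin (b x)).
Hypothesis beq : forall s x y, s \> b x y = b (s \> x) y + b x (s \> y).

Let D := sd (dsum M1 M2).

(** Elements are (t, ((x, y), s)). The term b x y' - b x' y turns T + M1 + M2 into a Heisenberg
    algebra with [T] central in it, on which [S] acts by derivations. *)
Definition heis_br (e e' : (T * D)%type) : (T * D)%type :=
  (e.2.2 \> e'.1 - e'.2.2 \> e.1 + (b e.2.1.1 e'.2.1.2 - b e'.2.1.1 e.2.1.2),
   [lie e.2, e'.2]).

Let blD y u v : b (u + v) y = b u y + b v y. Proof. exact: (linfD (bl y)). Qed.
Let brD x u v : b x (u + v) = b x u + b x v. Proof. exact: (linfD (br x)). Qed.
Let blN y u : b (- u) y = - b u y. Proof. exact: (linfN (bl y)). Qed.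
Let brN x u : b x (- u) = - b x u. Proof. exact: (linfN (br x)). Qed.

Lemma heis_brDl a x y z : heis_br (a *: x + y) z = a *: heis_br x z + heis_br y z.
Proof.
transitivity ((a *: (heis_br x z).1 + (heis_br y z).1,
  a *: (heis_br x z).2 + (heis_br y z).2) : (T * D)%type) => //.
rewrite /heis_br; congr (_, _); last exact: lie_brDl.
by rewrite /= actDl actZl actDr actZr bl br; vring.
Qed.
Lemma heis_brDr a x y z : heis_br z (a *: x + y) = a *: heis_br z x + heis_br z y.
Proof.
transitivity ((a *: (heis_br z x).1 + (heis_br z y).1,
  a *: (heis_br z x).2 + (heis_br z y).2) : (T * D)%type) => //.
rewrite /heis_br; congr (_, _); last exact: lie_brDr.
by rewrite /= actDl actZl actDr actZr bl br; vring.
Qed.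
Lemma heis_brxx x : heis_br x x = 0.
Proof. by rewrite /heis_br lie_brxx !subrr addr0. Qed.
Lemma heis_jacobi x y z :
  heis_br x (heis_br y z) + heis_br y (heis_br z x) + heis_br z (heis_br x y) = 0.
Proof.
transitivity ((0, 0) : (T * D)%type) => //; rewrite /heis_br.
congr (_, _); last exact: lie_jacobi.
rewrite /= !(actDr, actNr, lm_actbr, beq, blD, brD, blN, brN); vring.
Qed.

Definition heis : lieAlgebra F :=
  LieAlgebra heis_brDl heis_brDr heis_brxx heis_jacobi.

(* T lies in the Frattini subalgebra since it is spanned by brackets in M1 + M2. *)
Lemma good_heis : good M1 -> good M2 -> (forall t, bspan b t) -> good T.
Proof.
move=> g1 g2 bT.
have hp : @lie_hom F heis D (fun e => e.2) by split.
have sp : surj (fun e : heis => e.2) by move=> d; exists (0, d).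
have sH : solv heis.
  apply: (solv_ext hp sp) (sd_solv solS) => -[t d] [t' d'] /= -> ->.
  rewrite /heis_br /= !act0l (linf0 (br _)) !subrr add0r.
  by congr (_, _); exact: (@br0r F D 0).
have FH : Fo heis.
  apply: (Fo_frattini sF sH hp sp _ (good_dsum g1 g2)) => -[t0 d] /= -> H mH.
  apply/negPn/negP => nH.
  pose A (e : heis) := e.2 = 0.
  have iA : idealP A.
    rewrite /A; split=> [|[t' d'] [t'' d''] /= ->]; last exact: (@br0r F D d').
    by split=> // a x y /= -> ->; rewrite scaler0 addr0.
  have dec := max_plus_ideal mH iA (ex_intro2 _ _ ((t0, 0) : heis) erefl nH).
  have [sbH _] := mH.
  have [U UP] : exists U : {vspace T}, forall t, t \in U <-> ((t, 0) : heis) \in H.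
    apply: vspace_of_subsp; split; first by rewrite mem0v.
    move=> a x y hx hy; have -> : ((a *: x + y, 0) : heis) = a *: ((x, 0) : heis) + (y, 0).
      by congr (_, _); rewrite /= scaler0 addr0.
    by rewrite memvD // memvZ.
  case/negP: nH; apply/UP/bT => x y; apply/UP.
  (* [H] maps onto [D], so it contains elements above x and y. Their [T]-components do not affect
     the bracket, as both have zero [S]-component; the bracket is exactly b x y. *)
  have [h [a [hH aA e1]]] := dec (0, ((x, 0), 0)).
  have [h' [a' [hH' aA' e1']]] := dec (0, ((0, y), 0)).
  have := sbH _ _ hH hH'; rewrite /= /heis_br.
  have -> : h.2 = ((x, 0), 0) by have := congr1 snd e1; rewrite /= aA addr0.
  have -> : h'.2 = ((0, y), 0) by have := congr1 snd e1'; rewrite /= aA' addr0.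
  rewrite /= !act0l (linf0 (br _)) !subr0 add0r => k.
  rewrite (_ : (_, 0) = (b x y, [lie ((x, 0), 0) : D, ((0, y), 0)])) //.
  by congr (_, _); rewrite [RHS]/lie_br /= /sd_br (@act0l _ _ (dsum M1 M2)) (@act0l _ _ (dsum M1 M2)) subrr br0r.
apply: (@good_ideal heis (fun e => e.2.2) T (fun t => (t, 0)) FH).
- by split.
- by move=> s; exists (0, (0, s)).
- by move=> a x y; congr (_, _); rewrite /= scaler0 addr0.
- by move=> x y [].
- move=> t t'; rewrite /= /heis_br /= !act0l (linf0 (br _)) !subrr add0r.
  by congr (_, _); exact: (@br0r F D 0).
- move=> [t d] t'; rewrite /= /heis_br /= act0l (linf0 (br _)) (linf0 (bl _)) !subr0 addr0.
  by congr (_, _); exact: (@br0r F D d).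
Qed.

End Heisenberg.

(** Stated for any equivariant pairing, so that it serves both tensor products of matrix
    representations and evaluation maps. *)
Lemma gsub_bilin M1 M2 V (b : M1 -> M2 -> V) :
  (forall y, lin (fun x => b x y)) -> (forall x, lin (b x)) ->
  (forall s x y, s \> b x y = b (s \> x) y + b x (s \> y)) ->
  good M1 -> good M2 -> gsub (bspan b).
Proof.
move=> bl br beq g1 g2.
have [|T [i [[li ei] ii iP]]] := @submodule_ex _ _ V (bspan b).
  split; first exact: subsp_bspan.
  move=> s; apply: (bspan_map (lm_actr s)) => x y.
  by rewrite beq; apply: (subspD (subsp_bspan b)); exact: bspanP.
have /choice_fun[b' bE] : forall xy, exists t, i t = b xy.1 xy.2.
  by move=> xy; apply/iP; exact: bspanP.
exists T, i; split=> //.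
apply: (@good_heis M1 M2 T (fun x y => b' (x, y))) => //.
- by move=> y a u v; apply: ii; rewrite li !bE bl.
- by move=> x a u v; apply: ii; rewrite li !bE br.
- by move=> s x y; apply: ii; rewrite ei (linfD li) !bE beq.
- move=> t U bU.
  have [W WP] : exists W : {vspace V}, forall v, v \in W <-> exists2 t, t \in U & i t = v.
    apply: vspace_of_subsp; split; first by exists 0; rewrite ?mem0v ?(linf0 li).
    move=> a _ _ [u uU <-] [v vU <-]; exists (a *: u + v); last by rewrite li.
    by rewrite memvD // memvZ.
  have : bspan b (i t) by apply/iP; exists t.
  move=> /(_ W); case/(_ _)/WP => [x y|t' tU /ii <- //].
  by apply/WP; exists (b' (x, y)); rewrite ?bE.
Qed.

(** * Building up a good module from good pieces of its quotients *)

Section Exhaustion.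
Variables (L : lieAlgebra F) (f : S -> L).
Hypothesis hf : lie_hom f.

(** A largest subspace that is [L]-stable and good over [S] is enlarged by [gsub_ext] as long as it
    is proper. Stability under [L] is kept so that the quotients remain [L]-modules. *)
Lemma good_exhaust (M : lmodule L) :
  (forall U : M -> Prop, stable U -> (exists v, ~ U v) ->
     exists (Q : lmodule L) (psi : M -> Q) (P : Q -> Prop),
     [/\ mod_hom psi, surj psi, (forall v, psi v = 0 <-> U v) &
         [/\ stable P, (exists2 q, P q & q != 0) & @gsub (res hf Q) P]]) ->
  good (res hf M).
Proof.
move=> step.
have [||U [sU gU] max] := @ex_max_measure {vspace M}
  (fun U => @stable F L M (fun v => v \in U) /\ @gsub (res hf M) (fun v => v \in U))
  (fun U => \dim U) (dim M).
- exists 0%VS; split.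
    split; first exact: subsp_vspace.
    by move=> x v; rewrite !memv0 => /eqP ->; rewrite act0r.
  have [M0 [h [gM hh hP]]] := gsub0 (res hf M); exists M0, h; split=> // v.
  by rewrite memv0 -hP; split=> /eqP.
- by move=> U _; rewrite -dimvf dimvS // subvf.
case: (classic (exists v, v \notin U)) => [[v0 nv0]|no]; last first.
  have [M0 [h [gM hh hP]]] := gU; apply: gsub_full; exists M0, h; split=> // v.
  rewrite -hP; split=> // _; apply/negPn/negP => nv; by apply: no; exists v.
have [|Q [psi [P [hpsi spsi kpsi [sP [q0 Pq0 nq0] gP]]]]] := step (fun v => v \in U) sU.
  by exists v0; apply/negP.
have [lpsi epsi] := hpsi.
have [U' U'P] : exists U' : {vspace M}, forall v, v \in U' <-> P (psi v).
  apply: vspace_of_subsp; split; first by rewrite (linf0 lpsi); case: sP => -[].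
  by move=> a x y hx hy; rewrite lpsi; apply: sP.1.2.
have gU' : @gsub (res hf M) (fun v => v \in U').
  have hpsi' : @mod_hom F S (res hf M) (res hf Q) psi by split=> // x v; apply: epsi.
  have gk : @gsub (res hf M) (fun v => psi v = 0).
    have [M0 [h [gM hh hP]]] := gU; exists M0, h; split=> // v.
    by rewrite kpsi.
  have [M0 [h [gM hh hP]]] := gsub_ext hpsi' spsi gk gP; exists M0, h; split=> // v.
  by rewrite U'P.
have sU' : @stable F L M (fun v => v \in U').
  split; first exact: subsp_vspace.
  by move=> x v /U'P pv; apply/U'P; rewrite epsi; apply: sP.2.
have le := max U' (conj sU' gU'); have [v vE] := spsi q0.
have UU' u : u \in U -> u \in U'.
  by move=> /kpsi hu; apply/U'P; rewrite hu; case: sP => -[].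
case/eqP: nq0; rewrite -vE; apply/kpsi; apply: (subv_dim_eq UU' le).
by apply/U'P; rewrite vE.
Qed.

End Exhaustion.

Lemma id_hom : lie_hom (@id S).
Proof. by []. Qed.

Lemma good_exhaust_id M :
  (forall U : M -> Prop, stable U -> (exists v, ~ U v) ->
     exists (Q : lmodule S) (psi : M -> Q) (P : Q -> Prop),
     [/\ mod_hom psi, surj psi, (forall v, psi v = 0 <-> U v),
         (exists2 q, P q & q != 0) & gsub P]) ->
  good M.
Proof.
move=> step; apply: (@good_im (res id_hom M) M id); [by split | by move=> y; exists y |].
apply: good_exhaust => U sU nU; have [Q [psi [P [hp sp kp nP gP]]]] := step U sU nU.
by exists Q, psi, P; split=> //; split=> //; exact: gsub_stable.
Qed.

(** Take the first term of the subnormal chain not inside the submodule [U]. If it is not [S]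
    itself, [S] maps it into the preceding term, hence into [U], and it yields a trivial submodule
    of L / U. If it is [S], solubility gives an ideal A of [S] abelian modulo [U], and A / (A /\ U)
    is an abelian ideal of a quotient of [S]. *)
Lemma good_adj (L : lieAlgebra F) (f : S -> L) (hf : lie_hom f) (S0 : {vspace L}) :
  (forall y, y \in S0 <-> exists x, f x = y) -> subnormal S0 -> good (res hf (adj L)).
Proof.
move=> imf [n [c [c0 [cn [_ ci]]]]].
have [lf ef] := hf.
apply: good_exhaust_id => U sU [v0 nv0].
have [Q [psi [si [hpsi lsi psiK kpsi]]]] := quotient_module sU.
have [lpsi epsi] := hpsi.
have spsi : surj psi by move=> q; exists (si q).
have ex : exists i, ~ (forall x, x \in c i -> U x).
  by exists n => H; apply: nv0; apply: H; rewrite cn memvf.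
have [i nci min] := ex_min_measure id ex.
have {}min m : (m < i)%N -> forall x, x \in c m -> U x.
  move=> lt; apply: NNPP => no; have := min m no; by rewrite leqNgt lt.
have leN : (i <= n)%N.
  rewrite leqNgt; apply/negP => lt; apply: nci => x xi; have := min n lt v0.
  by rewrite cn memvf => /(_ isT) /nv0.
case: i nci min leN => [|i] nci min leN.
  have [H HP] : exists H : {vspace S}, forall s, s \in H <-> U (f s).
    apply: vspace_of_subsp; split; first by rewrite (linf0 lf); case: sU => -[].
    by move=> a x y hx hy; rewrite lf; apply: sU.1.2.
  have [|A [iA [a0 Aa0 na0] abA]] := solS (H := H).
    apply: contra_not_neq nci => fH x; rewrite c0 => /imf[s <-].
    by apply/HP; rewrite fH memvf.
  exists Q, psi, (fun q => exists2 a, A a & psi (f a) = q); split=> //.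
    by exists (psi (f a0)); [exists a0 | apply: contra na0 => /eqP/kpsi/HP].
  have [sA jA] := iA.
  have [MA [iMA [[lA eA] iiA AP]]] := @submodule_ex _ _ (adj S) A (conj sA jA).
  have hh : mod_hom (fun m : MA => psi (f (iMA m)) : Q).
    split=> [a x y|x v]; first by rewrite lA lf lpsi.
    by rewrite eA /= ef -epsi.
  have [|T [pi [sT [[lpi epi] lsT piK kpi]]]] :=
      @quotient_module _ _ MA (fun m => psi (f (iMA m)) = 0).
    split; last by move=> x v; rewrite hh.2 => ->; rewrite act0r.
    split; first by rewrite (linf0 hh.1).
    by move=> a x y hx hy; rewrite hh.1 hx hy scaler0 addr0.
  have iB : idealP (fun s => A s /\ U (f s)).
    split; first split.
    - by split; [case: sA | rewrite (linf0 lf); case: sU => -[]].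
    - move=> a x y [h1 h2] [k1 k2]; split; first exact: sA.2.
      by rewrite lf; apply: sU.1.2.
    - move=> x y [h1 h2]; split; first exact: jA.
      rewrite ef; exact: (sU.2 x).
  have [E [p [[lp ep] spp kp]]] := lie_quotient iB.
  have pk m : psi (f (iMA m)) = 0 -> p (iMA m) = 0.
    by move=> hm; apply/kp; split; [apply/AP; exists m | apply/kpsi].
  have gT : good T.
    apply: (@good_abelian E p T (fun t => p (iMA (sT t)))) => //.
    - exact: (Fo_im sF (conj lp ep) spp FS).
    - by move=> a x y; rewrite lsT lA lp.
    - apply: linf_inj; first by move=> a x y; rewrite lsT lA lp.
      by move=> t /kp[_ /kpsi h]; rewrite -(piK t); apply/kpi.
    - move=> t t'; rewrite -ep; apply/kp.
      have At u : A (iMA u) by apply/AP; exists u.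
      by split; [apply: jA | apply/HP/abA].
    - move=> s t; rewrite -ep; apply/eqP; rewrite -subr_eq0 -(linfB lp).
      rewrite -[ [lie s, _] ]/(s \> (iMA (sT t) : adj S)) -eA -(linfB lA); apply/eqP/pk/kpi.
      by rewrite (linfB lpi) epi !piK subrr.
  have psE m : psi (f (iMA (sT (pi m)))) = psi (f (iMA m)).
    apply/eqP; rewrite -subr_eq0 -(linfB hh.1); apply/eqP/kpi.
    by rewrite (linfB lpi) piK subrr.
  exists T, (fun t => psi (f (iMA (sT t)))); split=> //.
    split=> [a x y|x v]; first by rewrite lsT hh.1.
    by rewrite -{1}(piK v) -epi psE hh.2.
  move=> q; split=> [[a /AP[m <-] <-]|[t <-]]; first by exists (pi m).
  by exists (iMA (sT t)) => //; apply/AP; exists (sT t).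
have [v vc nv] : exists2 v, v \in c i.+1 & ~ U v.
  apply: NNPP => no; apply: nci => x xc; apply: NNPP => nx; apply: no; by exists x.
have inc k : (k <= i)%N -> (S0 <= c k)%VS.
  elim: k => [|k IH] lek; first by rewrite c0.
  apply: subv_trans (IH (ltnW lek)) _; have [] // := ci k.
  exact: leq_trans lek (ltnW leN).
have act0 s : s \> (psi v) = 0.
  rewrite -epsi; apply/kpsi; apply: (min i) => //.
  rewrite /= brC memvN; have [_ H] := ci i leN; apply: H => //.
  by apply: (subvP (inc i (leqnn i))); apply/imf; exists s.
exists Q, psi, (fun q => exists a : F, a *: psi v = q); split=> //.
  by exists (psi v); [exists 1; rewrite scale1r | apply/eqP => /kpsi].
exists (triv S), (fun a : F^o => (a : F) *: psi v); split=> //; first exact: good_triv.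
split=> [a x y|x a]; first by rewrite scalerDl scalerA.
by rewrite actZr act0 scaler0 /= /triv_act scale0r.
Qed.

End FixS.
End Hypercentral.

(** * Matrix representations and their tensor products *)

Section MatrixReps.
Variables (F : fieldType) (L : lieAlgebra F).

Lemma rep_actl n (rho : L -> 'M[F]_n) : lie_rep rho -> forall v : 'rV[F]_n, lin (fun x => v *m rho x).
Proof. by move=> [lr _] v a x y; rewrite lr mulmxDr -scalemxAr. Qed.

Lemma rep_actr n (rho : L -> 'M[F]_n) x : @lin F 'rV[F]_n 'rV[F]_n (fun v => v *m rho x).
Proof. by move=> a u v; rewrite mulmxDl scalemxAl. Qed.

Lemma rep_actbr n (rho : L -> 'M[F]_n) : lie_rep rho -> forall (x y : L) (v : 'rV[F]_n),
  v *m rho [lie x, y] = (v *m rho y) *m rho x - (v *m rho x) *m rho y.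
Proof. by move=> [_ br] x y v; rewrite br mulmxBr !mulmxA. Qed.

Definition rmod n (rho : L -> 'M[F]_n) (H : lie_rep rho) : lmodule L :=
  LModule (rep_actl H) (@rep_actr n rho) (rep_actbr H).

Lemma row_mx_eq m n (A B : 'M[F]_(m, n)) : (forall v : 'rV_m, v *m A = v *m B) -> A = B.
Proof. by move=> H; apply/row_matrixP => i; rewrite !rowE. Qed.

Lemma module_rep (M : lmodule L) : exists rho : L -> 'M[F]_(dim M),
  lie_rep rho /\ forall x (v : M), v2r (x \> v) = v2r v *m rho x.
Proof.
have ex x : exists A : 'M[F]_(dim M), forall v : M, v2r (x \> v) = v2r v *m A.
  have l : lin (fun v : 'rV[F]_(dim M) => v2r (x \> (r2v v : M))).
    by move=> a u v; rewrite linearP /= actDr actZr linearP.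
  have [h hE] := lin_hom l.
  by exists (lin1_mx h) => v; rewrite mul_rV_lin1 /= hE v2rK.
have [rho rE] := choice_fun ex; exists rho; split=> //; split=> [a x y|x y].
  apply: row_mx_eq => v; rewrite -(r2vK v) mulmxDr -scalemxAr -!rE.
  by rewrite actDl actZl linearP.
apply: row_mx_eq => v; rewrite -(r2vK v) mulmxBr !mulmxA -!rE.
by rewrite lm_actbr linearB.
Qed.

Lemma mxexpS n (A : 'M[F]_n) k : A ^+ k.+1 = A *m A ^+ k.
Proof. exact: exprS. Qed.

Lemma mxexpSr n (A : 'M[F]_n) k : A ^+ k.+1 = A ^+ k *m A.
Proof. exact: exprSr. Qed.

Lemma mul_expmx_iter n (A : 'M[F]_n) k (v : 'rV[F]_n) :
  v *m A ^+ k = iter k (fun u => u *m A) v.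
Proof. by elim: k => [|k IH]; rewrite ?mulmx1 //= -IH mxexpSr mulmxA. Qed.

Lemma trmx_exp n (A : 'M[F]_n) k : (A ^+ k)^T = A^T ^+ k.
Proof.
elim: k => [|k IH]; first by rewrite !expr0 trmx1.
by rewrite mxexpS trmx_mul IH mxexpSr.
Qed.

Section Tensor.
Variables (m n : nat).
Implicit Types (M : 'M[F]_(m, n)).

Lemma mxvec_eq (A B : 'M[F]_(m * n)) :
  (forall M, mxvec M *m A = mxvec M *m B) -> A = B.
Proof. by move=> H; apply: row_mx_eq => v; rewrite -(vec_mxK v). Qed.

(** The Kronecker sum of [A] and [B]: the tensor product is the space of matrices, with u^T v as the
    pure tensor of u and v. *)
Definition tens_mx (A : 'M[F]_m) (B : 'M[F]_n) : 'M[F]_(m * n) :=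
  lin_mulmx A^T + lin_mulmxr B.

Lemma mul_tens_mx A B M : mxvec M *m tens_mx A B = mxvec (A^T *m M + M *m B).
Proof. by rewrite mulmxDr !mul_vec_lin linearD. Qed.

Lemma tens_mx_lin a A A' B B' :
  tens_mx (a *: A + A') (a *: B + B') = a *: tens_mx A B + tens_mx A' B'.
Proof.
apply: mxvec_eq => M; rewrite [RHS]mulmxDr -scalemxAr !mul_tens_mx.
rewrite -linearZ -linearD; congr mxvec.
rewrite [(_ + _)^T]linearD /= [(_ *: _)^T]linearZ /=.
rewrite mulmxDl mulmxDr -scalemxAl -scalemxAr scalerDr.
by rewrite addrACA.
Qed.

Lemma tens_rep (L' : lieAlgebra F) (r1 : L' -> 'M[F]_m) (r2 : L' -> 'M[F]_n) :
  lie_rep r1 -> lie_rep r2 -> lie_rep (fun x => tens_mx (r1 x) (r2 x)).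
Proof.
move=> [l1 b1] [l2 b2]; split=> [a x y|x y]; first by rewrite l1 l2 tens_mx_lin.
apply: mxvec_eq => M; rewrite [RHS]mulmxBr !mulmxA !mul_tens_mx -linearB; congr mxvec.
rewrite b1 b2 !(linearB, linearD) /= !trmx_mul !(mulmxDl, mulmxDr, mulmxBl, mulmxBr).
rewrite ?(mulmxN, mulNmx) !mulmxA; vring.
Qed.

End Tensor.

End MatrixReps.

(** * Additivity of p-th powers *)

Section Frobenius.
Variables (F : fieldType) (p : nat).
Hypothesis pF : p \in [pchar F].

Lemma mulrn_dvd (V : lmodType F) k (v : V) : (p %| k)%N -> v *+ k = 0.
Proof. by move=> pk; rewrite -scaler_nat (_ : k%:R = 0) ?scale0r //; apply/eqP; rewrite -(dvdn_pcharf pF). Qed.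

Lemma expr_p_addmx n (A B : 'M[F]_n) : A *m B = B *m A -> (A + B) ^+ p = A ^+ p + B ^+ p.
Proof.
move=> cAB; have prp := pcharf_prime pF; rewrite (exprDn_comm p (cAB : GRing.comm A B)).
have [q qE] : exists q, p = q.+1 by exists p.-1; rewrite prednK // prime_gt0.
rewrite qE big_ord_recl big_ord_recr /= subn0 subnn bin0 binn !expr0 mulr1 mul1r !mulr1n.
rewrite big1 ?add0r // => i _; apply: mulrn_dvd; rewrite -qE prime_dvd_bin //=.
by rewrite qE /bump /= add1n ltnS.
Qed.

(** Left and right multiplications commute, so the binomial theorem modulo p applies. This is why
    p-th powers of characters add under tensor products. *)
Lemma tens_exp_p m n (A : 'M[F]_m) (B : 'M[F]_n) :
  tens_mx A B ^+ p = tens_mx (A ^+ p) (B ^+ p).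
Proof.
have lE k M : mxvec M *m (lin_mulmx A^T) ^+ k = mxvec (A^T ^+ k *m M) :> 'rV[F]_(m * n).
  elim: k M => [|k IH] M; first by rewrite mulmx1 mul1mx.
  by rewrite [in LHS]mxexpS [LHS]mulmxA mul_vec_lin IH mxexpSr mulmxA.
have rE k M : mxvec M *m (lin_mulmxr B) ^+ k = mxvec (M *m B ^+ k) :> 'rV[F]_(m * n).
  elim: k M => [|k IH] M; first by rewrite !mulmx1.
  by rewrite [in LHS]mxexpS [LHS]mulmxA mul_vec_lin IH mxexpS mulmxA.
rewrite expr_p_addmx.
  by apply: mxvec_eq => M; rewrite mulmxDr lE rE -linearD /= mul_tens_mx trmx_exp.
by apply: mxvec_eq => M; rewrite !mulmxA !mul_vec_lin /= mulmxA.
Qed.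

End Frobenius.

(** * Functions on words *)

Section Multinomial.
Variable n : nat.
Implicit Types (a : {ffun 'I_n -> nat}) (w : seq 'I_n).

Definition ffdec a i : {ffun 'I_n -> nat} := [ffun j => a j - (j == i)]%N.
Definition ffinc a i : {ffun 'I_n -> nat} := [ffun j => a j + (j == i)]%N.

Lemma ffincK a i : ffdec (ffinc a i) i = a.
Proof. by apply/ffunP => j; rewrite !ffunE addnK. Qed.

Lemma ffdecK a i : (0 < a i)%N -> ffinc (ffdec a i) i = a.
Proof.
by move=> ai; apply/ffunP => j; rewrite !ffunE; case: eqP => [->|_] /=; lia.
Qed.

Lemma ffdec_inc a i j : i != j -> ffdec (ffinc a i) j = ffinc (ffdec a j) i.
Proof.
move=> ij; apply/ffunP => k; rewrite !ffunE.
by case: (eqVneq k i) => [->|_]; rewrite ?(negPf ij) /=; lia.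
Qed.

(* The value of the iterated partial derivative along w of the monomial with
   exponents a at the origin. *)
Fixpoint nder a w : nat :=
  if w is i :: w' then (a i * nder (ffdec a i) w')%N else [forall i, a i == 0%N].

Lemma nder_count a w : nder a w != 0%N -> forall i, count_mem i w = a i.
Proof.
elim: w a => [|j w IH] a /=; first by case: forallP => // H _ i; rewrite (eqP (H i)).
rewrite muln_eq0 negb_or => /andP[aj /IH H] i; rewrite H ffunE eq_sym.
by case: eqP => [->|_] /=; move: aj; lia.
Qed.

(** For matching letter counts the value is the product of the factorials of the [a i], which is
    prime to p when all exponents are below p. *)
Lemma nder_neq0 (F : fieldType) p a w : p \in [pchar F] -> (forall i, count_mem i w = a i) ->
  (forall i, a i < p)%N -> (nder a w)%:R != 0 :> F.
Proof.
move=> pF; elim: w a => [|j w IH] a H lt /=.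
  by case: forallP => [_|[]]; rewrite ?oner_neq0 // => i; rewrite -H.
have aj : (0 < a j)%N by rewrite -H /= eqxx.
rewrite natrM mulf_neq0 ?IH //.
- by rewrite -(dvdn_pcharf pF) gtnNdvd.
- by move=> i; rewrite ffunE -H /= eq_sym addKn.
- by move=> i; rewrite ffunE; apply: leq_ltn_trans (lt i); apply: leq_subr.
Qed.

Lemma nder_inc0 a i : nder (ffinc a i) [::] = 0%N.
Proof.
by rewrite /=; case: forallP => // /(_ i); rewrite ffunE eqxx addn1.
Qed.

End Multinomial.

(** The required letter is moved to the front by adjacent swaps. The length is fixed because the
    functions concerned are symmetric only on words of their leading length. *)
Lemma swap_perm (T : eqType) (V : Type) (k : nat) (g : seq T -> V) :
  (forall u x y v, size (u ++ x :: y :: v) = k -> g (u ++ x :: y :: v) = g (u ++ y :: x :: v)) ->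
  forall w w', size w = k -> perm_eq w w' -> g w = g w'.
Proof.
move=> sw w w' sz pe; elim: w k g sw w' sz pe => [|x w IH] k g sw w' sz pe.
  by move: pe; rewrite perm_sym => /perm_nilP ->.
have xw' : x \in w' by rewrite -(perm_mem pe) mem_head.
case/splitPr: xw' pe => u v pe.
have mv t u' : size (t ++ u' ++ x :: v) = k -> g (t ++ u' ++ x :: v) = g (t ++ x :: u' ++ v).
  elim: u' t => [|y u' IHu] t sz' //=.
  rewrite -cat_rcons IHu ?cat_rcons //= -sw //.
  by move: sz'; rewrite /= !size_cat /= !size_cat /=; lia.
have szw := perm_size pe; rewrite (mv [::] u) /=; last by rewrite -szw.
have pe' : perm_eq w (u ++ v).
  rewrite -(perm_cons x); apply: perm_trans pe _.
  by rewrite -(cat1s x v) perm_catCA.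
apply: (IH (size w) (fun s => g (x :: s))) => // t y z s szt.
by apply: (sw (x :: t)); rewrite /= szt.
Qed.

Section Words.
Variables (F : fieldType) (Fo : lie_class F).
Hypothesis sF : saturated_formation Fo.
Variables (S : lieAlgebra F).
Hypotheses (FS : Fo S) (nzS : exists s : S, s != 0).
Variables (L : lieAlgebra F) (f : S -> L).
Hypothesis hf : lie_hom f.
Variables (p : nat) (pm : L -> L).
Hypotheses (pF : p \in [pchar F]) (rL : restricted p pm).

Definition ggood n (rho : L -> 'M[F]_n) :=
  exists H : lie_rep rho, good Fo (res hf (rmod H)).

Definition nice n (rho : L -> 'M[F]_n) :=
  [/\ ggood rho, forall x, rho x ^+ p = rho (pm x) & forall z, in_centre z -> rho z = 0].

(** The leftmost letter acts last, so a word acts like the product of its letters in the enveloping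
    algebra. *)
Definition wact n (rho : L -> 'M[F]_n) (w : seq L) (v : 'rV[F]_n) :=
  foldr (fun x u => u *m rho x) v w.

Lemma wact_cat n (rho : L -> 'M[F]_n) u w v : wact rho (u ++ w) v = wact rho u (wact rho w v).
Proof. by rewrite /wact foldr_cat. Qed.

Lemma wact_lin n (rho : L -> 'M[F]_n) w : lin (wact rho w).
Proof. by elim: w => [|x w IH] a u v //=; rewrite IH mulmxDl scalemxAl. Qed.

(* The functions on words which vanish on the relations of the restricted
   enveloping algebra of L / Z(L). *)
Record wfun (V : lmodType F) (c : seq L -> V) := WFun {
  wf_lin : forall u v, lin (fun x => c (u ++ x :: v));
  wf_comm : forall u v x y,
    c (u ++ x :: y :: v) - c (u ++ y :: x :: v) = c (u ++ [lie x, y] :: v);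
  wf_pow : forall u v x, c (u ++ nseq p x ++ v) = c (u ++ pm x :: v);
  wf_centre : forall u v z, in_centre z -> c (u ++ z :: v) = 0
}.

Lemma wfun_lin V c d a : @wfun V c -> @wfun V d -> wfun (fun w => a *: c w + d w).
Proof.
move=> [cl cc cp cz] [dl dc dp dz]; split=> [u v b x y|u v x y|u v x|u v z hz].
- by rewrite cl dl !scalerDr !scalerA (mulrC a) addrACA.
- by rewrite -cc -dc scalerBr opprD addrACA.
- by rewrite cp dp.
- by rewrite cz // dz // scaler0 addr0.
Qed.

Lemma wact_wfun n N (rho : L -> 'M[F]_n) (P : 'rV[F]_n -> Prop) y (m : 'M[F]_(n, N)) :
  lie_rep rho -> (forall x v, P v -> P (v *m rho x)) ->
  (forall x v, P v -> v *m rho x ^+ p = v *m rho (pm x)) ->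
  (forall z v, P v -> in_centre z -> v *m rho z = 0) -> P y ->
  wfun (fun w => wact rho w y *m m).
Proof.
move=> hrho sP pP zP Py.
have Pw w : P (wact rho w y) by elim: w => //= x w IH; apply: sP.
split=> [u v a x z|u v x z|u v x|u v z hz]; rewrite !wact_cat /=.
- by rewrite (rep_actl hrho) wact_lin mulmxDl scalemxAl.
- by rewrite -mulmxBl -(linfB (wact_lin _ _)) (rep_actbr hrho).
- rewrite -pP // mul_expmx_iter; congr (wact _ _ _ *m _).
  by elim: (p) => //= k ->.
- by rewrite zP // (linf0 (wact_lin _ _)) mul0mx.
Qed.

(** Matrix coefficients of nice representations; [m] bundles N functionals, so that one
    representation serves all coordinates. *)
Definition coefP N (c : seq L -> 'rV[F]_N) := exists n (rho : L -> 'M[F]_n) y (m : 'M[F]_(n, N)),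
  nice rho /\ forall w, c w = wact rho w y *m m.

Definition coefS (c : seq L -> F) := exists n (rho : L -> 'M[F]_n) y (m : 'cV[F]_n),
  nice rho /\ forall w, c w = (wact rho w y *m m) 0 0.

Lemma coefP_wfun N (c : seq L -> 'rV[F]_N) : coefP c -> wfun c.
Proof.
move=> [n [rho [y [m [[[hrho _] hp hz] cE]]]]].
have [cl cc cp cz] := @wact_wfun n N rho (fun=> True) y m hrho (fun _ _ _ => I)
  (fun x v _ => congr1 (mulmx v) (hp x))
  (fun z v _ h => etrans (congr1 (mulmx v) (hz z h)) (mulmx0 _ _)) I.
split=> [u v a x x'|u v x x'|u v x|u v z h]; rewrite !cE; [exact: cl|exact: cc|exact: cp|].
exact: cz.
Qed.

Lemma nice_triv : @nice 1 (fun=> 0).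
Proof.
split=> // [|x]; last by rewrite expr0n; case: p (pcharf_prime pF).
have H : @lie_rep F L 1 (fun=> 0).
  by split=> [a x y|x y]; rewrite ?scaler0 ?addr0 // mulmx0 subrr.
exists H; apply: (@good_im _ _ sF S (triv S) (res hf (rmod H)) (fun a : F^o => (a%:M : 'rV[F]_1))) (good_triv sF FS nzS).
  split=> [a x y|x v]; first by rewrite raddfD /= -mul_scalar_mx -scalar_mxM.
  by rewrite /= /triv_act mulmx0 raddf0.
by move=> v; exists (v 0 0); rewrite -mx11_scalar.
Qed.

Lemma coefP_scale N (c : seq L -> F) (t : 'rV[F]_N) : coefS c -> coefP (fun w => c w *: t).
Proof.
move=> [n [rho [y [m [nr cE]]]]]; exists n, rho, y, (m *m t); split=> // w.
by rewrite cE mulmxA [wact rho w y *m m]mx11_scalar mul_scalar_mx mxE eqxx mulr1n.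
Qed.

Lemma block_exp n1 n2 (A : 'M[F]_n1) (B : 'M[F]_n2) k :
  block_mx A 0 0 B ^+ k = block_mx (A ^+ k) 0 0 (B ^+ k).
Proof.
elim: k => [|k IH]; first by rewrite !expr0 -scalar_mx_block.
by rewrite mxexpS IH mulmx_block !(mulmx0, mul0mx, addr0, add0r) -!mxexpS.
Qed.

Lemma nice_block n1 n2 (r1 : L -> 'M[F]_n1) (r2 : L -> 'M[F]_n2) :
  nice r1 -> nice r2 -> nice (fun x => block_mx (r1 x) 0 0 (r2 x)).
Proof.
move=> [[H1 g1] p1 z1] [[H2 g2] p2 z2]; split=> [|x|z hz]; last first.
- by rewrite z1 // z2 // /block_mx !row_mx0 col_mx0.
- by rewrite block_exp p1 p2.
have H : lie_rep (fun x => block_mx (r1 x) 0 0 (r2 x)).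
  split=> [a x y|x y].
    by rewrite H1.1 H2.1 scale_block_mx add_block_mx !scaler0 !addr0.
  rewrite H1.2 H2.2 !mulmx_block !(mulmx0, mul0mx, addr0, add0r).
  by rewrite opp_block_mx add_block_mx !oppr0 !addr0.
exists H.
refine (@good_inj2 F Fo sF S (res hf (rmod H1)) (res hf (rmod H2)) (res hf (rmod H))
  (fun v : 'rV[F]_(n1 + n2) => lsubmx v) (fun v : 'rV[F]_(n1 + n2) => rsubmx v) _ _ _ g1 g2).
- split=> [a u v|x v]; first by rewrite linearP.
  by rewrite /= -{1}(hsubmxK v) mul_row_block !mulmx0 addr0 row_mxKl.
- split=> [a u v|x v]; first by rewrite linearP.
  by rewrite /= -{1}(hsubmxK v) mul_row_block !mulmx0 add0r row_mxKr.
- by move=> v hl hr; rewrite -(hsubmxK v) hl hr row_mx0.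
Qed.

Lemma wact_block n1 n2 (r1 : L -> 'M[F]_n1) (r2 : L -> 'M[F]_n2) w y1 y2 :
  wact (fun x => block_mx (r1 x) 0 0 (r2 x)) w (row_mx y1 y2) =
  row_mx (wact r1 w y1) (wact r2 w y2).
Proof.
by elim: w => //= x w ->; rewrite mul_row_block !mulmx0 addr0 add0r.
Qed.

Lemma coefP_lin N a (c d : seq L -> 'rV[F]_N) :
  coefP c -> coefP d -> coefP (fun w => a *: c w + d w).
Proof.
move=> [n1 [r1 [y1 [m1 [h1 c1]]]]] [n2 [r2 [y2 [m2 [h2 c2]]]]].
exists (n1 + n2)%N, (fun x => block_mx (r1 x) 0 0 (r2 x)), (row_mx y1 y2), (col_mx (a *: m1) m2).
split=> [|w]; first exact: nice_block.
by rewrite wact_block mul_row_col -scalemxAr c1 c2.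
Qed.

Lemma coefS_lin a (c d : seq L -> F) :
  coefS c -> coefS d -> coefS (fun w => a * c w + d w).
Proof.
move=> [n1 [r1 [y1 [m1 [h1 c1]]]]] [n2 [r2 [y2 [m2 [h2 c2]]]]].
exists (n1 + n2)%N, (fun x => block_mx (r1 x) 0 0 (r2 x)), (row_mx y1 y2), (col_mx (a *: m1) m2).
split=> [|w]; first exact: nice_block.
by rewrite wact_block mul_row_col -scalemxAr c1 c2 !mxE.
Qed.

Lemma coefS_one : coefS (fun w => (w == [::])%:R).
Proof.
exists 1%N, (fun=> 0), 1%:M, 1%:M; split=> [|[|x w]]; first exact: nice_triv.
  by rewrite mulmx1 mxE eqxx.
by rewrite /= mulmx0 mul0mx mxE.
Qed.

Lemma coefS_ext c d : (forall w, c w = d w) -> coefS c -> coefS d.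
Proof.
by move=> e [n [r [y [m [h cE]]]]]; exists n, r, y, m; split=> // w; rewrite -e.
Qed.

Lemma coefS0 : coefS (fun=> 0).
Proof.
apply: coefS_ext (coefS_lin (-1) coefS_one coefS_one) => w.
by rewrite mulN1r addNr.
Qed.

(* The product of functions dual to the coproduct for which letters are primitive. *)
Fixpoint wprod (w : seq L) (c d : seq L -> F) : F :=
  if w is x :: w' then wprod w' (fun v => c (x :: v)) d + wprod w' c (fun v => d (x :: v))
  else c [::] * d [::].

Lemma wprod_ext w c c' d d' : (forall v, c v = c' v) -> (forall v, d v = d' v) ->
  wprod w c d = wprod w c' d'.
Proof.
elim: w c c' d d' => [|x w IH] c c' d d' ec ed /=; first by rewrite ec ed.
by congr (_ + _); apply: IH.
Qed.

Lemma nice_tens n1 n2 (r1 : L -> 'M[F]_n1) (r2 : L -> 'M[F]_n2) :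
  nice r1 -> nice r2 -> nice (fun x => tens_mx (r1 x) (r2 x)).
Proof.
move=> [[H1 g1] p1 z1] [[H2 g2] p2 z2]; split=> [|x|z hz]; last first.
- rewrite z1 // z2 //; apply: mxvec_eq => M.
  by rewrite mul_tens_mx trmx0 mul0mx !mulmx0 addr0 raddf0.
- by rewrite (tens_exp_p pF) p1 p2.
have H := tens_rep H1 H2; exists H; apply: (gsub_full sF).
pose b (u : res hf (rmod H1)) (v : res hf (rmod H2)) : res hf (rmod H) :=
  mxvec ((u : 'rV_n1)^T *m (v : 'rV_n2)).
have bl y : lin (fun x => b x y).
  by move=> a u v; rewrite /b linearP /= mulmxDl -scalemxAl linearP.
have br x : lin (b x).
  by move=> a u v; rewrite /b mulmxDr -scalemxAr linearP.
have beq s x y : s \> b x y = b (s \> x) y + b x (s \> y).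
  rewrite /= /b mul_tens_mx -linearD /= trmx_mul.
  by congr (mxvec (_ + _)); rewrite mulmxA.
have [M0 [h [gM hh hP]]] := gsub_bilin sF FS bl br beq g1 g2.
exists M0, h; split=> // v; rewrite -hP; split=> // _ U bU.
rewrite -(vec_mxK v) [vec_mx v]matrix_sum_delta linear_sum; apply: memv_suml => i _ /=.
rewrite linear_sum; apply: memv_suml => j _ /=; rewrite linearZ memvZ //=.
have := bU (delta_mx 0 i) (delta_mx 0 j).
by rewrite /b trmx_delta mul_delta_mx.
Qed.

(** A letter acts on a tensor product through one factor or the other, which is the recursion of
    [wprod]. *)
Lemma coefS_prod c d : coefS c -> coefS d -> coefS (fun w => wprod w c d).
Proof.
move=> [n1 [r1 [y1 [m1 [h1 c1]]]]] [n2 [r2 [y2 [m2 [h2 c2]]]]].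
have l : @lin F 'rV[F]_(n1 * n2) 'rV[F]_1 (fun v => m1^T *m vec_mx v *m m2).
  by move=> a u v; rewrite linearP mulmxDr -scalemxAr mulmxDl -scalemxAl.
have [h hE] := lin_hom l.
exists (n1 * n2)%N, (fun x => tens_mx (r1 x) (r2 x)), (mxvec (y1^T *m y2)), (lin1_mx h).
split=> [|w]; first exact: nice_tens.
rewrite (wprod_ext w c1 c2) mul_rV_lin1 /= hE; clear.
(* The leftmost letter acts last and is absorbed into the functionals, hence the induction over all
   [m1] and [m2]. *)
elim: w m1 m2 => [|x w IH] m1 m2 /=.
  rewrite mxvecK mulmxA -trmx_mul -mulmxA [RHS]mxE big_ord1.
  by congr (_ * _); rewrite [RHS]mxE.
rewrite -[wact _ w _]vec_mxK mul_tens_mx mxvecK mulmxDr mulmxDl mxE.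
have e1 V : m1^T *m ((r1 x)^T *m V) *m m2 = (r1 x *m m1)^T *m V *m m2.
  by rewrite trmx_mul !mulmxA.
have e2 V : m1^T *m (V *m r2 x) *m m2 = m1^T *m V *m (r2 x *m m2) by rewrite !mulmxA.
rewrite e1 e2 -!IH.
by congr (_ + _); apply: wprod_ext => v //=; rewrite mulmxA.
Qed.

Lemma wprod_low k w c d : (forall v, (size v < k)%N -> c v = 0) -> (size w < k)%N ->
  wprod w c d = 0.
Proof.
elim: w k c d => [|x w IH] k c d low lt /=; first by rewrite low ?mul0r.
rewrite (IH k.-1) => [|v lv|]; last 1 first.
- by move: lt => /=; lia.
- by rewrite (IH k) ?addr0 //; apply: ltnW.
- by rewrite low //=; lia.
Qed.

(** The terms evaluate [c] and [d] on complementary subwords; only the one that gives every letter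
    to [c] survives. *)
Lemma wprod_lead k w c d : (forall v, (size v < k)%N -> c v = 0) -> size w = k ->
  wprod w c d = c w * d [::].
Proof.
elim: w k c d => [|x w IH] k c d low sz //=.
rewrite (IH k.-1) => [|v lv|]; last 1 first.
- by rewrite -sz.
- by rewrite (@wprod_low k) ?addr0 // -sz.
- by rewrite low //=; lia.
Qed.

(** Leibniz rule: multiplying by a function with linear part dual to [X i] raises the i-th exponent
    of the leading monomial. The scalar [q] is for the induction, where differentiation along [X j]
    brings out the factor [a j]. *)
Lemma wprod_nder n (X : 'I_n -> L) (i : 'I_n) (q : F) (a : {ffun 'I_n -> nat}) k w c d :
  d [::] = 0 -> (forall j, d [:: X j] = (i == j)%:R) ->
  (forall v, (size v < k)%N -> c v = 0) ->
  (forall v, size v = k -> c (map X v) = q * (nder a v)%:R) ->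
  size w = k.+1 -> wprod (map X w) c d = q * (nder (ffinc a i) w)%:R.
Proof.
move=> d0 dX; elim: k w q a c => [|k IH] [|j w] // q a c low cE [] sz.
  move: sz => /size0nil -> /=; rewrite dX d0 mulr0 add0r.
  rewrite (cE [::]) //=; case: (eqVneq i j) => [->|ij].
    rewrite ffincK mulr1 ffunE ?eqxx /= addn1.
    case: forallP => [a0|_]; last by rewrite muln0.
    by rewrite (eqP (a0 j)).
  rewrite mulr0 -[X in (_ * X)%N]/(nder _ [::]) ffdec_inc // nder_inc0 muln0.
  by rewrite mulr0.
rewrite /= (IH w (q * (a j)%:R) (ffdec a j)) => [|v lv|v sv|]; last 1 first.
- by [].
- rewrite (@wprod_lead k.+1) ?size_map // cE // dX ffunE.
  case: (eqVneq i j) => [->|ij]; last first.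
    by rewrite mulr0 addr0 ffdec_inc //= addn0 natrM mulrA.
  rewrite ?eqxx mulr1 ffincK /= addn1 mulSn natrD mulrDr addrC; congr (_ + _).
  (* For a j = 0 the truncated subtraction in [ffdec] is not undone by [ffinc], but the coefficient
     vanishes. *)
  case: (posnP (a j)) => [->|aj]; first by rewrite mul0n mulr0n !(mulr0, mul0r).
  by rewrite ffdecK // natrM mulrA.
- by rewrite low.
- by rewrite -[X j :: map X v]/(map X (j :: v)) cE /= ?sv // natrM mulrA.
Qed.

Lemma coefS_monomial n (X : 'I_n -> L) (eps : 'I_n -> seq L -> F) :
  (forall i, coefS (eps i)) -> (forall i, eps i [::] = 0) ->
  (forall i j, eps i [:: X j] = (i == j)%:R) ->
  forall m (a : {ffun 'I_n -> nat}), (\sum_i a i)%N = m -> exists P,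
   [/\ coefS P, (forall w, (size w < m)%N -> P w = 0) &
       (forall w, size w = m -> P (map X w) = (nder a w)%:R)].
Proof.
move=> eC e0 eX; elim=> [|m IH] a sa.
  exists (fun w => (w == [::])%:R); split=> // [|w /size0nil -> /=]; first exact: coefS_one.
  case: forallP => // -[] i; by rewrite -leqn0 -sa (bigD1 i) //= leq_addr.
have [i ai] : exists i, (0 < a i)%N.
  apply: NNPP => no; suff: (\sum_i a i)%N = 0%N by rewrite sa.
  apply: big1 => i _; apply/eqP; rewrite -leqn0 leqNgt; apply/negP => ai; apply: no; by exists i.
have [|P [PC Plow PE]] := IH (ffdec a i).
  apply: succn_inj; have <- : (\sum_j (ffdec a i j + (j == i)) = m.+1)%N.
    by rewrite -sa; apply: eq_bigr => j _; have /ffunP/(_ j) := ffdecK ai; rewrite ffunE.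
  have one : (\sum_(j < n) (j == i) = 1)%N.
    by rewrite (bigD1 i) //= eqxx big1 // => j /negPf ->.
  by rewrite big_split /= one addn1.
exists (fun w => wprod w P (eps i)); split=> [|w lw|w sw].
- exact: coefS_prod.
- case: (leqP m (size w)) => le; last exact: (wprod_low _ Plow).
  have sw : size w = m by apply/eqP; rewrite eqn_leq le andbT -ltnS.
  by rewrite (wprod_lead _ Plow sw) e0 mulr0.
- rewrite (@wprod_nder n X i 1 (ffdec a i) m) ?ffdecK ?mul1r // => v sv.
  by rewrite PE // mul1r.
Qed.

Hypothesis gadj : good Fo (res hf (adj L)).

Lemma coefS_sum (I : Type) (r : seq I) (a : I -> F) (c : I -> seq L -> F) :
  (forall i, coefS (c i)) -> coefS (fun w => \sum_(i <- r) a i * c i w).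
Proof.
move=> cC; elim: r => [|i r IH]; first by apply: coefS_ext coefS0 => w; rewrite big_nil.
by apply: coefS_ext (coefS_lin (a i) (cC i) IH) => w; rewrite big_cons.
Qed.

(** The kernel of ad is the centre, so [l] factors through the adjoint representation, followed by a
    functional [h] on matrices, which is a combination of matrix entries. *)
Lemma coefS_linear (l : L -> F^o) : lin l -> (forall z, in_centre z -> l z = 0) ->
  exists d, [/\ coefS d, d [::] = 0 & forall x, d [:: x] = l x].
Proof.
move=> ll lz; have [rho [H rE]] := module_rep (adj L).
have rV (v : 'rV[F]_(dim (adj L))) x : v *m rho x = v2r (x \> (r2v v : adj L)).
  by rewrite rE r2vK.
have r0 x : rho x = 0 <-> in_centre x.
  split=> [h y|h]; last by apply: row_mx_eq => v; rewrite rV /= h linear0 mulmx0.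
  by apply: (v2r_inj (vT := adj L)); rewrite (rE x y) h mulmx0 linear0.
have nr : nice rho.
  split=> [|x|z /r0 //].
    exists H; apply: (@good_im _ _ sF S (res hf (adj L)) (res hf (rmod H))
      (fun v => v2r (v : adj L)) _ _ gadj).
      by split=> [a u v|x v]; [rewrite linearP | rewrite /= -rE].
    by move=> v; exists (r2v v : adj L); rewrite r2vK.
  apply: row_mx_eq => v; rewrite mul_expmx_iter rV /=.
  rewrite (rL.2.1 x) -[v in LHS]r2vK; elim: (p) => //= k ->.
  by rewrite -(rE x).
have [g gE] := lin_hom (fun a x y => H.1 a x y : rho _ = _).
(* The pseudo-inverse recovers x from [rho x] up to the centre, where [l] vanishes. *)
pose h (M : 'M[F]_(dim (adj L))) := l ((g^-1)%VF M).
have lh : lin h by apply: (lin_comp ll) => a x y; rewrite linearP.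
have hE x : h (rho x) = l x.
  apply/eqP; rewrite -subr_eq0 -(linfB ll); apply/eqP/lz/r0.
  by rewrite -gE linearB /= limg_lfunVK ?gE ?subrr // -gE memv_img ?memvf.
have hsum M : h M = \sum_i \sum_j h (delta_mx i j) * M i j.
  rewrite {1}(matrix_sum_delta M) (linf_sum lh); apply: eq_bigr => i _.
  by rewrite (linf_sum lh); apply: eq_bigr => j _; rewrite (linfZ lh) mulrC.
have dE M i j : ((delta_mx 0 i : 'rV[F]_(dim (adj L))) *m M *m (delta_mx j 0 : 'cV[F]_(dim (adj L)))) 0 0 = M i j.
  by rewrite -(rowE i M) -(colE j (row i M)) !mxE.
pose e i j w := (wact rho w (delta_mx 0 i) *m (delta_mx j 0 : 'cV[F]_(dim (adj L)))) 0 0.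
have eC i j : coefS (e i j).
  by exists (dim (adj L)), rho, (delta_mx 0 i), (delta_mx j 0).
pose d0 w := \sum_i \sum_j h (delta_mx i j) * e i j w.
have d0C : coefS d0.
  have := coefS_sum (index_enum ('I_(dim (adj L)) * 'I_(dim (adj L)))%type) (fun ij => h (delta_mx ij.1 ij.2)) (fun ij => eC ij.1 ij.2).
  by apply: coefS_ext => w; rewrite /d0 pair_bigA.
(* The empty word acts as the identity matrix, so [d0] takes the value [h 1%:M] there, which has to
   be subtracted. *)
exists (fun w => (- h 1%:M) * (w == [::])%:R + d0 w); split.
- exact: coefS_lin coefS_one d0C.
- rewrite mulr1 (hsum 1%:M) addrC; apply/eqP; rewrite subr_eq0; apply/eqP.
  by apply: eq_bigr => i _; apply: eq_bigr => j _; rewrite -dE mulmx1.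
- move=> x; rewrite mulr0 add0r -hE hsum.
  by apply: eq_bigr => i _; apply: eq_bigr => j _; rewrite -(dE (rho x)).
Qed.

(** * Leading terms with respect to word length *)

Section Leading.
Variables (n : nat) (X : 'I_n -> L) (l : 'I_n -> L -> F^o).
Hypotheses (Xdec : forall x, exists2 z, in_centre z & x = z + \sum_i l i x *: X i).

Lemma wfun_multi (V : lmodType F) (c : seq L -> V) k : wfun c ->
  (forall w : seq 'I_n, size w = k -> c (map X w) = 0) -> forall w, size w = k -> c w = 0.
Proof.
move=> wc cX; suff H (w : seq L) : forall u : seq 'I_n, (size u + size w)%N = k -> c (map X u ++ w) = 0.
  by move=> w sw; apply: (H w [::]).
elim: w => [|x w IH] u sz; first by rewrite cats0 cX // -sz addn0.
have [z hz ->] := Xdec x; have lc := wf_lin wc (map X u) w.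
rewrite (linfD lc) (wf_centre wc) // add0r (linf_sum lc) big1 // => i _.
rewrite (linfZ lc) -cat_rcons -map_rcons IH ?scaler0 //.
by rewrite size_rcons addSnnS.
Qed.

(** Swapping neighbours costs a commutator, which makes the word shorter. *)
Lemma wfun_sym (V : lmodType F) (c : seq L -> V) k : wfun c ->
  (forall w, (size w < k)%N -> c w = 0) ->
  forall w w' : seq 'I_n, size w = k -> perm_eq w w' -> c (map X w) = c (map X w').
Proof.
move=> wc low; apply: (swap_perm (g := fun w => c (map X w))) => u x y v sz.
rewrite !map_cat /=; apply/eqP; rewrite -subr_eq0 (wf_comm wc) low //.
by move: sz; rewrite !size_cat /= !size_map; lia.
Qed.

(** By symmetry p equal letters are gathered and replaced by the single letter [pm x], which makes
    the word shorter. *)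
Lemma wfun_repeat (V : lmodType F) (c : seq L -> V) k w i : wfun c ->
  (forall w, (size w < k)%N -> c w = 0) -> size w = k -> (p <= count_mem i w)%N ->
  c (map X w) = 0.
Proof.
move=> wc low sw pw; have p1 := prime_gt1 (pcharf_prime pF).
pose w' := nseq (count_mem i w - p) i ++ filter (predC (pred1 i)) w.
have pe : perm_eq w (nseq p i ++ w').
  have e : filter (pred1 i) w = nseq (count_mem i w) i.
    by have /all_pred1P -> := filter_all (pred1 i) w; rewrite size_filter.
  by rewrite catA -nseqD subnKC // perm_sym -e perm_filterC.
rewrite (wfun_sym wc low sw pe) map_cat map_nseq (wf_pow wc [::]) low //.
have := perm_size pe; rewrite sw size_cat size_nseq /= size_map; lia.
Qed.

Lemma size_counts (w : seq 'I_n) : size w = (\sum_(i < n) count_mem i w)%N.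
Proof.
elim: w => [|j w IH] /=; first by rewrite big1.
rewrite big_split /= -IH (bigD1 j) //= eqxx big1 ?addn0 // => i.
by rewrite eq_sym => /negPf ->.
Qed.

(** Pigeonhole: among more than n (p - 1) basis letters one occurs at least p times. It replaces the
    finite monomial basis of a restricted enveloping algebra. *)
Lemma wfun_vanish (V : lmodType F) (c : seq L -> V) k : wfun c -> (n * p.-1 < k)%N ->
  (forall w, (size w < k)%N -> c w = 0) -> forall w, c w = 0.
Proof.
move=> wc big low; have p0 := prime_gt0 (pcharf_prime pF).
suff H m : forall w, (size w < k + m)%N -> c w = 0.
  by move=> w; apply: (H (size w).+1); rewrite addnS ltnS leq_addl.
elim: m => [|m IH] w; first by rewrite addn0; apply: low.
rewrite addnS ltnS leq_eqVlt => /orP[/eqP sw|]; last exact: IH.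
apply: (wfun_multi wc) sw => w' sw'.
have [i pi] : exists i, (p <= count_mem i w')%N.
  apply: NNPP => no; suff : (size w' <= n * p.-1)%N by rewrite sw'; move: big; lia.
  rewrite size_counts -[X in (_ <= X * _)%N](card_ord n) -sum_nat_const; apply: leq_sum => i _.
  rewrite -ltnS prednK // ltnNge; apply/negP => h; apply: no; by exists i.
exact: (wfun_repeat wc IH sw' pi).
Qed.

Variable eps : 'I_n -> seq L -> F.
Hypotheses (epsC : forall i, coefS (eps i)) (eps0 : forall i, eps i [::] = 0)
  (epsX : forall i j, eps i [:: X j] = (i == j)%:R).

(* Subtracting from c a combination of monomials in the eps i cancels its leading
   term. *)
Lemma wfun_step N (c : seq L -> 'rV[F]_N) k : wfun c -> (forall w, (size w < k)%N -> c w = 0) ->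
  exists2 d, coefP d & forall w, (size w <= k)%N -> c w = d w.
Proof.
move=> wc low.
have zC : coefP (fun=> 0 : 'rV[F]_N).
  have [m [r [y [b [nr bE]]]]] := coefS0; exists m, r, y, 0; split=> // w.
  by rewrite mulmx0.
suff [d [dC dlow dE]] : exists d, [/\ coefP d, forall w, (size w < k)%N -> d w = 0 &
    forall t : k.-tuple 'I_n, t \in enum {: k.-tuple 'I_n} -> c (map X t) = d (map X t)].
  exists d => // w; rewrite leq_eqVlt => /orP[/eqP sw|lt]; last by rewrite low ?dlow.
  have wcd := wfun_lin (-1) (coefP_wfun dC) wc.
  apply/esym/eqP; rewrite -subr_eq0 -oppr_eq0 opprB addrC -scaleN1r; apply/eqP.
  apply: (wfun_multi wcd) sw => w' sw'.
  have sz : size w' == k by apply/eqP.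
  by rewrite -[w']/(val (Tuple sz)) dE ?mem_enum // scaleN1r addNr.
(* Tuples are treated one at a time; [d] already agrees with [c] on [ts]. *)
elim: (enum _) => [|t ts [d [dC dlow dE]]]; first by exists (fun=> 0).
have wcd := wfun_lin (-1) (coefP_wfun dC) wc.
have lowcd w : (size w < k)%N -> -1 *: d w + c w = 0.
  by move=> lt; rewrite dlow // low // scaler0 addr0.
case: (eqVneq (-1 *: d (map X t) + c (map X t)) 0) => [z|nz].
  exists d; split=> // t'; rewrite inE => /orP[/eqP ->|]; last exact: dE.
  by move/eqP: z; rewrite scaleN1r addrC subr_eq0 => /eqP.
pose a := [ffun i => count_mem i (val t)].
have ap i : (a i < p)%N.
  rewrite ffunE ltnNge; apply: contra nz => h; apply/eqP.
  exact: (wfun_repeat wcd lowcd (size_tuple t) h).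
have [|P [PC Plow PE]] := @coefS_monomial n X eps epsC eps0 epsX k a.
  by rewrite -[RHS](size_tuple t) size_counts; apply: eq_bigr => i _; rewrite ffunE.
have nzN : (nder a t)%:R != 0 :> F.
  by apply: (nder_neq0 pF) ap => i; rewrite ffunE.
pose v := (nder a t)%:R^-1 *: (-1 *: d (map X t) + c (map X t)).
exists (fun w => 1 *: (P w *: v) + d w); split.
- exact: coefP_lin (coefP_scale v PC) dC.
- by move=> w lt; rewrite Plow // scale0r scaler0 add0r dlow.
move=> t'; rewrite scale1r PE ?size_tuple // inE.
case: (eqVneq t' t) => [-> _|nt /= t'ts].
  by rewrite scalerA mulfV // scale1r scaleN1r addrAC addNr add0r.
(* The correction at [t] affects an earlier tuple only if that tuple is a permutation of [t]; by
   symmetry the difference at [t] would then already have been zero. *)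
rewrite dE //; case: (eqVneq (nder a t') 0%N) => [->|/nder_count cnt].
  by rewrite scale0r add0r.
case/eqP: nz; rewrite (wfun_sym wcd lowcd (w' := t') (size_tuple t)).
  by rewrite dE // scaleN1r addNr.
by apply/allP => i _ /=; rewrite cnt ffunE.
Qed.

End Leading.

(** Corrections by [wfun_step] are made length by length, up to dim (L / Z(L)) times p - 1; after
    that [wfun_vanish] leaves nothing to correct. *)
Lemma wfun_coefP N (c : seq L -> 'rV[F]_N) : wfun c -> coefP c.
Proof.
move=> wc.
have [Z ZP] : exists Z : {vspace L}, forall z, z \in Z <-> in_centre z.
  apply: vspace_of_subsp; split=> [x|a x y hx hy z]; first exact: br0l.
  by rewrite lie_brDl hx hy scaler0 addr0.
have [Q [pi [si [lpi lsi piK kpi]]]] := quot_space Z.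
pose e (i : 'I_(dim Q)) : Q := r2v (delta_mx 0 i).
pose X i := si (e i).
pose l i x : F^o := crd i (pi x).
have le i j : l i (X j) = (i == j)%:R.
  by rewrite /l piK /crd r2vK mxE eqxx.
have ll i : lin (l i) by move=> a x y; rewrite /l lpi crdD crdZ.
have lz i z : in_centre z -> l i z = 0.
  by move=> /ZP/kpi h; rewrite /l h crd0.
have Xdec x : exists2 z, in_centre z & x = z + \sum_i l i x *: X i.
  exists (x - \sum_i l i x *: X i); last by rewrite subrK.
  apply/ZP/kpi; rewrite (linfB lpi); apply/eqP; rewrite subr_eq0; apply/eqP/crdP => j.
  rewrite -[LHS]/(l j x) -[RHS]/(l j _) (linf_sum (ll j)) (bigD1 j) //= big1.
    by rewrite (linfZ (ll j)) le eqxx /GRing.scale /= mulr1 addr0.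
  by move=> i ij; rewrite (linfZ (ll j)) le eq_sym (negPf ij) scaler0.
have [eps epsP] := choice_fun (fun i => coefS_linear (ll i) (lz i)).
have epsC i : coefS (eps i) by case: (epsP i).
have eps0 i : eps i [::] = 0 by case: (epsP i).
have epsX i j : eps i [:: X j] = (i == j)%:R by case: (epsP i) => _ _ ->.
have step := wfun_step Xdec epsC eps0 epsX.
have H k : exists2 d, coefP d & forall w, (size w < k)%N -> c w = d w.
  elim: k => [|k [d dC dE]].
    have [n [r [y [b [nr bE]]]]] := coefS0.
    exists (fun=> 0) => //; exists n, r, y, 0; split=> // w; by rewrite mulmx0.
  have wcd := wfun_lin (-1) (coefP_wfun dC) wc.
  have [|d' dC' dE'] := step N _ k wcd.
    by move=> w lt; rewrite dE // scaleN1r addNr.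
  exists (fun w => 1 *: d w + d' w); first exact: coefP_lin.
  by move=> w lt; rewrite -dE' // scaleN1r scale1r addrA subrr add0r.
have [d dC dE] := H (dim Q * p.-1).+1.
have wcd := wfun_lin (-1) (coefP_wfun dC) wc.
have cd w : c w = d w.
  apply/eqP; rewrite -subr_eq0 addrC -scaleN1r; apply/eqP.
  apply: (wfun_vanish Xdec wcd (ltnSn _)) => v lt.
  by rewrite dE // scaleN1r addNr.
by have [n [r [y [b [nr bE]]]]] := dC; exists n, r, y, b; split=> // w; rewrite cd.
Qed.

(** * Good submodules where p-th powers agree with the p-map *)

Section Restricted.
Variables (N : nat) (rho : L -> 'M[F]_N) (H : lie_rep rho).
Implicit Types P : 'rV[F]_N -> Prop.

(** The orbit map of [u] is a matrix coefficient: w.u = (w.y) m with [y] in a good module, and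
    goodness is transferred along [m]. *)
Lemma restricted_gsub P u : @stable F L (rmod H) P ->
  (forall x v, P v -> v *m rho x ^+ p = v *m rho (pm x)) ->
  (forall z v, P v -> in_centre z -> v *m rho z = 0) -> P u ->
  exists P1 : 'rV[F]_N -> Prop, [/\ @stable F L (rmod H) P1, P1 u &
    @gsub F Fo S (res hf (rmod H)) P1].
Proof.
move=> sP pP zP Pu.
have := wfun_coefP (wact_wfun 1%:M H sP.2 pP zP Pu).
move=> [n [r [y [m [[[Hr gr] _ _] cE]]]]].
have {}cE w : wact rho w u = wact r w y *m m by rewrite -cE mulmx1.
(* The matrix [m] alone is not equivariant. [R] selects the pairs on which it is; the [Y] that occur
   form a submodule of the good module, which [m] maps onto the required one. *)
pose R Y t := forall w, wact rho w t = wact r w Y *m m.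
have R0 : R 0 0 by move=> w; rewrite !(linf0 (wact_lin _ _)) mul0mx.
have Rl a Y Y' t t' : R Y t -> R Y' t' -> R (a *: Y + Y') (a *: t + t').
  by move=> h h' w; rewrite !wact_lin h h' mulmxDl scalemxAl.
have Rx x Y t : R Y t -> R (Y *m r x) (t *m rho x).
  move=> h w; have := h (w ++ [:: x]).
  by rewrite !wact_cat.
have Rm Y t : R Y t -> t = Y *m m by move=> h; apply: (h [::]).
exists (fun t => exists Y, R Y t); split.
- split; first split; first by exists 0.
    by move=> a t t' [Y h] [Y' h']; exists (a *: Y + Y'); apply: Rl.
  by move=> x t [Y h]; exists (Y *m r x); apply: Rx.
- by exists y.
- have [|M [i [[li ei] ii iP]]] := @submodule_ex F S (res hf (rmod Hr)) (fun Y => exists t, R Y t).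
    split; first split; first by exists 0.
      by move=> a Y Y' [t h] [t' h']; exists (a *: t + t'); apply: Rl.
    by move=> x Y [t h]; exists (t *m rho (f x)); apply: Rx.
  exists M, (fun v => (i v : 'rV[F]_n) *m m); split.
  + exact: (good_inj sF (conj li ei) ii gr).
  + split=> [a u' v|x v]; first by rewrite li mulmxDl scalemxAl.
    have [t h] : exists t, R (i v) t by apply/iP; exists v.
    by rewrite ei /= -(Rm _ _ h) -(Rm _ _ (Rx (f x) _ _ h)).
  + move=> t; split=> [[Y h]|[v <-]].
      have [v vE] : exists v, i v = Y by apply/iP; exists t.
      by exists v; rewrite vE -(Rm _ _ h).
    have [t' h] : exists t, R (i v) t by apply/iP; exists v.
    by exists (i v); rewrite -(Rm _ _ h).
Qed.

Hypothesis zL : forall z : L, in_centre z -> pm z = 0.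

(** Inside [P] a minimal nonzero stable subspace is taken. A central z acts on it with p-th power
    rho(z^[p]) = 0, so the kernel of rho(z) is a nonzero submodule, hence everything. *)
Lemma restricted_gsub_ex P : @stable F L (rmod H) P ->
  (forall x v, P v -> v *m rho x ^+ p = v *m rho (pm x)) -> (exists2 v, P v & v != 0) ->
  exists P1 : 'rV[F]_N -> Prop, [/\ @stable F L (rmod H) P1, exists2 v, P1 v & v != 0 &
    @gsub F Fo S (res hf (rmod H)) P1].
Proof.
move=> sP pP [v0 Pv0 nv0].
have [|U [sU UP [u uU nu]] min] := @ex_min_measure {vspace 'rV[F]_N} (fun U =>
    [/\ @stable F L (rmod H) (fun v => v \in U), forall v, v \in U -> P v &
        exists2 v, v \in U & v != 0]) (fun U => \dim U).
  have [U UP] := vspace_of_subsp sP.1; exists U; split.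
  - by split=> [|x v /UP h]; [exact: subsp_vspace | apply/UP/sP.2].
  - by move=> v /UP.
  - by exists v0 => //; apply/UP.
have zU z v : v \in U -> in_centre z -> v *m rho z = 0.
  move=> vU hz.
  have r0 : rho 0 = 0.
    by have := H.1 (-1) 0 0; rewrite scaler0 addr0 scaleN1r addNr.
  have cz x : rho z *m rho x = rho x *m rho z.
    apply/eqP; by rewrite eq_sym -subr_eq0 -H.2 hz r0.
  have [U1 U1P] : exists U1 : {vspace 'rV[F]_N}, forall v, v \in U1 <-> v \in U /\ v *m rho z = 0.
    apply: vspace_of_subsp; split; first by rewrite mem0v mul0mx.
    move=> a x y [xU xz] [yU yz]; split; first by rewrite memvD // memvZ.
    by rewrite mulmxDl -scalemxAl xz yz scaler0 addr0.
  have sub x : x \in U1 -> x \in U by move=> /U1P[].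
  suff /(subv_dim_eq sub)/(_ _ vU)/U1P[] : (\dim U <= \dim U1)%N by [].
  apply: min; split.
  - split; first exact: subsp_vspace.
    move=> x w /U1P[wU wz]; apply/U1P; split; first exact: sU.2.
    by rewrite /= -mulmxA -cz mulmxA wz mul0mx.
  - by move=> w /sub /UP.
  - have ex : exists k, u *m rho z ^+ k == 0.
      by exists p; rewrite pP ?zL ?r0 ?mulmx0 //; apply: UP.
    case: (ex_minnP ex) => -[|k] /eqP hk mink.
      by case/eqP: nu; rewrite -hk expr0 mulmx1.
    exists (u *m rho z ^+ k); last by apply/negP => /mink; rewrite ltnn.
    apply/U1P; split; last by rewrite -mulmxA -mxexpSr.
    elim: (k) => [|j IH]; first by rewrite expr0 mulmx1.
    by rewrite mxexpSr mulmxA; apply: sU.2.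
have [|P1 [sP1 P1u gP1]] := @restricted_gsub (fun v => v \in U) u sU _ zU uU.
  by move=> x v /UP; apply: pP.
by exists P1; split=> //; exists u.
Qed.

End Restricted.

End Words.

(** * Composition series and common eigenvectors *)

Section Series.
Variables (K : fieldType) (n : nat) (I : Type) (P : I -> Prop) (r : I -> 'M[K]_n).
Implicit Types A B U : 'M[K]_n.

Local Notation stab := (mx_stable P r).

Lemma irr_factor_eq A B B' : (B :=: B')%MS -> irr_factor P r A B -> irr_factor P r A B'.
Proof.
move=> e [lt irr]; split=> [|W sW AW WB]; first by rewrite /ltmx -!e.
by rewrite -!e; apply: irr; rewrite ?e.
Qed.

Definition mx_chain A B (k : nat) (c : nat -> 'M[K]_n) :=
  [/\ c 0%N = A, (c k :=: B)%MS &
   forall i, (i < k)%N -> stab (c i) /\ stab (c i.+1) /\ irr_factor P r (c i) (c i.+1)].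

Lemma mx_chain_ex A B : stab A -> stab B -> (A <= B)%MS -> exists k c, mx_chain A B k c.
Proof.
have [m] := ubnP (\rank B - \rank A); elim: m A => // m IH A ltm sA sB AB.
case: (boolP (B <= A)%MS) => BA.
  by exists 0%N, (fun=> A); split=> //; apply/eqmxP/andP.
have [|A' [sA' ltA' A'B] min] := @ex_min_measure _
  (fun A' => [/\ stab A', (A < A')%MS & (A' <= B)%MS]) (fun A' => \rank A').
  by exists B; split=> //; rewrite /ltmx AB.
have [|k [c [c0 ck ci]]] := IH A' _ sA' sB A'B.
  by have := rank_ltmx ltA'; have := mxrankS A'B; move: ltm; lia.
exists k.+1, (fun i => if i is i'.+1 then c i' else A); split=> // -[_|i] //=; last exact: ci.
have sc0 : stab (c 0%N) by rewrite c0.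
rewrite c0 in sc0 *; split=> //; split=> //; split=> // W sW AW WA'.
case: (boolP (W <= A)%MS) => WA; [left|right]; first by apply/andP.
have /min le : [/\ stab W, (A < W)%MS & (W <= B)%MS].
  by split=> //; [rewrite /ltmx AW | apply: submx_trans A'B].
by apply/andP; split; rewrite // -(geq_leqif (mxrank_leqif_sup WA')).
Qed.

Lemma comp_series_through U : stab U -> ~~ (1%:M <= U)%MS ->
  exists k c j, [/\ comp_series P r k c, (j < k)%N & (c j :=: U)%MS].
Proof.
move=> sU nU.
have s0 : stab 0 by move=> i _; rewrite mul0mx.
have s1 : stab 1%:M by move=> i _; rewrite submx1.
have [k1 [c1 [c10 c1k c1i]]] := mx_chain_ex s0 sU (sub0mx _ _).
have [k2 [c2 [c20 c2k c2i]]] := mx_chain_ex sU s1 (submx1 _).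
have k2p : (0 < k2)%N.
  by case: k2 c2k {c2i} => // e; move: nU; rewrite -c20 e submx_refl.
pose c i := if (i < k1)%N then c1 i else c2 (i - k1)%N.
exists (k1 + k2)%N, c, k1; split; first split.
- rewrite /c; case: ltnP => [_|]; first by rewrite c10; apply/andP.
  rewrite leqn0 => /eqP k0; move: c1k; rewrite k0 c10 subn0 c20 => h.
  by apply/eqmxP; apply: eqmx_sym.
- split; first by rewrite /c ltnNge leq_addr /= addKn; apply/eqmxP.
  move=> i lti; rewrite /c; case: (ltngtP i.+1 k1) => [lt|gt|e].
  + by apply: c1i; apply: ltnW.
  + by rewrite subSn //; apply: c2i; move: lti gt; lia.
  + rewrite -e subnn c20; have [] := c1i i; first by rewrite -e.
    rewrite e => h1 [h2 h3]; split=> //; split=> //; exact: irr_factor_eq c1k h3.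
- by rewrite -[X in (X < _)%N]addn0 ltn_add2l.
- by rewrite /c ltnn subnn c20.
Qed.

End Series.

Lemma mx_of_subsp (F : fieldType) n (P : 'rV[F]_n -> Prop) : subsp P ->
  exists A : 'M[F]_n, forall u, (u <= A)%MS <-> P u.
Proof.
move=> sP; have [||A AP max] := @ex_max_measure _
  (fun A : 'M[F]_n => forall u : 'rV_n, (u <= A)%MS -> P u) (fun A => \rank A) n.
- by exists 0 => u; rewrite submx0 => /eqP ->; case: sP.
- by move=> A _; apply: rank_leq_row.
exists A => u; split=> [|Pu]; first exact: AP.
have /max : forall w : 'rV_n, (w <= A + u)%MS -> P w.
  move=> w /sub_addsmxP[[D1 D2] -> /=]; apply: subspD => //.
    by apply: AP; apply: submxMl.
  by rewrite [D2]mx11_scalar mul_scalar_mx; apply: subspZ.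
rewrite (geq_leqif (mxrank_leqif_sup (addsmxSl A u))); apply: submx_trans.
exact: addsmxSr.
Qed.

(* The matrix e of least rank among those acting as the identity on the section
   isolates the common generalized null space. *)
Lemma common_null_col (K : fieldType) n (I : Type) (G : I -> 'M[K]_n) (A B : 'M[K]_n) :
  (forall x y, G x *m G y = G y *m G x) -> (A < B)%MS -> (forall x, (B *m G x <= A)%MS) ->
  exists2 y : 'cV[K]_n, y != 0 & forall x, G x *m y = 0.
Proof.
case: n G A B => [|n] G A B comm /andP[AB nBA] BG.
  by case/negP: nBA; rewrite (flatmx0 B) sub0mx.
have AG x : (A *m G x <= A)%MS by apply: submx_trans (BG x); apply: submxMr.
pose E (e : 'M[K]_n.+1) := (forall x, e *m G x = G x *m e) /\ (B *m (e - 1%:M) <= A)%MS.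
have E1 : E 1%:M by split=> [x|]; rewrite ?subrr ?mulmx0 ?sub0mx // mulmx1 mul1mx.
have [e [ec eB] min] := ex_min_measure (fun e : 'M[K]_n.+1 => \rank e) (ex_intro E _ E1).
have ne : e != 0.
  apply: contra nBA => /eqP e0; move: eB; rewrite e0 sub0r mulmxN mulmx1.
  by rewrite (eqmx_opp B).
have nil x : exists k, G x ^+ k *m e = 0.
  set g := G x.
  have cp0 : char_poly g != 0 by apply: monic_neq0; apply: char_poly_monic.
  have [m [q [nq0 qE]]] := multiplicity_XsubC (char_poly g) 0.
  rewrite cp0 /= in nq0.
  (* [q1] has value 1 at 0. As g is zero on B / A, q1(g) is the identity there, while q1(g) g^m = 0
     by Cayley-Hamilton; since [e] has least rank, its row space is that of q1(g) e, so g^m kills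
     [e]. *)
  pose q1 := (q.[0])^-1 *: q.
  have q0 : q.[0] != 0 by [].
  have [h hE] : exists h, q1 - 1 = h * 'X.
    have /factor_theorem[h hE] : root (q1 - 1) 0.
      by rewrite rootE !hornerE mulVf // subrr.
    by exists h; rewrite hE subr0.
  pose e1 := horner_mx g q1; pose H := horner_mx g h.
  have hX (s : {poly K}) : horner_mx g (s * 'X) = horner_mx g s *m g.
    by rewrite rmorphM /= horner_mx_X.
  have e1E : e1 - 1%:M = g *m H.
    rewrite -[1%:M]/(1 : 'M_n.+1) -(rmorph1 (horner_mx g)) -rmorphB hE mulrC.
    by rewrite rmorphM /= horner_mx_X.
  have hcomm y (s : {poly K}) : horner_mx g s *m G y = G y *m horner_mx g s.
    elim/poly_ind: s => [|s c IH]; first by rewrite rmorph0 mul0mx mulmx0.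
    rewrite rmorphD /= hX horner_mx_C mulmxDl mulmxDr scalar_mxC; congr (_ + _).
    by rewrite -mulmxA (comm x y) mulmxA IH mulmxA.
  have AH (s : {poly K}) : (A *m horner_mx g s <= A)%MS.
    elim/poly_ind: s => [|s c IH]; first by rewrite rmorph0 mulmx0 sub0mx.
    rewrite rmorphD /= hX horner_mx_C mulmxDr mul_mx_scalar addmx_sub ?scalemx_sub //.
    by rewrite mulmxA; apply: submx_trans (AG x); apply: submxMr.
  have gm : e1 *m g ^+ m = 0.
    rewrite -[_ *m _]/(e1 * g ^+ m) -{1}(horner_mx_X g) -rmorphXn -rmorphM /q1 -scalerAl.
    by rewrite subr0 in qE; rewrite -qE -mul_polyC rmorphM /= Cayley_Hamilton mulr0.
  have Ee1 : E (e1 *m e).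
    split=> [y|]; first by rewrite -mulmxA ec !mulmxA hcomm.
    have -> : e1 *m e - 1%:M = (e1 - 1%:M) *m e + (e - 1%:M).
      by rewrite mulmxBl mul1mx addrA subrK.
    rewrite mulmxDr addmx_sub // e1E !mulmxA.
    have Ae : (A *m e <= A)%MS.
      rewrite -[e](subrK 1%:M) mulmxDr mulmx1 addmx_sub //.
      by apply: submx_trans eB; apply: submxMr.
    apply: submx_trans Ae; apply: submxMr; apply: submx_trans (AH h); apply: submxMr.
    exact: BG.
  have /submxP[D DE] : (e <= e1 *m e)%MS.
    by rewrite -(geq_leqif (mxrank_leqif_sup (submxMl e1 e))); apply: min.
  exists m; have ecm k : e *m g ^+ k = g ^+ k *m e.
    elim: k => [|k IH]; first by rewrite expr0 mulmx1 mul1mx.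
    by rewrite mxexpSr mulmxA IH -mulmxA ec mulmxA.
  by rewrite -ecm {1}DE -!mulmxA ecm (mulmxA e1) gm mul0mx mulmx0.
(* Of the nonzero matrices with these properties, one of least rank is killed by each [G x]:
   otherwise multiplying by [G x] would keep its row space, contradicting nilpotency. *)
pose E' (e' : 'M[K]_n.+1) := [/\ e' != 0, forall x, e' *m G x = G x *m e' &
  forall x, exists k, G x ^+ k *m e' = 0].
have [e' [ne' ec' nil'] min'] :=
  ex_min_measure (fun e : 'M[K]_n.+1 => \rank e) (ex_intro E' e (And3 ne ec nil)).
have Ge x : G x *m e' = 0.
  apply/eqP/negPn/negP => nz.
  have Eg : E' (G x *m e').
    split=> // y; first by rewrite -mulmxA ec' !mulmxA comm.
    have [k kE] := nil' y; exists k.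
    by rewrite -ec' mulmxA kE mul0mx.
  have /submxP[D DE] : (e' <= G x *m e')%MS.
    by rewrite -(geq_leqif (mxrank_leqif_sup (submxMl (G x) e'))); apply: min'.
  have It k : e' = D ^+ k *m (G x ^+ k *m e').
    elim: k => [|k IH]; first by rewrite !mul1mx.
    have cm : G x ^+ k *m e' = e' *m G x ^+ k.
      elim: (k) => [|i IHi]; first by rewrite expr0 mulmx1 mul1mx.
      by rewrite mxexpS -mulmxA IHi mulmxA -ec' -mulmxA -mxexpS.
    have s : G x ^+ k *m e' = D *m (G x ^+ k.+1 *m e').
      by rewrite {1}cm {1}DE -!mulmxA -cm mxexpS !mulmxA.
    by rewrite {1}IH s mulmxA -mxexpSr.
  by have [k kE] := nil' x; case/eqP: ne'; rewrite (It k) kE mulmx0.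
have [i [j nij]] : exists i j, e' i j != 0.
  apply: NNPP => no; case/eqP: ne'; apply/matrixP => i j; rewrite mxE.
  by apply/eqP/negPn/negP => nz; apply: no; exists i, j.
exists (col j e') => [|x]; last by rewrite colE mulmxA Ge mul0mx.
by apply: contraNneq nij => /matrixP/(_ i 0); rewrite !mxE => ->.
Qed.

Lemma schur_scalar (K : closedFieldType) n (I : Type) (P : I -> Prop) (r : I -> 'M[K]_n)
  (A B D : 'M[K]_n) : mx_stable P r A -> mx_stable P r B -> irr_factor P r A B ->
  (forall i, P i -> D *m r i = r i *m D) -> (A *m D <= A)%MS -> (B *m D <= B)%MS ->
  exists a, forall u : 'rV[K]_n, (u <= B)%MS -> (u *m D - a *: u <= A)%MS.
Proof.
case: n r A B D => [|n] r A B D sA sB [/andP[AB nBA] irr] comm AD BD.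
  by case/negP: nBA; rewrite (flatmx0 B) sub0mx.
have [u0 u0B u0A] : exists2 u : 'rV_n.+1, (u <= B)%MS & ~~ (u <= A)%MS.
  have /row_subPn[i nA] := nBA; by exists (row i B) => //; apply: row_sub.
have stepD (u : 'rV_n.+1) z : (u <= B)%MS -> (u *m (D - z%:M) <= B)%MS.
  move=> uB; rewrite mulmxBr mul_mx_scalar addmx_sub ?eqmx_opp ?scalemx_sub //.
  by apply: submx_trans BD; apply: submxMr.
have [a [u [uB uA ua]]] : exists a (u : 'rV_n.+1),
    [/\ (u <= B)%MS, ~~ (u <= A)%MS & (u *m (D - a%:M) <= A)%MS].
  (* The linear factors are applied in turn to a vector outside [A]; the one that first moves it
     into [A] gives an eigenvector modulo [A]. *)
  have [s sE] := closed_field_poly_normal (char_poly D).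
  have : (u0 *m horner_mx D (\prod_(z <- s) ('X - z%:P)) <= A)%MS.
    have := Cayley_Hamilton D; rewrite sE (monicP (char_poly_monic D)) scale1r => ->.
    by rewrite mulmx0 sub0mx.
  elim: s u0 u0B u0A {sE} => [|z s IH] u0 u0B u0A.
    by rewrite big_nil rmorph1 mulmx1 (negPf u0A).
  rewrite big_cons rmorphM rmorphB /= horner_mx_X horner_mx_C mulmxA => h.
  case: (boolP (u0 *m (D - z%:M) <= A)%MS) => h1; first by exists z, u0.
  exact: IH (stepD _ _ u0B) h1 h.
exists a.
have [W WP] : exists W : 'M[K]_n.+1, forall v : 'rV_n.+1,
    (v <= W)%MS <-> (v <= B)%MS /\ (v *m (D - a%:M) <= A)%MS.
  apply: mx_of_subsp; split; first by rewrite mul0mx !sub0mx.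
  move=> b x y [xB xA] [yB yA]; rewrite mulmxDl -scalemxAl.
  by rewrite !addmx_sub ?scalemx_sub.
have sW : mx_stable P r W.
  move=> i Pi; apply/rV_subP => v /submxP[D' ->]; rewrite mulmxA; apply/WP.
  have /WP[hB hA] : (D' *m W <= W)%MS by apply: submxMl.
  split; first by apply: submx_trans (sB i Pi); apply: submxMr.
  have -> : D' *m W *m r i *m (D - a%:M) = D' *m W *m (D - a%:M) *m r i.
    rewrite -!mulmxA; congr (_ *m (_ *m _)).
    by rewrite mulmxBr mulmxBl -scalar_mxC comm.
  by apply: submx_trans (sA i Pi); apply: submxMr.
have AW : (A <= W)%MS.
  apply/rV_subP => v vA; apply/WP; split; first exact: submx_trans vA AB.
  rewrite mulmxBr mul_mx_scalar addmx_sub ?eqmx_opp ?scalemx_sub //.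
  by apply: submx_trans AD; apply: submxMr.
have WB : (W <= B)%MS by apply/rV_subP => v /WP[].
case: (irr W sW AW WB) => /andP[h1 h2].
  by case/negP: uA; apply: submx_trans h1; apply/WP.
by move=> v vB; have /WP[_] := submx_trans vB h2; rewrite mulmxBr mul_mx_scalar.
Qed.

(** A matrix has the same rank over [F] and [K]. As the family [G] may be infinite, it is replaced
    by one matrix over [F] that [t] still annihilates and whose column space contains that of every
    [G x]. *)
Lemma null_row_descent (F K : fieldType) (j : {rmorphism F -> K}) n (I : Type) (G : I -> 'M[F]_n) :
  (exists2 t : 'rV[K]_n, t != 0 & forall x, t *m map_mx j (G x) = 0) ->
  exists2 u : 'rV[F]_n, u != 0 & forall x, u *m G x = 0.
Proof.
move=> [t nt tG].
(* M has its column space in the sum of the column spaces of the G x *)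
pose E (M : 'M[F]_n) := (forall u : 'rV[F]_n, (forall x, u *m G x = 0) -> u *m M = 0) /\
  t *m map_mx j M = 0.
have [||M [EM tM] max] := @ex_max_measure _ (fun M => E M^T) (fun M => \rank M) n.
- by exists 0; rewrite trmx0; split=> [u _|]; rewrite ?map_mx0 mulmx0.
- by move=> M _; apply: rank_leq_row.
have GM x : ((G x)^T <= M)%MS.
  have /max : E ((G x)^T + M)%MS^T.
    have [D DE] : exists D, ((G x)^T + M)%MS = D *m col_mx (G x)^T M.
      by apply/submxP; rewrite addsmxE.
    split=> [u hu|].
      rewrite DE trmx_mul tr_col_mx trmxK mulmxA mul_mx_row hu EM //.
      by rewrite row_mx0 mul0mx.
    rewrite DE trmx_mul tr_col_mx trmxK map_mxM map_row_mx mulmxA mul_mx_row tG tM.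
    by rewrite row_mx0 mul0mx.
  rewrite (geq_leqif (mxrank_leqif_sup (addsmxSr _ _))); apply: submx_trans.
  exact: addsmxSl.
have nfree : kermx M^T != 0.
  apply: contraNneq nt => /eqP; rewrite -(map_mx_eq0 j) map_kermx kermx_eq0 => fr.
  by rewrite -(mulmx_free_eq0 _ fr) tM.
have /rowV0Pn[i /sub_kermxP iM nzi] := nfree.
exists i => // x; have /submxP[D DE] := GM x.
by rewrite -[G x]trmxK DE trmx_mul mulmxA iM mul0mx.
Qed.

(** * Hypercentral modules *)

Section Central.
Variables (F : fieldType) (Fo : lie_class F).
Hypothesis sF : saturated_formation Fo.
Variables (S : lieAlgebra F).
Hypotheses (FS : Fo S) (nzS : exists s : S, s != 0).
Variables (L : lieAlgebra F) (f : S -> L) (S0 : {vspace L}).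
Hypotheses (hf : lie_hom f) (injf : injective f)
  (imf : forall y, y \in S0 <-> exists x, f x = y).
Variables (n : nat) (rho : L -> 'M[F]_n).
Hypothesis H : lie_rep rho.

Let V := res hf (rmod H).

Let f0 s : f s \in S0. Proof. by apply/imf; exists s. Qed.

(** A composition series through a proper submodule has a central factor just above it. With [X] the
    split extension for that factor, [sd T] is a subdirect product of [X] and [S]. *)
Lemma Fhypercentral_good : Fhypercentral Fo S0 rho -> good Fo V.
Proof.
move=> hyp; apply: good_exhaust_id => // U sU [v0 nv0].
have [Um UmP] := mx_of_subsp sU.1.
have stU : mx_stable (fun x : L => x \in S0) rho Um.
  move=> x /imf[s <-]; apply/rV_subP => u /submxP[D ->]; rewrite mulmxA.
  by apply/UmP; apply: (sU.2 s); apply/UmP; apply: submxMl.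
have nUm : ~~ (1%:M <= Um)%MS.
  by apply/negP => h; apply: nv0; apply/UmP; apply: submx_trans h; apply: submx1.
have [k [c [j [cs jk cj]]]] := comp_series_through stU nUm.
have [_ [_ /(_ j jk)[scj [scj1 [lt _]]]]] := cs.
have [X [A [Q0 [phi [pi [FX [AQ [AQ0 [abA [lphi [phiA [phiS [phi0 [lpi [brpi [piQ [piS [pi0 act]]]]]]]]]]]]]]]]]]
  := hyp k c cs j jk.
have [Q [psi [si [[lpsi epsi] lsi psiK kpsi]]]] := quotient_module sU.
have kc u : psi u = 0 <-> (u <= c j)%MS by rewrite kpsi cj -UmP.
pose P q := exists2 u : V, (u <= c j.+1)%MS & psi u = q.
have sP : stable P.
  split; first split.
  - by exists 0; rewrite ?sub0mx // (linf0 lpsi).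
  - move=> a _ _ [u hu <-] [v hv <-]; exists (a *: u + v); last by rewrite lpsi.
    by rewrite addmx_sub ?scalemx_sub.
  - move=> x _ [u hu <-]; exists (x \> u); last by rewrite epsi.
    by apply: submx_trans (scj1 _ (f0 x)); apply: submxMr.
have [T [i [[li ei] ii iP]]] := submodule_ex sP.
have extau t : exists u : V, (u <= c j.+1)%MS /\ psi u = i t.
  by have /iP[u hu uE] : exists t', i t' = i t; [exists t | exists u].
have [tau tauP] := choice_fun extau.
have tauU t : (tau t <= c j.+1)%MS by case: (tauP t).
have psitau t : psi (tau t) = i t by case: (tauP t).
have phi_eq u v : (u <= c j.+1)%MS -> (v <= c j.+1)%MS -> psi u = psi v -> phi u = phi v.
  move=> hu hv e; apply/eqP; rewrite -subr_eq0 -(linfB (V := 'rV[F]_n) lphi); apply/eqP/phi0.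
    by rewrite addmx_sub ?eqmx_opp.
  by apply/kc; rewrite (linfB lpsi) e subrr.
have gT : good Fo T.
  pose h (e : sd T) : X := phi (tau e.1) + pi (f e.2).
  apply: (@Fo_subdirect _ _ sF (sd T) X S h (fun e => e.2)) => //; last first.
  - move=> [t s]; rewrite /h /= => e s0; rewrite s0 in e *.
    have pi00 : pi (f 0) = 0.
      by have := lpi (-1) _ _ (f0 0) (f0 0); rewrite !scaleN1r !addNr (linf0 hf.1).
    rewrite pi00 addr0 in e; have /(phi0 _ (tauU t))/kc := e.
    by rewrite psitau => it0; have -> : t = 0 by apply: ii; rewrite it0 (linf0 li).
  - exact: sd_snd_surj.
  - move=> x; have : x \in (A + Q0)%VS by rewrite AQ memvf.
    case/memv_addP=> a /phiS[u hu <-] [q /piS[y /imf[s <-] <-] ->].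
    have /iP[t tE] : P (psi u) by exists u.
    exists (t, s); rewrite /h /=; congr (_ + _); apply: phi_eq => //.
    by rewrite psitau.
  - split=> [a [t s] [t' s']|[t s] [t' s']]; rewrite /h /=.
      have -> : phi (tau (a *: t + t')) = phi (a *: tau t + tau t').
        apply: phi_eq => //; first by rewrite addmx_sub ?scalemx_sub.
        by rewrite lpsi !psitau li.
      by rewrite lphi hf.1 lpi //; vring.
    have Atau u : phi (tau u) \in A by apply: phiA.
    have stau x u : (tau u *m rho (f x) <= c j.+1)%MS.
      by apply: submx_trans (scj1 _ (f0 x)); apply: submxMr.
    have -> : phi (tau (s \> t' - s' \> t)) = phi (tau t' *m rho (f s) - tau t *m rho (f s')).
      apply: phi_eq => //; first by rewrite addmx_sub ?eqmx_opp.
      rewrite -[_ *m rho (f s)]/(s \> (tau t' : V)) -[_ *m rho (f s')]/(s' \> (tau t : V)).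
      by rewrite (linfB lpsi) !epsi !psitau (linfB li) !ei.
    rewrite (linfB (V := 'rV[F]_n) lphi) -!act // hf.2 brpi // !(brDl, brDr) (abA (phi _) (phi _)) //.
    by rewrite (brC (phi (tau t)) (pi _)); vring.
have spsi : surj psi by move=> q; exists (si q).
exists Q, psi, P; split=> //.
  have [u hu nu] : exists2 u : V, (u <= c j.+1)%MS & ~~ (u <= c j)%MS.
    case/andP: lt => _ /row_subPn[a na]; exists (row a (c j.+1)) => //; exact: row_sub.
  by exists (psi u); [exists u | apply: contra nu => /eqP/kc].
by exists T, i; split.
Qed.

(** The split extension by S / C_S(T) is [sd T] modulo the ideal of pairs (0, s) with s acting as
    zero on [T]. *)
Lemma good_Fhypercentral : good Fo V -> Fhypercentral Fo S0 rho.
Proof.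
move=> gV k c [_ [_ cs]] j jk; have [scj [scj1 _]] := cs j jk.
have st (U : 'M[F]_n) : mx_stable (fun x : L => x \in S0) rho U -> @stable F S V (fun u => (u <= U)%MS).
  move=> sU; split; first split=> [|a x y hx hy]; rewrite ?sub0mx ?addmx_sub ?scalemx_sub //.
  by move=> s u hu; apply: submx_trans (sU _ (f0 s)); apply: submxMr.
have [Q [psi [si [[lpsi epsi] lsi psiK kpsi]]]] := quotient_module (st _ scj).
have gQ : good Fo Q by apply: (@good_im _ _ sF S V Q psi) gV => // q; exists (si q).
have [T [i [[li ei] ii iP]]] : exists (T : lmodule S) (i : T -> Q), [/\ mod_hom i, injective i &
    forall q, (exists2 u : V, (u <= c j.+1)%MS & psi u = q) <-> exists t, i t = q].
  apply: submodule_ex; have [[s0 sl] sx] := st _ scj1; split; first split.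
  - by exists 0; rewrite ?sub0mx ?(linf0 lpsi).
  - by move=> a _ _ [u hu <-] [v hv <-]; exists (a *: u + v); rewrite ?lpsi //; apply: sl.
  - by move=> x _ [u hu <-]; exists (x \> u); rewrite ?epsi //; apply: sx.
have gT := good_inj sF (conj li ei) ii gQ.
have iI : @idealP F (sd T) (fun e => e.1 = 0 /\ forall t : T, e.2 \> t = 0).
  split; first split.
  - by split=> //= t; rewrite act0l.
  - move=> a x y [x1 x2] [y1 y2]; split=> [|t] /=; first by rewrite x1 y1 scaler0 addr0.
    by rewrite actDl actZl x2 y2 scaler0 addr0.
  - move=> [t s] [t' s'] [/= -> h]; split=> [|u] /=; first by rewrite act0r h subrr.
    by rewrite lm_actbr !h act0r subrr.
have [X [p [[lp ep] sp kp]]] := lie_quotient iI.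
have [ig igE] := lin_hom li; have [fg fgE] := lin_hom hf.1.
(* [Fcentral_factor] asks for maps on all row vectors and on all of [L]. Pseudo-inverses of the
   inclusions provide them; only the values on the factor and on [S0] matter. *)
pose r (q : Q) : T := (ig^-1)%VF q; pose g (y : L) : S := (fg^-1)%VF y.
have rK t : r (i t) = t.
  by rewrite /r -igE lker0_lfunK //; apply/lker0P => x y; rewrite !igE => /ii.
have gK s : g (f s) = s.
  by rewrite /g -fgE lker0_lfunK //; apply/lker0P => x y; rewrite !fgE => /injf.
have lr : lin r by move=> a x y; rewrite /r linearP.
have lg : lin g by move=> a x y; rewrite /g linearP.
pose pT (t : T) : X := p ((t, 0) : sd T); pose pS (s : S) : X := p ((0, s) : sd T).
have lpT : lin pT.
  by move=> a x y; rewrite /pT -lp; congr p; congr (_, _); rewrite /= scaler0 addr0.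
have lpS : lin pS.
  by move=> a x y; rewrite /pS -lp; congr p; congr (_, _); rewrite /= scaler0 addr0.
have [A AP] : exists A : {vspace X}, forall x, x \in A <-> exists t, pT t = x.
  apply: vspace_of_subsp; split; first by exists 0; rewrite (linf0 lpT).
  by move=> a _ _ [t <-] [t' <-]; exists (a *: t + t').
have [B BP] : exists B : {vspace X}, forall x, x \in B <-> exists s, pS s = x.
  apply: vspace_of_subsp; split; first by exists 0; rewrite (linf0 lpS).
  by move=> a _ _ [t <-] [t' <-]; exists (a *: t + t').
have pT0 t : pT t = 0 -> t = 0 by move=> /kp[].
have iu u : (u <= c j.+1)%MS -> i (r (psi u)) = psi u.
  by move=> hu; have [t tE] : exists t, i t = psi u; [apply/iP; exists u | rewrite -tE rK].
exists X, A, B, (fun u => pT (r (psi u))), (fun y => pS (g y)).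
split; first exact: (Fo_im sF (conj lp ep) sp gT).
split.
  apply: vspace_full => x; have [[t s] <-] := sp x.
  have -> : p (t, s) = pT t + pS s.
    rewrite /pT /pS -(linfD lp); congr p; congr (_, _); by rewrite /= ?addr0 ?add0r.
  by apply: memv_add; [apply/AP; exists t | apply/BP; exists s].
split.
  apply/eqP; rewrite -subv0; apply/subvP => x; rewrite memv_cap => /andP[/AP[t <-] /BP[s e]].
  have /kp[/= t0 _] : p ((t, - s) : sd T) = 0.
    have -> : ((t, - s) : sd T) = (t, 0) - (0, s) by congr (_, _); rewrite /= ?subr0 ?sub0r.
    by rewrite (linfB lp) -[p (0, s)]/(pS s) e subrr.
  by rewrite t0 (linf0 lpT) mem0v.
split.
  move=> _ _ /AP[t <-] /AP[t' <-]; rewrite /pT -ep /= /sd_br /= !act0l subrr br0r.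
  exact: (linf0 lp).
split; first by move=> a u v; rewrite lpsi lr lpT.
split; first by move=> u _; apply/AP; exists (r (psi u)).
split.
  move=> _ /AP[t <-]; have /iP[u hu uE] : exists t', i t' = i t by exists t.
  by exists u => //; rewrite uE rK.
split.
  move=> u hu; rewrite -kpsi; split=> [/pT0 e|->]; last by rewrite (linf0 lr) (linf0 lpT).
  by rewrite -iu // e (linf0 li).
split; first by move=> a x y _ _; rewrite lg lpS.
split.
  move=> _ _ /imf[x <-] /imf[y <-]; rewrite -hf.2 !gK /pS -ep /= /sd_br /= !act0r subrr.
  by [].
split; first by move=> x _; apply/BP; exists (g x).
split; first by move=> _ /BP[s <-]; exists (f s); rewrite ?gK.
split.
  move=> _ /imf[s <-]; rewrite gK; split=> [/kp[_ /= h]|[_ h]].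
    split=> // u hu; apply/kpsi.
    by rewrite -[u *m _]/(s \> (u : V)) epsi -iu // -ei h (linf0 li).
  apply/kp; split=> //= t; apply: ii; rewrite ei (linf0 li).
  have /iP[u hu <-] : exists t', i t' = i t by exists t.
  by rewrite -epsi; apply/kpsi/h.
move=> _ u /imf[s <-] hu; rewrite gK /pS /pT -ep /= /sd_br /= act0l subr0 br0r.
rewrite -[u *m _]/(s \> (u : V)) epsi -[in RHS]iu // -ei rK.
by [].
Qed.

End Central.

(** * Character clusters *)

Section Clusters.
Variables (F : fieldType) (Fo : lie_class F).
Hypothesis sF : saturated_formation Fo.
Variables (S : lieAlgebra F).
Hypotheses (FS : Fo S) (nzS : exists s : S, s != 0).
Variables (L : lieAlgebra F) (f : S -> L).
Hypothesis hf : lie_hom f.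
Variables (p : nat) (pm : L -> L).
Hypotheses (pF : p \in [pchar F]) (rL : restricted p pm).
Hypothesis zL : forall z : L, in_centre z -> pm z = 0.
Hypothesis gadj : good Fo (res hf (adj L)).
Variables (K : closedFieldType) (j : {rmorphism F -> K}).

Lemma map_expmx n (A : 'M[F]_n) k : map_mx j (A ^+ k) = map_mx j A ^+ k.
Proof.
elim: k => [|k IH]; first exact: map_mx1.
by rewrite !mxexpS map_mxM IH.
Qed.

Definition pdef n (rho : L -> 'M[F]_n) x := rho x ^+ p - rho (pm x).

Lemma exprN_p n (A : 'M[F]_n) : (- A) ^+ p = - A ^+ p.
Proof.
apply/eqP; rewrite -addr_eq0 addrC -(expr_p_addmx pF) ?subrr ?mulNmx ?mulmxN //.
by rewrite expr0n; case: p (pcharf_prime pF).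
Qed.

Lemma pdef_comm n (rho : L -> 'M[F]_n) x y : lie_rep rho ->
  pdef rho x *m rho y = rho y *m pdef rho x.
Proof.
move=> [lr br]; set A := rho x; set B := rho y.
(* the p-th power of ad A is ad (A ^+ p) *)
pose ad (M : 'M[F]_n) := M *m A - A *m M.
have iterE k : iter k ad (rho y) = rho (iter k (lie_br x) y).
  by elim: k => //= k ->; rewrite br.
have adE : iter p ad B = B *m A ^+ p - A ^+ p *m B.
  (* On matrices, [ad] is the Kronecker sum of - A^T and A, so [tens_exp_p] computes its p-th
     power. *)
  have cE k M : mxvec M *m (tens_mx (- A^T) A) ^+ k = mxvec (iter k ad M).
    elim: k M => [|k IH] M; first by rewrite mulmx1.
    rewrite mxexpS mulmxA mul_tens_mx (_ : _ + _ = ad M) ?IH -?iterSr //.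
    by rewrite /ad linearN /= trmxK mulNmx addrC.
  have := cE p B; rewrite (tens_exp_p pF) mul_tens_mx => /(can_inj mxvecK) <-.
  by rewrite exprN_p linearN /= -trmx_exp trmxK mulNmx addrC.
rewrite iterE -(rL.2.1 x) br -/B in adE.
rewrite /pdef mulmxBl mulmxBr -/A; apply/eqP; rewrite -subr_eq0; apply/eqP.
have -> : A ^+ p *m B - rho (pm x) *m B - (B *m A ^+ p - B *m rho (pm x)) =
  (B *m rho (pm x) - rho (pm x) *m B) - (B *m A ^+ p - A ^+ p *m B) by vring.
by rewrite adE subrr.
Qed.

Lemma pdef_commutes n (rho : L -> 'M[F]_n) x y : lie_rep rho ->
  pdef rho x *m pdef rho y = pdef rho y *m pdef rho x.
Proof.
move=> H; have pk k : pdef rho x *m rho y ^+ k = rho y ^+ k *m pdef rho x.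
  elim: k => [|k IH]; first by rewrite mulmx1 mul1mx.
  by rewrite mxexpSr mulmxA IH -mulmxA pdef_comm // mulmxA.
by rewrite [pdef rho y]/pdef [LHS]mulmxBr [RHS]mulmxBl pk pdef_comm.
Qed.

Definition has_good_sub n (rho : L -> 'M[F]_n) (H : lie_rep rho) :=
  exists P : 'rV[F]_n -> Prop, [/\ @stable F L (rmod H) P, exists2 v, P v & v != 0 &
    @gsub F Fo S (res hf (rmod H)) P].

(* psi stands for the p-th power of a character. *)
Definition realizable (psi : L -> K) := forall n (rho : L -> 'M[F]_n) (H : lie_rep rho),
  (exists2 t : 'rV[K]_n, t != 0 & forall x, t *m map_mx j (pdef rho x) = psi x *: t) ->
  has_good_sub H.

(** For weight 0 the eigenvector can be taken over [F]. The common null space of the [pdef rho x] is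
    [L]-stable because they commute with the representation. *)
Lemma realizable0 psi : (forall x, psi x = 0) -> realizable psi.
Proof.
move=> psi0 n rho H [t nt tE].
have [|u nu uE] := @null_row_descent F K j n L (pdef rho).
  by exists t => // x; rewrite tE psi0 scale0r.
pose P (v : 'rV[F]_n) := forall x, v *m pdef rho x = 0.
apply: (@restricted_gsub_ex F Fo sF S FS nzS L f hf p pm pF rL gadj n rho H zL P); last by exists u.
- split; first split=> [x|a v w hv hw x]; first by rewrite mul0mx.
    by rewrite mulmxDl -scalemxAl hv hw scaler0 addr0.
  by move=> x v hv y; rewrite /= -mulmxA -pdef_comm // mulmxA hv mul0mx.
- move=> x v hv; apply/eqP; rewrite -subr_eq0 -mulmxBr; apply/eqP; exact: hv.
Qed.

Variables (nV : nat) (rhoV : L -> 'M[F]_nV) (HV : lie_rep rhoV).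
Hypothesis gV : good Fo (res hf (rmod HV)).

Lemma map_tens_mx m n (A : 'M[F]_m) (B : 'M[F]_n) :
  map_mx j (tens_mx A B) = tens_mx (map_mx j A) (map_mx j B).
Proof.
rewrite map_mxD; congr (_ + _).
  by apply: map_lin_mx => M; rewrite /= map_mxM map_trmx.
by apply: map_lin_mx => M; rewrite /= map_mxM.
Qed.

(* A vector of weight psi + chi^p in T gives one of weight psi in Hom(V, T); a
   good submodule of Hom(V, T) evaluates to one of T. *)
Lemma realizable_add psi (chi : L -> K) : realizable psi ->
  (exists2 y : 'cV[K]_nV, y != 0 & forall x, map_mx j (pdef rhoV x) *m y = chi x ^+ p *: y) ->
  realizable (fun x => psi x + chi x ^+ p).
Proof.
move=> rpsi [y ny yE] n rho H [t nt tE].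
have HD : lie_rep (fun x => - (rhoV x)^T).
  split=> [a x x'|x x']; first by rewrite HV.1 linearP /= opprD scalerN.
  rewrite HV.2 linearB /= !trmx_mul !mulmxN !mulNmx !opprK opprB; vring.
have HT := tens_rep HD H.
have pE x : pdef (fun x => tens_mx (- (rhoV x)^T) (rho x)) x
    = tens_mx (- (pdef rhoV x)^T) (pdef rho x).
  rewrite /pdef (tens_exp_p pF) exprN_p -trmx_exp; apply: mxvec_eq => M.
  rewrite mulmxBr !mul_tens_mx -linearB; congr mxvec.
  by rewrite !(linearB, linearN) /= !trmxK !(mulmxBl, mulmxBr, mulNmx); vring.
have [|P [[sP aP] [M0 PM0 nM0] [M1 [h [g1 [lh eh] hP]]]]] := rpsi _ _ HT.
  (* The column [y] has weight - chi^p in the dual of V, which cancels the extra summand in the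
     weight of [t]. *)
  exists (mxvec (y *m t)).
    rewrite -(inj_eq (can_inj vec_mxK)) mxvecK linear0.
    have [i0 ni] : exists i, y i 0 != 0.
      apply: NNPP => no; case/eqP: ny; apply/colP => i; rewrite mxE.
      by apply/eqP/negPn/negP => nz; apply: no; exists i.
    have [j0 nj] : exists i, t 0 i != 0.
      apply: NNPP => no; case/eqP: nt; apply/rowP => i; rewrite mxE.
      by apply/eqP/negPn/negP => nz; apply: no; exists i.
    apply: contraNneq (mulf_neq0 ni nj) => /matrixP/(_ i0 j0).
    by rewrite !mxE big_ord1 => ->.
  move=> x; rewrite pE map_tens_mx mul_tens_mx -linearZ; congr mxvec.
  rewrite map_trmx linearN /= trmxK map_mxN mulNmx mulmxA yE -mulmxA tE.
  by rewrite -scalemxAl -scalemxAr scalerDl addrC addrK.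
pose b (m : M1) (v : res hf (rmod HV)) : res hf (rmod H) :=
  (v : 'rV[F]_nV) *m vec_mx (h m : 'rV[F]_(nV * n)).
have bl v : lin (fun m => b m v).
  by move=> a m m'; rewrite /b lh linearP mulmxDr -scalemxAr.
have br m : lin (b m).
  by move=> a v v'; rewrite /b mulmxDl -scalemxAl.
have tensE x (w : 'rV[F]_(nV * n)) (v : 'rV[F]_nV) :
    v *m vec_mx (w *m tens_mx (- (rhoV x)^T) (rho x)) + v *m rhoV x *m vec_mx w
    = v *m vec_mx w *m rho x.
  rewrite -{1}[w]vec_mxK mul_tens_mx mxvecK linearN /= trmxK mulNmx mulmxDr mulmxN !mulmxA.
  by rewrite addrAC addNr add0r.
have beq s m v : s \> b m v = b (s \> m) v + b m (s \> v).
  by rewrite /b eh /= -tensE.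
exists (bspan b); split.
- split; first exact: subsp_bspan.
  move=> x; apply: (@bspan_map _ _ _ _ _ b b (fun v : 'rV[F]_n => v *m rho x)).
    by move=> a u v; rewrite mulmxDl -scalemxAl.
  move=> m v; rewrite /b /= -tensE; apply: (subspD (subsp_bspan b)); last exact: bspanP.
  have /hP[m' <-] : P (h m *m tens_mx (- (rhoV x)^T) (rho x)) by apply: (aP x); apply/hP; exists m.
  exact: bspanP.
- have /hP[m mE] := PM0.
  have [v nv] : exists v : 'rV[F]_nV, v *m vec_mx (M0 : 'rV[F]_(nV * n)) != 0.
    apply: NNPP => no; case/eqP: nM0; rewrite -[M0]vec_mxK.
    rewrite (_ : vec_mx M0 = 0) ?linear0 //; apply: row_mx_eq => v; rewrite mulmx0.
    by apply/eqP/negPn/negP => nz; apply: no; exists v.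
  by exists (b m v); [exact: bspanP | rewrite /b mE].
- exact: (gsub_bilin sF FS bl br beq g1 gV).
Qed.

Lemma realizable_ext psi psi' : (forall x, psi x = psi' x) -> realizable psi -> realizable psi'.
Proof. by move=> e r n rho H [t nt tE]; apply: r; exists t => // x; rewrite e. Qed.

(** The factor with character [chi] may sit anywhere in the series, but the [pdef rhoV x] commute,
    so a common eigenvector exists; it is a column because it is needed in the dual module. *)
Lemma in_cl_col chi : in_cl j p pm rhoV chi ->
  exists2 y : 'cV[K]_nV, y != 0 & forall x, map_mx j (pdef rhoV x) *m y = chi x ^+ p *: y.
Proof.
move=> [k [c [[_ [_ cs]] [i ik cE]]]]; have [_ [_ [lt _]]] := cs i ik.
have [||y ny yE] := @common_null_col K nV L
  (fun x => map_mx j (pdef rhoV x) - (chi x ^+ p)%:M) (c i) (c i.+1) _ lt.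
- move=> x y; set A := map_mx j (pdef rhoV x); set B := map_mx j (pdef rhoV y).
  have AB : A *m B = B *m A by rewrite -!map_mxM pdef_commutes.
  rewrite [LHS]mulmxBl [RHS]mulmxBl !mulmxBr AB !mul_scalar_mx !mul_mx_scalar.
  rewrite !scale_scalar_mx (mulrC (chi y ^+ p)); vring.
- move=> x; apply/rV_subP => u /submxP[D ->]; rewrite mulmxA mulmxBr mul_mx_scalar.
  have := cE x (D *m c i.+1) (submxMl _ _).
  by rewrite /pdef map_mxB map_expmx.
exists y => // x; apply/eqP; rewrite -subr_eq0 -mul_scalar_mx -mulmxBl; apply/eqP; exact: yE.
Qed.

(** Each unit of a coefficient costs one use of [realizable_add]; the Frobenius map of [K] turns the
    p-th power of the sum into the sum of the weights. *)
Lemma realizable_span chi : Fp_span (in_cl j p pm rhoV) chi ->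
  realizable (fun x => chi x ^+ p).
Proof.
move=> [s [sC chiE]]; apply: (@realizable_ext (fun x => (\sum_(c <- s) c.1%:R * c.2 x) ^+ p)).
  by move=> x; rewrite chiE.
have pK : p \in [pchar K] by rewrite (fmorph_pchar j).
have addp (a b : K) : (a + b) ^+ p = a ^+ p + b ^+ p by exact: (pFrobenius_autD_comm pK (mulrC a b)).
elim: s sC {chiE chi} => [|[m chi] s IH] sC.
  by apply: realizable0 => x; rewrite big_nil expr0n; case: p (pcharf_prime pF).
have [|y ny yE] := @in_cl_col chi; first by apply: (sC (m, chi)); left.
have {}IH := IH (fun c h => sC c (or_intror h)).
elim: m {sC} => [|m IHm].
  by apply: realizable_ext IH => x; rewrite big_cons /= mul0r add0r.
apply: realizable_ext (realizable_add IHm (ex_intro2 _ _ y ny yE)) => x.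
by rewrite !big_cons /= -addp -natr1 mulrDl mul1r addrAC.
Qed.

Variables (nW : nat) (rhoW : L -> 'M[F]_nW) (HW : lie_rep rhoW).
Hypothesis clW : forall chi, in_cl j p pm rhoW chi -> Fp_span (in_cl j p pm rhoV) chi.

(** Over [K] some composition factor sits directly above [U]. By Schur it has a character, which
    lies in cl(W), and its vectors give eigenvectors in the scalar extension of W / U. *)
Lemma cluster_good : good Fo (res hf (rmod HW)).
Proof.
apply: (good_exhaust sF FS nzS) => U sU [v0 nv0].
have [Um UmP] := mx_of_subsp sU.1.
have stF x : (Um *m rhoW x <= Um)%MS.
  apply/rV_subP => u /submxP[D ->]; rewrite mulmxA.
  by apply/UmP; apply: (sU.2 x); apply/UmP; apply: submxMl.
pose UK := map_mx j Um; pose r x := map_mx j (rhoW x).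
have stU : mx_stable (fun _ : L => True) r UK by move=> x _; rewrite -map_mxM map_submx.
have nUK : ~~ (1%:M <= UK)%MS.
  rewrite -(map_mx1 j) map_submx.
  by apply/negP => h; apply: nv0; apply/UmP; apply: submx_trans h; apply: submx1.
have [k [c [i [cs ik ci]]]] := comp_series_through stU nUK.
have [_ [_ /(_ i ik)[sci [sci1 irr]]]] := cs.
have pdK x (C : 'M[K]_nW) : mx_stable (fun _ : L => True) r C -> (C *m map_mx j (pdef rhoW x) <= C)%MS.
  move=> sC; rewrite /pdef map_mxB map_expmx mulmxBr addmx_sub ?eqmx_opp ?(sC _ I) //.
  elim: (p) => [|m IH]; first by rewrite mulmx1.
  by rewrite mxexpSr mulmxA; apply: submx_trans (sC x I); apply: submxMr.
have exa x : exists a : K, forall u : 'rV[K]_nW, (u <= c i.+1)%MS ->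
    (u *m map_mx j (pdef rhoW x) - a ^+ p *: u <= c i)%MS.
  have [y _|a aE] := schur_scalar sci sci1 irr _ (pdK x _ sci) (pdK x _ sci1).
    by rewrite /r -!map_mxM pdef_comm.
  (* This is a p-th root of the Schur scalar: the monic equation x^p = a, given by its lower
     coefficients. *)
  have [b bE] := solve_monicpoly (fun m => if m == 0%N then a else 0) (prime_gt0 (pcharf_prime pF)).
  have p0 := prime_gt0 (pcharf_prime pF).
  exists b => u hu; rewrite bE (bigD1 (Ordinal p0)) //= expr0 mulr1 big1 ?addr0; first exact: aE.
  by move=> m; rewrite -val_eqE /= => /negPf ->; rewrite mul0r.
have [chi chiE] := choice_fun exa.
have /clW/realizable_span rz : in_cl j p pm rhoW chi.
  exists k, c; split=> //; exists i => // x u hu; rewrite -map_expmx -map_mxB; exact: chiE.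
(* [C] is the coordinate map of W / U and [B] a section of it, from a rank factorization of the
   cokernel; [realizable] needs the quotient as a matrix representation. *)
have [q [C [B [R [BC CR fR]]]]] : exists q (C : 'M[F]_(nW, q)) (B : 'M[F]_(q, nW)) R,
    [/\ B *m C = 1%:M, C *m R = cokermx Um & row_free R].
  have [B BC] := row_fullP (col_base_full (cokermx Um)).
  exists (\rank (cokermx Um)), (col_base (cokermx Um)), B, (row_base (cokermx Um)).
  by split=> //; [exact: mulmx_base | exact: row_base_free].
have kC (u : 'rV[F]_nW) : u *m C = 0 <-> (u <= Um)%MS.
  have -> : (u <= Um)%MS = (u *m C *m R == 0) by rewrite submxE -mulmxA CR.
  by rewrite mulmx_free_eq0 //; split=> /eqP.
have UC : Um *m C = 0.
  apply: row_mx_eq => v; rewrite mulmxA mulmx0; apply/kC; exact: submxMl.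
pose rT x := B *m rhoW x *m C.
have CrT x : rhoW x *m C = C *m rT x.
  apply: row_mx_eq => u; apply/eqP; rewrite -subr_eq0 /rT !mulmxA -!mulmxBl; apply/eqP/kC.
  apply: submx_trans (stF x); apply: submxMr; apply/kC.
  by rewrite mulmxBl -!mulmxA BC mulmx1 subrr.
have HT : lie_rep rT.
  have rTM x y : B *m (rhoW y *m rhoW x) *m C = rT y *m rT x.
    by rewrite -!mulmxA CrT !mulmxA.
  split=> [a x y|x y]; last by rewrite -!rTM -mulmxBl -mulmxBr -HW.2.
  by rewrite /rT HW.1 mulmxDr mulmxDl -scalemxAr -scalemxAl.
have CpT x : C *m pdef rT x = pdef rhoW x *m C.
  rewrite /pdef mulmxBr mulmxBl CrT; congr (_ - _).
  elim: (p) => [|m IH]; first by rewrite mulmx1 mul1mx.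
  by rewrite mxexpSr mulmxA IH [in RHS]mxexpSr -!mulmxA CrT.
have kCK (u : 'rV[K]_nW) : (u <= UK)%MS -> u *m map_mx j C = 0.
  by case/submxP=> D ->; rewrite -mulmxA -map_mxM UC map_mx0 mulmx0.
have [u hu nu] : exists2 u : 'rV[K]_nW, (u <= c i.+1)%MS & ~~ (u <= c i)%MS.
  case: irr => /andP[_ /row_subPn[a na]] _; exists (row a (c i.+1)) => //; exact: row_sub.
have [|P [sP nP gP]] := rz _ rT HT.
  exists (u *m map_mx j C) => [|x].
    apply: contra nu => /eqP e; rewrite ci submxE -map_cokermx.
    by rewrite -CR map_mxM mulmxA e mul0mx.
  rewrite -mulmxA -map_mxM CpT map_mxM mulmxA.
  have /kCK : (u *m map_mx j (pdef rhoW x) - chi x ^+ p *: u <= UK)%MS by rewrite -ci; apply: chiE.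
  by rewrite mulmxBl -scalemxAl => /eqP; rewrite subr_eq0 => /eqP.
exists (rmod HT), (fun v : 'rV[F]_nW => v *m C), P; split=> //.
- split=> [a v w|x v]; first by rewrite mulmxDl scalemxAl.
  by rewrite /= -mulmxA CrT mulmxA.
- by move=> v; exists (v *m B); rewrite -mulmxA BC mulmx1.
- by move=> v; rewrite -UmP; apply: kC.
Qed.

End Clusters.

Theorem theorem1
  (F : fieldType) (p : nat) (Fo : lie_class F)
  (K : closedFieldType) (f : {rmorphism F -> K})
  (L : lieAlgebra F) (pm : L -> L) (S : {vspace L})
  (nV nW : nat) (rhoV : L -> 'M[F]_nV) (rhoW : L -> 'M[F]_nW) :
  p \in [pchar F] ->
  saturated_formation Fo ->
  restricted p pm ->
  (forall z : L, in_centre z -> pm z = 0) ->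
  S != 0%VS -> subalgebra S -> subnormal S -> sub_in_class Fo S ->
  lie_rep rhoV -> lie_rep rhoW ->
  (forall chi : L -> K, in_cl f p pm rhoW chi -> Fp_span (in_cl f p pm rhoV) chi) ->
  Fhypercentral Fo S rhoV ->
  Fhypercentral Fo S rhoW.
Proof.
move=> pF sF rL zL nzS _ snS [M [g [FM [hg [injg img]]]]] HV HW clW hV.
have nzM : exists s : M, s != 0.
  have /img[s sE] := memv_pick S; exists s; apply: contraNneq nzS => s0.
  by rewrite -vpick0 -sE s0 (linf0 hg.1).
have gV := @Fhypercentral_good F Fo sF M FM nzM L g S hg img nV rhoV HV hV.
have gW := cluster_good sF FM nzM pF rL zL (good_adj sF FM nzM hg img snS) gV HW clW.
exact (good_Fhypercentral sF injg img gW).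
Qed.
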